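(* Assume that the Lévy process $\{z_t,t\in[0,T]\}$ is square integrable, that for each $t$, $\tilde\sigma(t,\cdot,\cdot)$ is Lipschitz continuous when $\mathbb R\times\mathcal P_2(\mathbb R)$ is endowed with the product of the canonical metric on $\mathbb R$ and the Vaserstein metric $d$ on $\mathcal P_2(\mathbb R)$, that for fixed $x\in\mathbb R$ and $\nu\in\mathcal P_2(\mathbb R)$, $\tilde\sigma(\cdot,x,\nu)$ is left continuous with right limits, and that $\int_0^T|\tilde\sigma(s,0,\delta_0)|^2ds<\infty$, where $\delta_0$ is the Dirac measure at $0$. Then, with $\tilde x^{i,n}$ and $\tilde x^i$ as defined in the context, $$\lim_{n\to\infty}\sup_{i\le n}\mathbb E\left(\sup_{t\le T}|\tilde x_t^{i,n}-\tilde x_t^i|^2\right)=0.$$ Moreover, if $\tilde\sigma(t,\tilde x,\nu)=\int_{\mathbb R}\eta(t,\tilde x,\tilde y)\,\nu(d\tilde y)$, where $\eta:[0,T]\times\mathbb R\times\mathbb R\to\mathbb R$ is a Lipschitz continuous function with respect to $(\tilde x,\tilde y)$ and left continuous with right limits with respect to $t$, then $$\sup_{i\le n}\mathbb E\left(\sup_{t\le T}|\tilde x_t^{i,n}-\tilde x_t^i|^2\right)\le\frac Cn,$$ where $C$ does not depend on $n$.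
   Context: $T>0$ and $(\Omega,\mathcal F,\mathbb P)$ is a complete probability space. $\{z_t\}$ is a Lévy process with values in $\mathbb R$; $\{\tilde\alpha_t,t\in[0,T]\}$ is a (càdlàg) Markov chain on the finite state space $\mathbb S=\{1,\dots,d\}$; $\tilde x(0)$ is a real random variable with $\mathbb E|\tilde x(0)|^2<\infty$; $\tilde x(0)$, $z$ and $\tilde\alpha$ are mutually independent. $\tilde\sigma:[0,T]\times\mathbb R\times\mathcal P(\mathbb R)\to\mathbb R$, where $\mathcal P(\mathbb R)$ is the space of probability measures on $\mathbb R$, and $r:\mathbb R\to\mathbb R$ is a positive continuous function. $\mathcal P_2(\mathbb R)$ is the space of probability measures on $\mathbb R$ with finite second moment, with the Vaserstein metric $$d(\mu,\nu)=\inf\left\{\left(\int_{\mathbb R\times\mathbb R}|x-y|^2Q(dx,dy)\right)^{1/2}:Q\in\mathcal P(\mathbb R\times\mathbb R)\text{ with marginals }\mu\text{ and }\nu\right\}.$$ Let $(\tilde x_0^i,z^i,\tilde\alpha^i)$, $i\ge1$, be a sequence of independent copies of $(\tilde x(0),z,\tilde\alpha)$. The interacting particles $\tilde x^{i,n}$, $i=1,\dots,n$, solve $$d\tilde x_t^{i,n}=\tilde\sigma(t,\tilde x_{t-}^{i,n},\mu_{t-}^n)\,r(\tilde\alpha_{t-}^i)\,dz_t^i,\quad t\in[0,T],\qquad \tilde x_0^{i,n}=\tilde x_0^i,$$ where $\mu^n=\frac1n\sum_{j=1}^n\delta_{\tilde x^{j,n}}$ is the empirical distribution (so $\mu^n_{t-}=\frac1n\sum_{j=1}^n\delta_{\tilde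 x^{j,n}_{t-}}$). The limit process $\tilde x^i$ is the unique solution, with $\mathbb E(\sup_{t\le T}|\tilde x^i_t|^2)<\infty$, of the nonlinear equation $$d\tilde x_t^i=\tilde\sigma(t,\tilde x_{t-}^i,\mathbb P_{t-})\,r(\tilde\alpha_{t-}^i)\,dz_t^i,\qquad \tilde x_0^i=\tilde x_0^i \text{ (the given initial value)},$$ where $\mathbb P_t$ is the probability distribution of $\tilde x_t^i$ (which does not depend on $i$) and $\mathbb P_{t-}$ is the distribution of $\tilde x^i_{t-}$.
   Formalization: The Lipschitz constants of σ̃(t,·,·) and of η(t,·,·) are taken uniform in t ∈ [0,T]; with an arbitrary constant for each t the limit claim fails (e.g. σ̃ = t^{-p}φ(t^{-q}·mean of ν), p>1/2, q>0, φ smooth supported in (1,2), z Brownian). *)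

(* Defs.v *)
From HB Require Import structures.
From mathcomp Require Import all_boot all_order all_algebra.
From mathcomp Require Import all_classical all_reals all_analysis.

Set Implicit Arguments.
Unset Strict Implicit.
Unset Printing Implicit Defensive.

Import Order.TTheory GRing.Theory Num.Theory.
Import numFieldNormedType.Exports.

Local Open Scope classical_set_scope.
Local Open Scope ring_scope.

Notation probR R := (probability (measurableTypeR R) R).

Section Paths.
Context {R : realType}.
Implicit Types (T t : R) (f : R -> R).

Definition cadlag T f :=
  (forall t, 0 <= t < T -> f s @[s --> t^'+] --> f t) /\
  (forall t, 0 < t <= T -> cvg (f s @[s --> t^'-])).

Definition caglad T f :=
  (forall t, 0 < t <= T -> f s @[s --> t^'-] --> f t) /\
  (forall t, 0 <= t < T -> cvg (f s @[s --> t^'+])).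

(* f(t-), with the convention f(0-) = f(0) *)
Definition lpart f t : R :=
  if t <= 0 then f t else lim (f s @[s --> t^'-]).

Definition supsq T f : \bar R :=
  ereal_sup [set (`|f t| ^+ 2)%:E | t in `[0, T]].

(* k intervals, hence the k+1 points t 0 <= ... <= t k of [0, T] *)
Definition grid T (k : nat) (t : nat -> R) :=
  [/\ 0 <= t 0%N, forall i, (i < k)%N -> t i <= t i.+1 & t k <= T].

End Paths.

Section Wasserstein.
Context {R : realType}.
Implicit Types mu nu : probR R.

Definition P2 : set (probR R) :=
  [set mu : probR R | (\int[mu]_x (`|x| ^+ 2)%:E < +oo)%E].

Definition coupling mu nu :
    set (probability (measurableTypeR R * measurableTypeR R)%type R) :=
  [set Q : probability _ R | (forall A, measurable A -> Q (A `*` setT) = mu A) /\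
           (forall B, measurable B -> Q (setT `*` B) = nu B)].

Definition vaserstein mu nu : \bar R :=
  ereal_inf [set ((\int[Q]_z (`|z.1 - z.2| ^+ 2)%:E) `^ 2^-1)%E
            | Q in coupling mu nu].

(* (1/n) \sum_(j < n) \d_(x j) for 0 < n: the total mass of the sum is n *)
Definition empirical (n : nat) (x : nat -> R) : probR R :=
  mnormalize (msum (fun j => \d_(x j : measurableTypeR R)) n)
    (\d_(0 : measurableTypeR R)).

End Wasserstein.

Section RandomVariables.
Context {R : realType} {disp : measure_display} {Omega : measurableType disp}.
Variable P : probability Omega R.
Implicit Types (T t : R) (X : Omega -> R) (G : set (set Omega)).

Definition meas_wrt G X :=
  forall B : set R, measurable B -> G (X @^-1` B).

Definition preimages (K : set (Omega -> R)) : set (set Omega) :=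
  [set A | exists2 X, K X & exists2 B, measurable B & A = X @^-1` B].

Definition sigma_of (K : set (Omega -> R)) : set (set Omega) :=
  <<s preimages K >>.

Definition is_law X (mu : probR R) :=
  measurable_fun setT X /\
  forall B : set R, measurable B -> mu B = P (X @^-1` B).

Definition mutual_indep (I : eqType) (G : I -> set (set Omega)) :=
  forall (J : seq I) (A : I -> set Omega), uniq J ->
    (forall i, i \in J -> G i (A i)) ->
    P (\big[setI/setT]_(i <- J) A i) = (\big[*%E/1%E]_(i <- J) P (A i))%E.

Definition cvg_in_prob0 (Y : nat -> Omega -> \bar R) :=
  forall e : R, 0 < e -> P [set w | (e%:E <= Y m w)%E] @[m --> \oo] --> 0%E.

End RandomVariables.

Section Driver.
Context {R : realType} {disp : measure_display} {Omega : measurableType disp}.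
Variable P : probability Omega R.
Implicit Types (T t : R).

(* stochastic continuity follows from the stationarity of the increments and
   the regularity of the paths *)
Definition levy_process T (z : R -> Omega -> R) :=
  [/\ forall t, 0 <= t <= T -> measurable_fun setT (z t),
      {ae P, forall w, z 0 w = 0 /\ cadlag T (z ^~ w)},
      forall k (t : nat -> R), grid T k t ->
        mutual_indep P (fun i : 'I_k =>
          sigma_of [set fun w => z (t i.+1) w - z (t i) w]) &
      forall s t : R, 0 <= s -> 0 <= t -> s + t <= T ->
        forall B : set R, measurable B ->
          P [set w | B (z (s + t) w - z s w)] = P (z t @^-1` B)].

Definition square_integrable T (z : R -> Omega -> R) :=
  forall t, 0 <= t <= T -> (\int[P]_w (`|z t w| ^+ 2)%:E < +oo)%E.

(* {1, ..., d}, embedded in the domain of r *)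
Definition state_space (d : nat) : set R := [set k.+1%:R | k in `I_d].

(* no time-homogeneity is required; the Markov property is written as a product
   to allow conditioning events of probability 0 *)
Definition markov_chain T (d : nat) (a : R -> Omega -> R) :=
  [/\ forall t, 0 <= t <= T -> measurable_fun setT (a t),
      forall t w, 0 <= t <= T -> state_space d (a t w),
      {ae P, forall w, cadlag T (a ^~ w)} &
      forall k (t b : nat -> R), grid T k.+1 t ->
        (P (\bigcap_(i in `I_k.+2) [set w | a (t i) w = b i]) *
         P [set w | a (t k) w = b k] =
         P (\bigcap_(i in `I_k.+1) [set w | a (t i) w = b i]) *
         P [set w | a (t k) w = b k /\ a (t k.+1) w = b k.+1])%E].

Record driver := Driver {
  ini : Omega -> R;
  lev : R -> Omega -> R;
  chain : R -> Omega -> R }.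

Definition observed (D : driver) t : set (Omega -> R) :=
  [set ini D] `|` [set lev D s | s in `[0, t]]
              `|` [set chain D s | s in `[0, t]].

Definition is_driver T (d : nat) (D : driver) :=
  [/\ measurable_fun setT (ini D) /\
        (\int[P]_w (`|ini D w| ^+ 2)%:E < +oo)%E,
      levy_process T (lev D),
      markov_chain T d (chain D) &
      mutual_indep P (fun k : 'I_3 => nth set0
        [:: sigma_of [set ini D];
            sigma_of [set lev D t | t in `[0, T]];
            sigma_of [set chain D t | t in `[0, T]]] k)].

(* D' has the same law as D, as a random element of R x D[0,T] x D[0,T] *)
Definition is_copy T (D D' : driver) :=
  [/\ measurable_fun setT (ini D'),
      forall t, 0 <= t <= T ->
        measurable_fun setT (lev D' t) /\ measurable_fun setT (chain D' t),
      {ae P, forall w, cadlag T (lev D' ^~ w) /\ cadlag T (chain D' ^~ w)} &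
      forall k (t : nat -> R) (A : set R) (B C : nat -> set R),
        (forall i, 0 <= t i <= T) -> measurable A ->
        (forall i, measurable (B i)) -> (forall i, measurable (C i)) ->
        let event (E : driver) := ini E @^-1` A `&` \bigcap_(i in `I_k)
          (lev E (t i) @^-1` B i `&` chain E (t i) @^-1` C i) in
        P (event D') = P (event D)].

Definition independent_copies T (D0 : driver) (D : nat -> driver) :=
  (forall i, is_copy T D0 (D i)) /\
  mutual_indep P (fun i => sigma_of (observed (D i) T)).

(* P-completed filtration generated by the data of index in J *)
Definition history (D : nat -> driver) (J : set nat) t : set (set Omega) :=
  <<s preimages (\bigcup_(j in J) observed (D j) t) `|` P.-negligible >>.

End Driver.

Section Ito.
Context {R : realType} {disp : measure_display} {Omega : measurableType disp}.
Variable P : probability Omega R.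
Variables (T : R) (F : R -> set (set Omega)).
Implicit Types z H I : R -> Omega -> R.

(* \sum_(k < pieces) coef k * 1_(knot k, knot k.+1] *)
Record simple_process := SimpleProcess {
  pieces : nat;
  knot : nat -> R;
  coef : nat -> Omega -> R }.

Definition simple_predictable (S : simple_process) :=
  grid T (pieces S) (knot S) /\
  forall k, (k < pieces S)%N ->
    meas_wrt (F (knot S k)) (coef S k) /\
    exists M : R, forall w, `|coef S k w| <= M.

Definition simple_val (S : simple_process) (s : R) (w : Omega) : R :=
  \sum_(k < pieces S) coef S k w * (knot S k < s <= knot S k.+1)%R%:R.

Definition simple_int (S : simple_process) z (t : R) (w : Omega) : R :=
  \sum_(k < pieces S) coef S k w *
    (z (Num.min t (knot S k.+1)) w - z (Num.min t (knot S k)) w).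

(* I is the Ito integral of H against z on [0, T], for z a square integrable
   Levy process with respect to F: the limit in probability, uniformly in time,
   of the integrals of simple processes converging to H in L^2(0, T), in
   probability *)
Definition ito_integral z H I :=
  exists S : nat -> simple_process,
  [/\ forall m, simple_predictable (S m),
      cvg_in_prob0 P (fun m w => (\int[lebesgue_measure]_(s in `[0%R, T])
        (`|simple_val (S m) s w - H s w| ^+ 2)%:E)%E) &
      cvg_in_prob0 P (fun m w =>
        supsq T (fun t => simple_int (S m) z t w - I t w))].

(* d x_t = H_t d z_t on [0, T], with x_0 = xi *)
Definition sde_solution (xi : Omega -> R) z H (x : R -> Omega -> R) :=
  [/\ {ae P, forall w, cadlag T (x ^~ w)},
      forall t : R, 0 <= t <= T -> meas_wrt (F t) (x t),
      {ae P, forall w, x 0 w = xi w} &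
      ito_integral z H (fun t w => x t w - xi w)].

End Ito.

Section MeanField.
Context {R : realType} {disp : measure_display} {Omega : measurableType disp}.
Variable P : probability Omega R.
Variables (T : R) (sigma : R -> R -> probR R -> R) (r : R -> R).
Variable D : nat -> @driver R disp Omega.

(* the system of the particles x 0, ..., x n.-1 *)
Definition particle_system (n : nat) (x : nat -> R -> Omega -> R) :=
  forall i, (i < n)%N ->
    sde_solution P T (history P D `I_n) (ini (D i)) (lev (D i))
      (fun t w => sigma t (lpart (x i ^~ w) t)
                    (empirical n (fun j => lpart (x j ^~ w) t)) *
                  r (lpart (chain (D i) ^~ w) t))
      (x i).

(* law t is the distribution of x_{t-}^i, the same for all i *)
Definition limit_processes (x : nat -> R -> Omega -> R) :=
  exists law : R -> probR R,
  (forall i (t : R), 0 <= t <= T -> is_law P (fun w => lpart (x i ^~ w) t) (law t)) /\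
  forall i,
    (\int[P]_w supsq T (x i ^~ w) < +oo)%E /\
    sde_solution P T (history P D [set i]) (ini (D i)) (lev (D i))
      (fun t w => sigma t (lpart (x i ^~ w) t) (law t) *
                  r (lpart (chain (D i) ^~ w) t))
      (x i).

Definition mean_sup_dist (n : nat) (x y : nat -> R -> Omega -> R) : \bar R :=
  ereal_sup [set (\int[P]_w supsq T (fun t => x i t w - y i t w)%R)%E
            | i in `I_n].

End MeanField.

Section Coefficients.
Context {R : realType}.
Variable T : R.

(* the Lipschitz constant is uniform in t; the product metric is taken to be the
   sum of the two metrics *)
Definition lipschitz_coef (sigma : R -> R -> probR R -> R) :=
  exists L : R, forall t : R, 0 <= t <= T ->
    forall (x y : R) (mu nu : probR R), P2 mu -> P2 nu ->
      (`|sigma t x mu - sigma t y nu|%:E <=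
       L%:E * (`|x - y|%:E + vaserstein mu nu))%E.

Definition caglad_coef (sigma : R -> R -> probR R -> R) :=
  forall (x : R) (nu : probR R), P2 nu -> caglad T (fun t => sigma t x nu).

Definition lipschitz_kernel (eta : R -> R -> R -> R) :=
  exists L : R, forall t : R, 0 <= t <= T -> forall x y x' y' : R,
    `|eta t x y - eta t x' y'| <= L * (`|x - x'| + `|y - y'|).

Definition caglad_kernel (eta : R -> R -> R -> R) :=
  forall x y : R, caglad T (fun t => eta t x y).

End Coefficients.

(* Main.v *)
(** Proof idea.  For a left-continuous, adapted and bounded coefficient the Ito integral against the
    Levy process is the limit in probability of the Riemann sums over the dyadic grids, so every
    estimate can be made on finite sums of independent stationary increments, for which Doob's maximal
    inequality is elementary.  The particles and their limits are driven by the same increments; the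
    errors e^j = x^{j,n} - x^j, localized to the event where all of them stay below N, therefore
    satisfy a Gronwall inequality whose source is
      E |sigma(t, x^i_{t-}, mu) - sigma(t, x^i_{t-}, P_{t-})|^2,
    with mu the empirical measure of the independent copies x^1_{t-}, ..., x^n_{t-}.  This source is
    small by the law of large numbers: uniformly in t after quantizing R into finitely many cells and
    coupling two measures on finitely many points through their common mass, and of order 1/n for a
    kernel, because the n centered terms of the average are orthogonal. *)
Require Import Defs.
From HB Require Import structures.
From mathcomp Require Import all_boot all_order all_algebra.
From mathcomp Require Import all_classical all_reals all_analysis.
From mathcomp Require Import measurable_realfun ring lra zify.
Import Order.TTheory GRing.Theory Num.Theory.
Import numFieldNormedType.Exports.
Local Open Scope classical_set_scope.
Local Open Scope ring_scope.
Set Implicit Arguments.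
Unset Strict Implicit.
Unset Printing Implicit Defensive.

(** * Expectations *)

(** Three obstacles shape the proof. Nothing is assumed on the moments of the particles, only the
    limit processes have a finite expected supremum; hence the localization, which gives the crude
    bound N to start from, and an iteration whose limit no longer contains N, so that Fatou's lemma
    can remove the localization. An Ito integral is given only by the existence of some
    approximating simple processes, unrelated from one integral to the next; the Riemann sums are
    approximations common to a particle and to its limit, and these can be subtracted. Finally, the
    independence of the limit processes is not a hypothesis: it holds because each one is adapted to
    the completed history of its own driver. The copies [D i] carry no Levy structure by assumption
    either; it is transported from [D0] through finite-dimensional laws. The increments need not be
    centered: over a step of length T / 2^p the mean is of order 2^-p, and Cauchy-Schwarz over the
    2^p steps makes the drift as cheap as the martingale part. Paths are regular only almost surely,
    whence the completed histories and the recourse to countably many times. *)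

Section Expectation.
Context {R : realType} {disp : measure_display} {Omega : measurableType disp}.
Variable P : probability Omega R.
Implicit Types f g X Y : Omega -> R.

Definition L1 f := P.-integrable setT (EFin \o f).
Definition L2 f := measurable_fun setT f /\ L1 (fun w => f w ^+ 2).
Local Notation E f := (\int[P]_w (f w)).

Lemma L1_meas f : L1 f -> measurable_fun setT f.
Proof. by move=> /measurable_int/measurable_EFinP. Qed.

Lemma L1_le f g : measurable_fun setT f -> L1 g ->
  (forall w, `|f w| <= g w) -> L1 f.
Proof.
move=> mf ig fg; apply: le_integrable ig => //; first exact/measurable_EFinP.
by move=> w _ /=; rewrite lee_fin (le_trans (fg w))// ler_norm.
Qed.

Lemma L1_cst (c : R) : L1 (fun=> c).
Proof. exact: finite_measure_integrable_cst. Qed.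

Lemma L1D f g : L1 f -> L1 g -> L1 (fun w => f w + g w).
Proof. by move=> /integrableD; exact. Qed.

Lemma L1B f g : L1 f -> L1 g -> L1 (fun w => f w - g w).
Proof. by move=> /integrableB; exact. Qed.

Lemma L1Z (c : R) f : L1 f -> L1 (fun w => c * f w).
Proof. by move=> /integrableZl; exact. Qed.

Lemma L1_norm f : L1 f -> L1 (fun w => `|f w|).
Proof. exact: integrable_norm. Qed.

Lemma L1_sum (I : eqType) (s : seq I) (F : I -> Omega -> R) :
  (forall i, i \in s -> L1 (F i)) -> L1 (fun w => \sum_(i <- s) F i w).
Proof.
elim: s => [_|i s ih h].
  by under [X in L1 X]funext do rewrite big_nil; exact: L1_cst.
under [X in L1 X]funext do rewrite big_cons.
apply: L1D; first by apply: h; rewrite mem_head.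
by apply: ih => j js; apply: h; rewrite in_cons js orbT.
Qed.

Lemma ED f g : L1 f -> L1 g -> E (fun w => f w + g w) = E f + E g.
Proof. by move=> *; rewrite RintegralD. Qed.

Lemma EB f g : L1 f -> L1 g -> E (fun w => f w - g w) = E f - E g.
Proof. by move=> *; rewrite RintegralB. Qed.

Lemma EZ (c : R) f : L1 f -> E (fun w => c * f w) = c * E f.
Proof. by move=> *; rewrite RintegralZl. Qed.

Lemma E_cst (c : R) : E (fun=> c) = c.
Proof.
rewrite Rintegral_cst// (_ : fine (P setT) = 1) ?mulr1//.
by rewrite -[RHS]/(fine 1%E); congr fine; exact: probability_setT.
Qed.

Lemma E_sum (I : eqType) (s : seq I) (F : I -> Omega -> R) :
  (forall i, i \in s -> L1 (F i)) ->
  E (fun w => \sum_(i <- s) F i w) = \sum_(i <- s) E (F i).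
Proof.
elim: s => [_|i s ih h].
  by under eq_Rintegral do rewrite big_nil; rewrite E_cst big_nil.
under eq_Rintegral do rewrite big_cons; rewrite big_cons ED//.
- by rewrite ih// => j js; apply: h; rewrite in_cons js orbT.
- by apply: h; rewrite mem_head.
- by apply: L1_sum => j js; apply: h; rewrite in_cons js orbT.
Qed.

Lemma E_le f g : L1 f -> L1 g -> (forall w, f w <= g w) -> E f <= E g.
Proof. by move=> *; apply: le_Rintegral. Qed.

Lemma E_ge0 f : (forall w, 0 <= f w) -> 0 <= E f.
Proof. by move=> h; apply: Rintegral_ge0. Qed.

Lemma EFin_E f : L1 f -> (E f)%:E = (\int[P]_w (f w)%:E)%E.
Proof. by move=> h; rewrite /Rintegral fineK//; exact: integrable_fin_num. Qed.

Lemma L1_lty f : measurable_fun setT f -> (forall w, 0 <= f w) ->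
  (\int[P]_w (f w)%:E < +oo)%E -> L1 f.
Proof.
move=> mf f0 fi; apply/integrableP; split; first exact/measurable_EFinP.
by under eq_integral do rewrite /= ger0_norm//.
Qed.

Lemma L1M_sqr f g : L2 f -> L2 g -> L1 (fun w => f w * g w).
Proof.
move=> [mf f2] [mg g2].
apply: (@L1_le _ (fun w => f w ^+ 2 + g w ^+ 2)).
- exact: measurable_funM.
- exact: L1D.
- move=> w; rewrite normrM -[f w ^+ 2]real_normK ?num_real//.
  rewrite -[g w ^+ 2]real_normK ?num_real//.
  have := sqr_ge0 (`|f w| - `|g w|); have := mulr_ge0 (normr_ge0 (f w)) (normr_ge0 (g w)).
  by lra.
Qed.

Lemma L2D f g : L2 f -> L2 g -> L2 (fun w => f w + g w).
Proof.
move=> lf lg; have [mf f2] := lf; have [mg g2] := lg.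
split; first exact: measurable_funD.
have -> : (fun w => (f w + g w) ^+ 2) =
    (fun w => (f w ^+ 2 + 2 * (f w * g w)) + g w ^+ 2).
  by apply/funext => w; ring.
by apply: L1D => //; apply: L1D => //; apply: L1Z; exact: L1M_sqr.
Qed.

Lemma L2Z (c : R) f : L2 f -> L2 (fun w => c * f w).
Proof.
move=> [mf f2]; split; first exact: measurable_funM.
by under [X in L1 X]funext do rewrite exprMn; exact: L1Z.
Qed.

Lemma L2B f g : L2 f -> L2 g -> L2 (fun w => f w - g w).
Proof.
move=> lf /(L2Z (-1)) /(L2D lf); congr L2.
by apply/funext => w; rewrite mulN1r.
Qed.

Lemma L2_cst (c : R) : L2 (fun=> c).
Proof. by split => //; exact: L1_cst. Qed.

Lemma L2_L1 f : L2 f -> L1 f.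
Proof.
move=> lf; have := L1M_sqr lf (L2_cst 1).
by congr L1; apply/funext => w; rewrite mulr1.
Qed.

Lemma L2_sum (I : eqType) (s : seq I) (F : I -> Omega -> R) :
  (forall i, i \in s -> L2 (F i)) -> L2 (fun w => \sum_(i <- s) F i w).
Proof.
elim: s => [_|i s ih h].
  by under [X in L2 X]funext do rewrite big_nil; exact: L2_cst.
under [X in L2 X]funext do rewrite big_cons.
apply: L2D; first by apply: h; rewrite mem_head.
by apply: ih => j js; apply: h; rewrite in_cons js orbT.
Qed.

Lemma L2_le f g : measurable_fun setT f -> L2 g ->
  (forall w, `|f w| <= `|g w|) -> L2 f.
Proof.
move=> mf [mg g2] fg; split => //.
apply: (L1_le _ g2); first exact: measurable_funX.
move=> w; rewrite normrX -[g w ^+ 2]real_normK ?num_real//.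
by rewrite lerXn2r ?nnegrE.
Qed.

Lemma L2_bounded f (M : R) : measurable_fun setT f ->
  (forall w, `|f w| <= M) -> L2 f.
Proof.
move=> mf fM; apply: (L2_le mf (L2_cst M)) => w.
by rewrite (le_trans (fM w))// ler_norm.
Qed.

Lemma E_sqr_ge0 f : 0 <= E (fun w => f w ^+ 2).
Proof. by apply: E_ge0 => w; exact: sqr_ge0. Qed.

Lemma L1_indic (A : set Omega) : measurable A -> L1 (\1_A).
Proof. by move=> mA; apply: integrable_indic. Qed.

Lemma E_indic (A : set Omega) : measurable A -> E (\1_A) = fine (P A).
Proof. by move=> mA; rewrite /Rintegral integral_indic// setIT. Qed.

(** Markov's inequality. *)
Lemma prob_le_E (A : set Omega) f (c : R) : measurable A -> L1 f -> 0 < c ->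
  (forall w, 0 <= f w) -> (forall w, A w -> c <= f w) ->
  (P A <= (E f / c)%:E)%E.
Proof.
move=> mA lf c0 f0 Af.
have PA : P A \is a fin_num by exact: fin_num_measure.
rewrite -(fineK PA) lee_fin ler_pdivlMr// mulrC -(E_indic mA).
rewrite -EZ; last exact: L1_indic.
apply: E_le => //; first by apply: L1Z; exact: L1_indic.
move=> w; rewrite indicE; case: (boolP (w \in A)) => [/set_mem/Af|_].
  by rewrite mulr1.
by rewrite mulr0.
Qed.

Lemma ae_E_eq f g : measurable_fun setT f -> measurable_fun setT g ->
  {ae P, forall w, f w = g w} -> E f = E g.
Proof.
move=> mf mg fg; congr fine; apply: ae_eq_integral => //.
- exact/measurable_EFinP.
- exact/measurable_EFinP.
- by apply: filterS fg => w /= ->.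
Qed.

Lemma ae_L1 f g : measurable_fun setT g -> L1 f ->
  {ae P, forall w, f w = g w} -> L1 g.
Proof.
move=> mg lf fg; have mf := L1_meas lf.
apply/integrableP; split; first exact/measurable_EFinP.
move/integrableP : lf => [_]; apply: le_lt_trans; rewrite le_eqVlt; apply/orP; left.
apply/eqP/ae_eq_integral => //.
- by apply: measurableT_comp => //; exact/measurable_EFinP.
- by apply: measurableT_comp => //; exact/measurable_EFinP.
- by apply: filterS fg => w /= ->.
Qed.

Lemma E_dominated (f_ : nat -> Omega -> R) f g :
  (forall n, measurable_fun setT (f_ n)) -> measurable_fun setT f ->
  {ae P, forall w, f_ n w @[n --> \oo] --> f w} -> L1 g ->
  {ae P, forall w n, `|f_ n w| <= g w} ->
  L1 f /\ E (f_ n) @[n --> \oo] --> E f.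
Proof.
move=> mf_ mf cf lg fg.
have [] := @dominated_convergence _ _ _ P setT measurableT
  (fun n => EFin \o f_ n) (EFin \o f) (EFin \o g).
- by move=> n; exact/measurable_EFinP.
- exact/measurable_EFinP.
- by apply: filterS cf => w h _; apply: cvg_EFin => //; exact: nearW.
- exact: lg.
- by apply: filterS fg => w h n _ /=; rewrite lee_fin.
move=> lf _ h; split => //.
by apply: fine_cvg; rewrite -/(E f) EFin_E.
Qed.

End Expectation.
Arguments L1 {R disp Omega} P f.
Arguments L2 {R disp Omega} P f.

(** * Independence *)

Section Independence.
Context {R : realType} {disp : measure_display} {Omega : measurableType disp}.
Variable P : probability Omega R.
Implicit Types (A B : set Omega) (G K : set (set Omega)).

Definition indep2 G K :=
  forall A B, G A -> K B -> P (A `&` B) = (P A * P B)%E.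

Lemma ae_P_eq A B : measurable A -> measurable B ->
  {ae P, forall w, A w <-> B w} -> P A = P B.
Proof.
move=> mA mB AB.
have h : {ae P, forall w, (\1_A w : R) = \1_B w}.
  apply: filterS AB => w [ab ba]; rewrite !indicE.
  by congr (_ %:R); congr nat_of_bool; apply/idP/idP => /set_mem ?; apply/mem_set; auto.
have H := ae_E_eq (measurable_indic mA) (measurable_indic mB) h.
rewrite !E_indic// in H.
by rewrite -[LHS]fineK ?fin_num_measure// H fineK// fin_num_measure.
Qed.

Lemma indep2S G K G' K' : G' `<=` G -> K' `<=` K -> indep2 G K -> indep2 G' K'.
Proof. by move=> GG KK GK A B /GG ? /KK ?; exact: GK. Qed.

(** For a fixed [B], the restriction of [P] to [B] and the multiple of [P] by [P B] are finite
    measures that agree on the intersection-stable class [G], hence on the sigma-algebra it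
    generates. *)
Lemma indep2_sigma G K : setI_closed G -> G setT -> G `<=` measurable ->
  K `<=` measurable -> indep2 G K -> indep2 <<s G >> K.
Proof.
move=> GI GT mG mK GK A B sA KB; have mB := mK _ KB.
pose b : {nonneg R} := NngNum (fine_ge0 (measure_ge0 P B)).
have bE : (b%:num)%:E = P B by rewrite /= fineK//; exact: fin_num_measure.
pose m1 : {measure set Omega -> \bar R} := mrestr P mB.
pose m2 : {measure set Omega -> \bar R} := mscale b P.
have -> : P (A `&` B) = m1 A by [].
have -> : (P A * P B = m2 A)%E by rewrite muleC -bE.
apply: (@g_sigma_algebra_measure_unique _ _ _ G mG (fun=> setT)) => //.
- by rewrite predeqE => w; split => // _; exists 0%N.
- move=> X GX; have -> : m1 X = P (X `&` B) by [].
  by rewrite GK// muleC -bE.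
- move=> _; apply: le_lt_trans (ltry 1).
  have -> : m1 setT = P (setT `&` B) by [].
  by rewrite setTI probability_le1.
Qed.

Lemma indep2C G K : indep2 G K -> indep2 K G.
Proof. by move=> GK A B KA GB; rewrite setIC GK// muleC. Qed.

(** The sets almost surely equal to a member of [<<s G >>] form a sigma-algebra that contains [G]
    and the negligible sets. *)
Lemma sigma_completion G A : <<s G `|` P.-negligible >> A ->
  exists A', <<s G >> A' /\ {ae P, forall w, A w <-> A' w}.
Proof.
have s0 : sigma_algebra setT <<s G >> by exact: smallest_sigma_algebra.
case: s0 => s0 sC sU.
pose H := [set A | exists A', <<s G >> A' /\ {ae P, forall w, A w <-> A' w}].
suff: <<s G `|` P.-negligible >> `<=` H by exact.
apply: smallest_sub; first split.
- by exists set0; split => //; exact: aeW.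
- move=> X [X' [sX aX]]; exists (setT `\` X'); split; first exact: sC.
  by apply: filterS aX => w [h1 h2]; split => -[_ nX]; split => // ?; apply: nX; auto.
- move=> F /choice[F' F'F]; exists (\bigcup_k F' k); split.
    by apply: sU => k; case: (F'F k).
  have : {ae P, forall w, forall k, F k w <-> F' k w}.
    by apply: ae_foralln => k; case: (F'F k).
  apply: filterS => w h; split => -[k _ Fk]; exists k => //; exact/h.
- move=> X [GX|[N [mN N0 XN]]].
    by exists X; split; [exact: sub_sigma_algebra|exact: aeW].
  exists set0; split => //; exists N; split => // w /= h; apply: XN.
  by apply: contrapT => nX; apply: h; split.
Qed.

Lemma sigma_measurable G : G `<=` measurable -> <<s G >> `<=` measurable.
Proof. by move=> mG; apply: smallest_sub => //; exact: sigma_algebra_measurable. Qed.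

Lemma indep2_completion G K : measure_is_complete P -> G `<=` measurable ->
  K `<=` measurable -> indep2 <<s G >> K -> indep2 <<s G `|` P.-negligible >> K.
Proof.
move=> cP mG mK GK A B sA KB; have mB := mK _ KB.
have mA : measurable A.
  by apply: sigma_measurable sA => X [/mG//|/cP].
have [A' [sA' AA']] := sigma_completion sA.
have mA' : measurable A' by exact: sigma_measurable sA'.
rewrite (ae_P_eq mA mA' AA') -GK//; apply: ae_P_eq.
- exact: measurableI.
- exact: measurableI.
- by apply: filterS AA' => w [h1 h2]; split => -[hA hB]; split; auto.
Qed.

Lemma in_bigsetI (I : eqType) (s : seq I) (F : I -> set Omega) w :
  (\big[setI/setT]_(i <- s) F i) w <-> forall i, i \in s -> F i w.
Proof.
elim: s => [|i s ih]; first by rewrite big_nil.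
rewrite big_cons; split => [[Fi /ih h] j|h].
  by rewrite in_cons => /predU1P[->//|/h].
split; first by apply: h; rewrite mem_head.
by apply/ih => j js; apply: h; rewrite in_cons js orbT.
Qed.

Lemma bigsetI_closed (I : eqType) (s : seq I) (F : I -> set Omega) G :
  G setT -> setI_closed G -> (forall i, i \in s -> G (F i)) ->
  G (\big[setI/setT]_(i <- s) F i).
Proof.
move=> GT GI; elim: s => [|i s ih] h; first by rewrite big_nil.
rewrite big_cons; apply: GI; first by apply: h; rewrite mem_head.
by apply: ih => j js; apply: h; rewrite in_cons js orbT.
Qed.

(** Finite intersections of events of the [G j] form an intersection-stable generating class. In
    such an intersection, [B] in [K] is either merged with the factor of index [i], inside [H i],
    and split off again by the independence of [G i] and [K], or it becomes the missing factor of
    index [i]. The typical case: [H j] is all of driver [j], [G j] its past, and [K] a future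
    increment of driver [i]. *)
Lemma indep2_join (I : eqType) (H G : I -> set (set Omega)) K (J : set I) (i : I) :
  mutual_indep P H ->
  (forall j, H j `<=` measurable) ->
  (forall j, setI_closed (H j)) ->
  (forall j, J j -> [/\ G j `<=` H j, setI_closed (G j) & G j setT]) ->
  K `<=` H i -> (J i -> indep2 (G i) K) ->
  indep2 <<s \bigcup_(j in J) G j >> K.
Proof.
move=> indH mH HI GJ KH iGK.
pose C := [set A | exists (s : seq I) (F : I -> set Omega),
  [/\ uniq s, forall j, j \in s -> J j /\ G j (F j) &
      A = \big[setI/setT]_(j <- s) F j]].
have mK : K `<=` measurable by move=> A /KH /mH.
have GH j A : J j -> G j A -> H j A by move=> /GJ[+ _ _]; exact.
have CT : C setT by exists [::], (fun=> setT); split => //; rewrite big_nil.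
have CI : setI_closed C.
  move=> _ _ [s [F [us hF ->]]] [s' [F' [us' hF' ->]]].
  exists (undup (s ++ s')), (fun j => (if j \in s then F j else setT) `&`
    (if j \in s' then F' j else setT)); split.
  - exact: undup_uniq.
  - move=> j; rewrite mem_undup mem_cat => js.
    have Jj : J j by case/orP: js => [/hF|/hF'] [].
    have [_ GjI GjT] := GJ _ Jj.
    split => //; apply: GjI.
      by case: ifPn => // /hF[].
    by case: ifPn => // /hF'[].
  - apply/seteqP; split => w.
      move=> [/in_bigsetI h /in_bigsetI h']; apply/in_bigsetI => j _.
      by split; case: ifPn => //; auto.
    move/in_bigsetI => h; split; apply/in_bigsetI => j js.
      by have := h j; rewrite mem_undup mem_cat js/= => /(_ isT)[].
    by have := h j; rewrite mem_undup mem_cat js orbT => /(_ isT)[].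
have mC : C `<=` measurable.
  move=> _ [s [F [_ hF ->]]]; apply: bigsetI_closed => //.
    by move=> ? ?; exact: measurableI.
  by move=> j /hF[Jj /(GH _ _ Jj)/mH].
have CK : indep2 C K.
  move=> _ B [s [F [us hF ->]]] KB.
  have HF j : j \in s -> H j (F j) by move=> /hF[Jj /(GH _ _ Jj)].
  have [si|si] := boolP (i \in s).
    have [Ji GF] := hF _ si.
    pose F' j := if j == i then F j `&` B else F j.
    have HF' j : j \in s -> H j (F' j).
      move=> js; rewrite /F'; case: eqP => [->|_]; last exact: HF.
      by apply: HI; [exact: HF|exact: KH].
    have -> : \big[setI/setT]_(j <- s) F j `&` B = \big[setI/setT]_(j <- s) F' j.
      apply/seteqP; split => w.
        move=> [/in_bigsetI h Bw]; apply/in_bigsetI => j js.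
        by rewrite /F'; case: ifPn => _; [split; auto|auto].
      move/in_bigsetI => h; split.
        by apply/in_bigsetI => j /h; rewrite /F'; case: ifPn => // _ [].
      by have := h _ si; rewrite /F' eqxx => -[].
    rewrite (indH _ _ us HF') (indH _ _ us HF).
    rewrite (bigD1_seq i)//= [in RHS](bigD1_seq i)//= /F' eqxx iGK// muleAC.
    congr (_ * _ * _)%E; apply: eq_bigr => j /negbTE ->//.
  pose F' j := if j == i then B else F j.
  have F'F j : j \in s -> F' j = F j.
    by rewrite /F'; case: eqP => // ->; rewrite (negbTE si).
  have HF' j : j \in i :: s -> H j (F' j).
    rewrite in_cons => /predU1P[->|js]; first by rewrite /F' eqxx; exact: KH.
    by rewrite F'F//; exact: HF.
  have -> : \big[setI/setT]_(j <- s) F j `&` B = \big[setI/setT]_(j <- i :: s) F' j.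
    rewrite big_cons {1}/F' eqxx setIC; congr (_ `&` _).
    by apply: eq_big_seq => j /F'F.
  rewrite indH//=; last by rewrite si.
  rewrite big_cons {1}/F' eqxx muleC; congr (_ * _)%E.
  rewrite indH//; apply: eq_big_seq => j /F'F -> //.
apply: (@indep2S <<s C >> K) => //; last exact: indep2_sigma.
apply: smallest_sub; first exact: smallest_sigma_algebra.
move=> A [j Jj GA]; apply: sub_sigma_algebra.
exists [:: j], (fun=> A); split => //.
  by move=> k; rewrite inE => /eqP ->.
by rewrite big_seq1.
Qed.

Lemma measure_eq_prod d1 d2 (T1 : measurableType d1) (T2 : measurableType d2)
    (m1 m2 : {measure set (T1 * T2) -> \bar R}) :
  (m1 setT < +oo)%E ->
  (forall (A : set T1) (B : set T2), measurable A -> measurable B ->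
    m1 (A `*` B) = m2 (A `*` B)) ->
  forall X, measurable X -> m1 X = m2 X.
Proof.
move=> m1T m12 X.
rewrite measurable_prod_measurableType.
apply: (@g_sigma_algebra_measure_unique _ _ _ _ _ (fun=> setT)) => //.
- by move=> _ [A mA [B mB <-]]; exact: measurableX.
- by move=> _; exists setT => //; exists setT => //; rewrite setXTT.
- by rewrite predeqE => w; split => // _; exists 0%N.
- move=> _ _ [A mA [B mB <-]] [A' mA' [B' mB' <-]].
  exists (A `&` A'); first exact: measurableI.
  exists (B `&` B'); first exact: measurableI.
  by rewrite setXI.
- by move=> _ [A mA [B mB <-]]; exact: m12.
Qed.

End Independence.

(** * Product laws and expectations under independence *)

Section ProductLaw.
Context {R : realType} {disp : measure_display} {Omega : measurableType disp}.
Variable P : probability Omega R.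
Context d1 d2 (T1 : measurableType d1) (T2 : measurableType d2).
Variables (X : {mfun Omega >-> T1}) (Y : {mfun Omega >-> T2}).
Hypothesis indXY : forall A B, measurable A -> measurable B ->
  P (X @^-1` A `&` Y @^-1` B) = (P (X @^-1` A) * P (Y @^-1` B))%E.

Let XY w := (X w, Y w).

Let mXY : measurable_fun setT XY.
Proof. by apply/measurable_fun_pairP; split => //. Qed.

HB.instance Definition _ := isMeasurableFun.Build _ _ _ _ XY mXY.

Lemma product_law (A : set (T1 * T2)) : measurable A ->
  (distribution P X \x distribution P Y)%E A = distribution P XY A.
Proof.
move=> mA.
by apply: product_measure_unique => //= B C mB mC; rewrite -indXY.
Qed.

Lemma indep_L1 (f : T1 * T2 -> R) : measurable_fun setT f ->
  L1 P (fun w => f (X w, Y w)) ->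
  (\int[P]_w f (X w, Y w))%:E =
  (\int[distribution P X]_x \int[distribution P Y]_y (f (x, y))%:E)%E.
Proof.
move=> mf lf.
have mf' : measurable_fun setT (EFin \o f) by exact/measurable_EFinP.
have i1 : (distribution P XY).-integrable setT (EFin \o f).
  exact: integrable_pushforward.
have eqm (g : T1 * T2 -> \bar R) :
    (\int[distribution P X \x distribution P Y]_z g z =
     \int[distribution P XY]_z g z)%E.
  by apply: eq_measure_integral => A mA _; exact: product_law.
have i2 : (distribution P X \x distribution P Y)%E.-integrable setT (EFin \o f).
  by apply/integrableP; split => //; move/integrableP : i1 => [_]; rewrite eqm.
rewrite EFin_E// (@integral12_prod_meas1 _ _ _ _ _ _ _ (EFin \o f))//.
by rewrite eqm integral_distribution.
Qed.

End ProductLaw.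

Section IndepExpectation.
Context {R : realType} {disp : measure_display} {Omega : measurableType disp}.
Variable P : probability Omega R.

Lemma eq_law_L1 (X Y : Omega -> R) (f : R -> R) : measurable_fun setT X ->
  measurable_fun setT Y -> measurable_fun setT f ->
  (forall B, measurable B -> P (X @^-1` B) = P (Y @^-1` B)) ->
  L1 P (fun w => f (X w)) ->
  L1 P (fun w => f (Y w)) /\ \int[P]_w f (X w) = \int[P]_w f (Y w).
Proof.
move=> mX mY mf XY lf.
pose X' : {mfun Omega >-> R} := mfun_Sub (mem_set mX).
pose Y' : {mfun Omega >-> R} := mfun_Sub (mem_set mY).
have eqP' A : measurable A -> A `<=` setT -> distribution P X' A = distribution P Y' A.
  by move=> mA _; exact: XY.
have mf' : measurable_fun setT (EFin \o f) by exact/measurable_EFinP.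
have mabs : measurable_fun setT (fun x => `|(f x)%:E|%E).
  exact: measurableT_comp mf'.
have lY : L1 P (fun w => f (Y w)).
  apply/integrableP; split; first by apply/measurable_EFinP; exact: measurableT_comp.
  move/integrableP : lf => [_].
  have := @ge0_integral_distribution _ _ _ _ _ P X' (fun x => `|(f x)%:E|%E).
  rewrite /comp/= => <- //.
  have := @ge0_integral_distribution _ _ _ _ _ P Y' (fun x => `|(f x)%:E|%E).
  rewrite /comp/= => <- //.
  by rewrite (eq_measure_integral _ eqP').
split=> //; congr fine.
have := @integral_distribution _ _ _ _ _ P X' (EFin \o f) mf' lf.
have := @integral_distribution _ _ _ _ _ P Y' (EFin \o f) mf' lY.
by rewrite /comp/= => <- <-; rewrite (eq_measure_integral _ eqP').
Qed.

(** The integrability of the product comes from Tonelli's theorem under the product law, so first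
    moments suffice. This matters in [C_sqr], where the factors are themselves squares and no fourth
    moment is available. *)
Lemma indep_EM (X Y : Omega -> R) : L1 P X -> L1 P Y ->
  (forall A B : set R, measurable A -> measurable B ->
  P (X @^-1` A `&` Y @^-1` B) = (P (X @^-1` A) * P (Y @^-1` B))%E) ->
  L1 P (fun w => X w * Y w) /\
  \int[P]_w (X w * Y w) = \int[P]_w X w * \int[P]_w Y w.
Proof.
move=> lX lY iXY; have mX := L1_meas lX; have mY := L1_meas lY.
pose X' : {mfun Omega >-> R} := mfun_Sub (mem_set mX).
pose Y' : {mfun Omega >-> R} := mfun_Sub (mem_set mY).
pose f (z : R * R) : R := z.1 * z.2.
have mf : measurable_fun setT f by apply: measurable_funM.
have lXY : L1 P (fun w => X w * Y w).
  pose g (z : R * R) := (`|z.1 * z.2|)%:E.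
  have mg : measurable_fun setT g.
    by apply/measurable_EFinP; apply: measurableT_comp.
  apply/integrableP; split; first by apply/measurable_EFinP; exact: measurable_funM.
  have pl := @product_law _ _ _ P _ _ _ _ X' Y' iXY.
  have -> : (\int[P]_x `|(EFin \o (fun w => X w * Y w)%R) x| =
     \int[distribution P X' \x distribution P Y']_z g z)%E.
    pose XY : Omega -> R * R := fun w => (X w, Y w).
    have mXY : measurable_fun setT XY by apply/measurable_fun_pairP; split.
    pose XY' : {mfun Omega >-> _} := mfun_Sub (mem_set mXY).
    rewrite (eq_measure_integral (distribution P XY')); last first.
      by move=> A mA _; exact: pl.
    by rewrite ge0_integral_distribution// => z; rewrite lee_fin.
  rewrite fubini_tonelli1//=; last by move=> z; rewrite /g lee_fin.
  rewrite /fubini_F.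
  have h x : (\int[distribution P Y']_y g (x, y) = `|x|%:E * (\int[P]_w `|Y w|)%:E)%E.
    under eq_integral do rewrite /g/= normrM EFinM.
    rewrite ge0_integralZl//; last first.
      by apply: measurableT_comp => //; exact: measurableT_comp.
    rewrite EFin_E; last exact: L1_norm.
    rewrite ge0_integral_distribution//.
    by apply: measurableT_comp => //; exact: measurableT_comp.
  under eq_integral do rewrite h.
  rewrite ge0_integralZr//; last 2 first.
  - by apply: measurableT_comp => //; exact: measurableT_comp.
  - by rewrite lee_fin; apply: E_ge0.
  rewrite ge0_integral_distribution//; last first.
    by apply: measurableT_comp => //; exact: measurableT_comp.
  by rewrite -(EFin_E (L1_norm lX)) -EFinM ltry.
split => //; apply: EFin_inj.
rewrite (@indep_L1 _ _ _ P _ _ _ _ X' Y' iXY f mf lXY).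
have h x : (\int[distribution P Y']_y (f (x, y))%:E = x%:E * (\int[P]_w Y w)%:E)%E.
  under eq_integral do rewrite /f/= EFinM.
  rewrite integralZl//; last first.
    by apply: integrable_pushforward => //; exact: lY.
  rewrite EFin_E// integral_distribution//.
under eq_integral do rewrite h.
rewrite integralZr//; last by apply: integrable_pushforward => //; exact: lX.
by rewrite EFinM (EFin_E lX) (integral_distribution _ lX).
Qed.

End IndepExpectation.

(** * Independence of the increments from the history *)

Section SubSigmaAlgebra.
Context {R : realType} {disp : measure_display} {Omega : measurableType disp}.
Variable P : probability Omega R.
Implicit Types (A B : set Omega) (G K : set (set Omega)).

(** Moves measurability with respect to a generated sigma-algebra to a type that carries it, where
    the closure lemmas on sums, products and limits apply. *)
Lemma meas_wrtP G (X : Omega -> R) :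
  meas_wrt <<s G >> X <-> measurable_fun (setT : set (g_sigma_algebraType G)) X.
Proof.
split => h; first by move=> _ B mB; rewrite setTI; exact: h.
by move=> B mB; have := h measurableT B mB; rewrite setTI.
Qed.

Lemma meas_wrtS G K (X : Omega -> R) : G `<=` K -> meas_wrt G X -> meas_wrt K X.
Proof. by move=> GK h B mB; apply/GK/h. Qed.

Lemma sigma_sub G K : G `<=` <<s K >> -> <<s G >> `<=` <<s K >>.
Proof. by move=> GK; apply: smallest_sub => //; exact: smallest_sigma_algebra. Qed.

Lemma sigmaT G : <<s G >> setT.
Proof. exact: (@measurableT _ (g_sigma_algebraType G)). Qed.

Lemma sigmaI G : setI_closed <<s G >>.
Proof. by move=> A B; exact: (@measurableI _ (g_sigma_algebraType G)). Qed.

Lemma meas_sigma_of (S : set (Omega -> R)) X : S X -> meas_wrt (sigma_of S) X.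
Proof. by move=> SX B mB; apply: sub_sigma_algebra; exists X => //; exists B. Qed.

Lemma sigma_of_measurable (S : set (Omega -> R)) :
  (forall X, S X -> measurable_fun setT X) -> sigma_of S `<=` measurable.
Proof.
move=> mS; apply: sigma_measurable => _ [X SX [B mB ->]].
by rewrite -[X in measurable X]setTI; exact: mS.
Qed.

Lemma sigma_ofS (S S' : set (Omega -> R)) :
  (forall X, S X -> meas_wrt (sigma_of S') X) -> sigma_of S `<=` sigma_of S'.
Proof. by move=> SS; apply: sigma_sub => _ [X SX [B mB ->]]; exact: SS. Qed.

Lemma measurable_preim (X : Omega -> R) (B : set R) : measurable_fun setT X ->
  measurable B -> measurable (X @^-1` B).
Proof. by move=> mX mB; rewrite -[X in measurable X]setTI; exact: mX. Qed.

Lemma sigma_bigcap G (k : nat) (F : nat -> set Omega) :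
  (forall i, (i < k)%N -> <<s G >> (F i)) -> <<s G >> (\bigcap_(i in `I_k) F i).
Proof.
move=> h; rewrite bigcap_mkord.
by apply: (@bigsetI_measurable _ (g_sigma_algebraType G)) => i _; exact: h.
Qed.

End SubSigmaAlgebra.

Section LevyIndep.
Context {R : realType} {disp : measure_display} {Omega : measurableType disp}.
Variable P : probability Omega R.
Variables (T : R) (z : R -> Omega -> R).
Hypothesis levy : levy_process P T z.

(** [levy_process] speaks of increments along a grid, here of values at unordered times. The times
    are sorted into a grid that ends with [s] and [u]; each value is almost surely a sum of
    increments before [s], and these are independent of the last increment. *)
Lemma levy_indep_fd (s u : R) k (t : nat -> R) (B : nat -> set R) (A : set Omega) :
  0 <= s -> s <= u -> u <= T -> (forall i, 0 <= t i <= s) ->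
  (forall i, measurable (B i)) ->
  sigma_of [set fun w => z u w - z s w] A ->
  P ((\bigcap_(i in `I_k) z (t i) @^-1` B i) `&` A) =
  (P (\bigcap_(i in `I_k) z (t i) @^-1` B i) * P A)%E.
Proof.
move=> s0 su uT ts mB sA; have [mz aez indz _] := levy.
have sT : s <= T by exact: le_trans uT.
have mzt r : 0 <= r <= T -> measurable_fun setT (z r) by exact: mz.
pose S := sort <=%O [seq t i | i <- iota 0 k].
have sizeS : size S = k by rewrite size_sort size_map size_iota.
have S_s r : r \in S -> 0 <= r <= s.
  by rewrite mem_sort => /mapP[i _ ->].
(* This makes k+3 grid points and k+2 increments; the last one, of index k+1, is [z u - z s]. *)
pose L := 0 :: S ++ [:: s; u].
have sizeL : size L = k.+3 by rewrite /= size_cat sizeS addn2.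
pose g := nth u L.
have Lsorted : sorted <=%O L.
  rewrite /= cat_path; apply/andP; split.
    rewrite path_sortedE; last exact: le_trans.
    rewrite sort_sorted ?andbT; last exact: le_total.
    by apply/allP => r /S_s /andP[].
  rewrite /= su !andbT.
  have : last 0 S \in 0 :: S by exact: mem_last.
  by rewrite in_cons => /predU1P[->//|/S_s/andP[]].
have gk1 : g k.+1 = s by rewrite /g /L /= nth_cat sizeS ltnn subnn.
have gk2 : g k.+2 = u by rewrite /g /L /= nth_cat sizeS ltnNge leqnSn/= subSnn.
have gr : grid T k.+2 g.
  split; first by [].
    by move=> i ik; move/(sortedP u): Lsorted; apply; rewrite sizeL.
  by rewrite gk2.
have g_in i : 0 <= g i <= T.
  have uT' : 0 <= u <= T by rewrite uT (le_trans s0 su).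
  have [il|il] := ltnP i (size L); last by rewrite /g nth_default.
  have := mem_nth u il; rewrite -/g in_cons mem_cat => /predU1P[->|].
    by rewrite lexx (le_trans s0 sT).
  case/orP => [/S_s/andP[-> h]|]; first by rewrite (le_trans h sT).
  by rewrite !inE => /orP[/eqP->|/eqP->//]; rewrite s0 sT.
pose inc (i : 'I_k.+2) := fun w => z (g i.+1) w - z (g i) w.
pose G (i : 'I_k.+2) := sigma_of [set inc i].
have minc i : measurable_fun setT (inc i) by apply: measurable_funB; exact: mzt.
have mG i : G i `<=` measurable.
  by apply: sigma_of_measurable => _ ->.
pose i0 : 'I_k.+2 := ord_max.
pose J : set 'I_k.+2 := [set i | i != i0].
have GA : G i0 A by rewrite /G /inc /= gk1 gk2.
have ind : indep2 P <<s \bigcup_(j in J) G j >> (G i0).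
  apply: (@indep2_join _ _ _ _ _ G G (G i0) J i0 (indz _ _ gr)) => //.
  - by move=> j; exact: sigmaI.
  - by move=> j _; split => //; [exact: sigmaI|exact: sigmaT].
  - by rewrite /J /= eqxx.
have [m mt] : exists m : nat -> nat, forall i, (i < k)%N ->
    (m i <= k)%N /\ g (m i) = t i.
  suff : forall i, exists m, (i < k)%N -> (m <= k)%N /\ g m = t i.
    by move=> /choice[m hm]; exists m.
  move=> i; exists (index (t i) S).+1 => ik.
  have tS : t i \in S.
    by rewrite mem_sort; apply/mapP; exists i => //; rewrite mem_iota.
  have lt : (index (t i) S < k)%N by rewrite -sizeS index_mem.
  by split => //; rewrite /g /L /= nth_cat sizeS lt nth_index.
pose f i := fun w => \sum_(j < k.+2 | (j < m i)%N) inc j w.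
(* The sum telescopes to [z (t i) - z 0], and [z 0] vanishes only almost surely; the event is
   therefore exchanged for [E] below. *)
have fz : {ae P, forall w, forall i, (i < k)%N -> z (t i) w = f i w}.
  apply: filterS aez => w [z0 _] i ik; have [mk <-] := mt _ ik.
  have mk2 : (m i <= k.+2)%N by exact: leq_trans mk (leqW (leqnSn k)).
  rewrite /f -(big_ord_widen _ (fun j => z (g j.+1) w - z (g j) w) mk2).
  rewrite -(big_mkord predT (fun j => z (g j.+1) w - z (g j) w)).
  by rewrite telescope_sumr// [X in _ - X]z0 subr0.
pose E := \bigcap_(i in `I_k) f i @^-1` B i.
have sE : <<s \bigcup_(j in J) G j >> E.
  apply: sigma_bigcap => i ik; have [mk _] := mt _ ik.
  suff : meas_wrt <<s \bigcup_(j in J) G j >> (f i) by apply.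
  apply/meas_wrtP.
  have -> : f i = fun w => \sum_(j < k.+2) (if (j < m i)%N then inc j w else 0).
    by apply/funext => w; rewrite /f big_mkcond.
  apply: measurable_sum => j.
  case: (boolP (j < m i)%N) => jm; last exact: measurable_cst.
  apply/meas_wrtP; apply: (@meas_wrtS _ _ _ (G j)); last exact: meas_sigma_of.
  move=> X GX; apply: sub_sigma_algebra; exists j => //.
  rewrite /J /= -val_eqE /= neq_ltn (leq_trans jm)//.
  exact: leq_trans mk _.
have mE : measurable E.
  by apply: sigma_measurable sE => X [j _ /mG].
have mA : measurable A by exact: mG GA.
have mZ : measurable (\bigcap_(i in `I_k) z (t i) @^-1` B i).
  rewrite bigcap_mkord; apply: bigsetI_measurable => i _.
  apply: measurable_preim => //; apply: mzt.
  by have /andP[-> h] := ts i; exact: le_trans h sT.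
have ZE : {ae P, forall w, (\bigcap_(i in `I_k) z (t i) @^-1` B i) w <-> E w}.
  by apply: filterS fz => w h; split => hh i ik; have := hh i ik; rewrite /= (h _ ik).
rewrite (ae_P_eq mZ mE ZE) -ind//; apply: ae_P_eq.
- exact: measurableI.
- exact: measurableI.
- by apply: filterS ZE => w [h1 h2]; split => -[]; split; auto.
Qed.

End LevyIndep.

Section DriverIndep.
Context {R : realType} {disp : measure_display} {Omega : measurableType disp}.
Variable P : probability Omega R.
Implicit Types D : @driver R disp Omega.

Definition cylinder D k (t : nat -> R) (A : set R) (B C : nat -> set R) : set Omega :=
  ini D @^-1` A `&` \bigcap_(i in `I_k)
          (lev D (t i) @^-1` B i `&` chain D (t i) @^-1` C i).

(** An intersection-stable class whose sigma-algebra contains all that is observed up to [s]. These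
    are the events that [is_copy] transports between drivers. *)
Definition cylinders D (s : R) : set (set Omega) :=
  [set X | exists k t A B C, [/\ forall i, 0 <= t i <= s, measurable A,
    forall i, measurable (B i), forall i, measurable (C i) &
    X = cylinder D k t A B C]].

Lemma cylindersT D s : 0 <= s -> cylinders D s setT.
Proof.
move=> s0; exists 0%N, (fun=> 0), setT, (fun=> setT), (fun=> setT); split => //.
  by rewrite lexx.
by rewrite /cylinder preimage_setT setTI; apply/esym/seteqP; split.
Qed.

Lemma cylindersI D s : setI_closed (cylinders D s).
Proof.
move=> _ _ [k [t [A [B [C [ht mA mB mC ->]]]]]] [k' [t' [A' [B' [C' [ht' mA' mB' mC' ->]]]]]].
pose u (V : Type) (f f' : nat -> V) i := if (i < k)%N then f i else f' (i - k)%N.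
exists (k + k')%N, (u _ t t'), (A `&` A'), (u _ B B'), (u _ C C'); split.
- by move=> i; rewrite /u; case: ifP.
- exact: measurableI.
- by move=> i; rewrite /u; case: ifP.
- by move=> i; rewrite /u; case: ifP.
apply/seteqP; split => w.
  move=> [[Aw h] [A'w h']]; split => // i /= ik; rewrite /u; case: ltnP => ki.
    exact: h.
  by apply: h' => /=; lia.
move=> [[Aw A'w] h]; split; split => // i /= ik.
  by have := h i; rewrite /u ik; apply => /=; lia.
have := h (k + i)%N; rewrite /u ltnNge leq_addr/= addKn; apply => /=; lia.
Qed.

Lemma observed_cylinders D s : 0 <= s -> sigma_of (observed D s) `<=` <<s cylinders D s >>.
Proof.
move=> s0; apply: sigma_sub => _ [X + [B mB ->]].
have in0 : 0 <= (0:R) <= s by rewrite lexx.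
case=> [[->|[t ts <-]]|[t ts <-]]; apply: sub_sigma_algebra.
- exists 0%N, (fun=> 0), B, (fun=> setT), (fun=> setT); split => //.
  by apply/seteqP; split => [w Bw|w []].
- exists 1%N, (fun=> t), setT, (fun=> B), (fun=> setT); split => //.
  by apply/seteqP; split => [w Bw|w [_ /(_ 0%N)[]]].
- exists 1%N, (fun=> t), setT, (fun=> setT), (fun=> B); split => //.
  by apply/seteqP; split => [w Bw|w [_ /(_ 0%N)[]]].
Qed.

Variables (T : R) (d : nat) (D0 : @driver R disp Omega).
Hypothesis D0_driver : is_driver P T d D0.

(** The increment belongs to the sigma-algebra of the Levy process, so it joins the second of the
    three independent factors, which [levy_indep_fd] then splits. *)
Lemma driver_indep_fd (s u : R) k t A B C E :
  0 <= s -> s <= u -> u <= T -> (forall i, 0 <= t i <= s) ->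
  measurable A -> (forall i, measurable (B i)) -> (forall i, measurable (C i)) ->
  measurable E ->
  let I := (fun w => lev D0 u w - lev D0 s w) @^-1` E in
  P (cylinder D0 k t A B C `&` I) = (P (cylinder D0 k t A B C) * P I)%E.
Proof.
move=> s0 su uT ts mA mB mC mE I; have [[mi _] levy _ ind] := D0_driver.
have sT : s <= T by exact: le_trans uT.
have tT i : 0 <= t i <= T by have /andP[-> h] := ts i; exact: le_trans h sT.
pose X0 := ini D0 @^-1` A.
pose X1 := \bigcap_(i in `I_k) lev D0 (t i) @^-1` B i.
pose X2 := \bigcap_(i in `I_k) chain D0 (t i) @^-1` C i.
have sI : sigma_of [set fun w => lev D0 u w - lev D0 s w] I.
  by apply: meas_sigma_of.
pose H (k : 'I_3) := nth set0 [:: sigma_of [set ini D0];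
            sigma_of [set lev D0 t | t in `[0, T]];
            sigma_of [set chain D0 t | t in `[0, T]]] k.
have inT r : 0 <= r <= T -> r \in `[0, T] by rewrite in_itv.
have s1 : sigma_of [set lev D0 t | t in `[0, T]] X1.
  apply: sigma_bigcap => i ik; apply: meas_sigma_of => //.
  by exists (t i) => //; exact: inT.
have s1I : sigma_of [set lev D0 t | t in `[0, T]] (X1 `&` I).
  apply: sigmaI => //; move: sI; apply: sigma_ofS => _ ->.
  apply/meas_wrtP; apply: measurable_funB; apply/meas_wrtP; apply: meas_sigma_of.
    by exists u => //; apply: inT; rewrite uT (le_trans s0).
  by exists s => //; apply: inT; rewrite sT s0.
have s0' : sigma_of [set ini D0] X0 by exact: meas_sigma_of.
have s2 : sigma_of [set chain D0 t | t in `[0, T]] X2.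
  apply: sigma_bigcap => i ik; apply: meas_sigma_of => //.
  by exists (t i) => //; exact: inT.
have three (Y : set Omega) : sigma_of [set lev D0 t | t in `[0, T]] Y ->
    P (X0 `&` (Y `&` X2)) = (P X0 * (P Y * P X2))%E.
  move=> sY; pose F (k : 'I_3) := nth set0 [:: X0; Y; X2] k.
  have := ind (enum 'I_3) F (enum_uniq _).
  rewrite !big_enum/= !big_ord_recl !big_ord0/= setIT mule1; apply.
  by move=> [[|[|[|//]]] i3] _.
have -> : cylinder D0 k t A B C = X0 `&` (X1 `&` X2).
  by rewrite /cylinder bigcapI.
have -> : X0 `&` (X1 `&` X2) `&` I = X0 `&` ((X1 `&` I) `&` X2).
  by rewrite -!setIA; congr (_ `&` (_ `&` _)); rewrite setIC.
rewrite !three// (@levy_indep_fd _ _ _ P T _ levy s u k t B I)//.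
by rewrite -!muleA; congr (_ * (_ * _))%E; rewrite muleC.
Qed.

(** [is_copy] compares values, not increments. Restricted to the cylinder, the laws of the pair of
    values at [u] and [s] are two finite measures on the plane; they agree on rectangles, hence on
    the preimage of [E] under subtraction. *)
Lemma copy_increment D (s u : R) k t A B C E : is_copy P T D0 D ->
  0 <= s -> s <= u -> u <= T -> (forall i, 0 <= t i <= T) ->
  measurable A -> (forall i, measurable (B i)) -> (forall i, measurable (C i)) ->
  measurable E ->
  let I (X : @driver R disp Omega) := (fun w => lev X u w - lev X s w) @^-1` E in
  P (cylinder D k t A B C `&` I D) = P (cylinder D0 k t A B C `&` I D0).
Proof.
move=> [mi mz _ cp] s0 su uT tT mA mB mC mE I.
have sin : 0 <= s <= T by rewrite s0 (le_trans su).
have uin : 0 <= u <= T by rewrite uT (le_trans s0).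
have [[mi0 _] [mz0 _ _ _] [mc0 _ _ _] _] := D0_driver.
have mcyl (X : @driver R disp Omega) : measurable_fun setT (ini X) ->
    (forall t, 0 <= t <= T -> measurable_fun setT (lev X t)) ->
    (forall t, 0 <= t <= T -> measurable_fun setT (chain X t)) ->
    measurable (cylinder X k t A B C).
  move=> h1 h2 h3; apply: measurableI; first exact: measurable_preim.
  rewrite bigcap_mkord; apply: bigsetI_measurable => i _.
  by apply: measurableI; apply: measurable_preim; auto.
have m0 := mcyl D0 mi0 mz0 mc0.
have m1 := mcyl D mi (fun t h => (mz t h).1) (fun t h => (mz t h).2).
have mp (X : @driver R disp Omega) :
    (forall t, 0 <= t <= T -> measurable_fun setT (lev X t)) ->
    measurable_fun setT (fun w => (lev X u w, lev X s w)).
  by move=> h; apply/measurable_fun_pairP; split; apply: h.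
pose p0 : {mfun Omega >-> (R * R)%type} := mfun_Sub (mem_set (mp D0 mz0)).
pose p1 : {mfun Omega >-> (R * R)%type} :=
  mfun_Sub (mem_set (mp D (fun t h => (mz t h).1))).
pose n0' : {measure set (R * R) -> \bar R} := pushforward (mrestr P m0) p0.
pose n1' : {measure set (R * R) -> \bar R} := pushforward (mrestr P m1) p1.
pose n0 := n0' (mp D0 mz0).
pose n1 := n1' (mp D (fun t h => (mz t h).1)).
pose E' : set (R * R) := (fun z : R * R => z.1 - z.2) @^-1` E.
have mE' : measurable E'.
  rewrite -[E']setTI; have : measurable_fun setT (fun z : R * R => z.1 - z.2).
    by apply: measurable_funB.
  by apply.
have -> : P (cylinder D k t A B C `&` I D) = n1 E'.
  by rewrite setIC.
have -> : P (cylinder D0 k t A B C `&` I D0) = n0 E'.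
  by rewrite setIC.
apply: measure_eq_prod => //.
  rewrite (_ : n1 setT = P (setT `&` cylinder D k t A B C))//.
  by rewrite (le_lt_trans (probability_le1 _ _)) ?ltry// setTI.
move=> U V mU mV.
(* The cylinder gets two further coordinates: time [u] at index k and time [s] at index k+1. *)
pose ext (x y : R) (i : nat) : R := if (i < k)%N then t i else if i == k then x else y.
pose exs (F : nat -> set R) (X Y : set R) (i : nat) : set R :=
  if (i < k)%N then F i else if i == k then X else Y.
have := cp k.+2 (ext u s) A (exs B U V) (exs C setT setT).
have e (X : @driver R disp Omega) :
    ini X @^-1` A `&` \bigcap_(i in `I_k.+2) (lev X (ext u s i) @^-1` exs B U V i `&`
      chain X (ext u s i) @^-1` exs C setT setT i) =
    (fun w => (lev X u w, lev X s w)) @^-1` (U `*` V) `&` cylinder X k t A B C.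
  apply/seteqP; split => w.
    move=> [Aw h]; split; last first.
      split => // i ik; have := h i; rewrite /ext /exs [in (i < k)%N]ik.
      by apply; rewrite /= (leq_trans ik)// leqW.
    split => /=.
      have := h k; rewrite /ext /exs ltnn eqxx => -[]//=.
    have := h k.+1; rewrite /ext /exs ltnNge leqnSn/= gtn_eqF// => -[]//=.
  move=> [[/= Uw Vw] [Aw h]]; split => // i /=; rewrite /ext /exs => ik.
  case: ltnP => ki; first exact: h.
  by case: ifPn => _.
rewrite /= !e; apply => //.
- by move=> i; rewrite /ext; case: ifP => // _; case: ifP.
- by move=> i; rewrite /exs; case: ifP => // _; case: ifP.
- by move=> i; rewrite /exs; case: ifP => // _; case: ifP.
Qed.

End DriverIndep.

Section CopiesIndep.
Context {R : realType} {disp : measure_display} {Omega : measurableType disp}.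
Variable P : probability Omega R.
Hypothesis cP : measure_is_complete P.
Variables (T : R) (d : nat) (D0 : @driver R disp Omega).
Variable D : nat -> @driver R disp Omega.
Hypothesis D0_driver : is_driver P T d D0.
Hypothesis D_copies : independent_copies P T D0 D.

Lemma lev_meas i t : 0 <= t <= T -> measurable_fun setT (lev (D i) t).
Proof. by move=> tT; have [/(_ i)[_ h _ _] _] := D_copies; case: (h _ tT). Qed.

Lemma chain_meas i t : 0 <= t <= T -> measurable_fun setT (chain (D i) t).
Proof. by move=> tT; have [/(_ i)[_ h _ _] _] := D_copies; case: (h _ tT). Qed.

Lemma observed_meas i s X : s <= T -> observed (D i) s X -> measurable_fun setT X.
Proof.
have [/(_ i)[mi _ _ _] _] := D_copies.
move=> sT [[->//|[t + <-]]|[t + <-]]; rewrite /= in_itv/= => /andP[t0 ts].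
  by apply: lev_meas; rewrite t0 (le_trans ts).
by apply: chain_meas; rewrite t0 (le_trans ts).
Qed.

Lemma observedS i s u : s <= u -> observed (D i) s `<=` observed (D i) u.
Proof.
move=> su X [[->|[t + <-]]|[t + <-]]; rewrite /= ?in_itv/=.
- by left; left.
- move=> /andP[t0 ts]; left; right; exists t => //.
  by rewrite /= in_itv/= t0 (le_trans ts).
- move=> /andP[t0 ts]; right; exists t => //.
  by rewrite /= in_itv/= t0 (le_trans ts).
Qed.

Lemma history_mono J J' s u : J `<=` J' -> s <= u ->
  history P D J s `<=` history P D J' u.
Proof.
move=> JJ su; apply: sigma_sub => A [[X [j Jj oX] [B mB ->]]|nA]; apply: sub_sigma_algebra.
  left; exists X; last by exists B.
  by exists j; [exact: JJ|exact: observedS oX].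
by right.
Qed.

Lemma history_measurable J s : s <= T -> history P D J s `<=` measurable.
Proof.
move=> sT; apply: sigma_measurable => A [[X [j Jj oX] [B mB ->]]|]; last exact: cP.
by apply: measurable_preim => //; exact: observed_meas oX.
Qed.

(** The guard [J i] covers two uses: a future increment of a driver that may itself be observed
    ([increment_indep]), and a driver outside [J], for which nothing is to be checked
    ([history_indep]). *)
Lemma history_indep_gen J s i K : s <= T -> K `<=` sigma_of (observed (D i) T) ->
  (J i -> indep2 P (sigma_of (observed (D i) s)) K) ->
  indep2 P (history P D J s) K.
Proof.
move=> sT KH iK; have [_ ind] := D_copies.
have mH j : sigma_of (observed (D j) T) `<=` measurable.
  by apply: sigma_of_measurable => X; exact: observed_meas.
have ssub j : sigma_of (observed (D j) s) `<=` sigma_of (observed (D j) T).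
  by apply: sigma_ofS => X /(observedS sT); exact: meas_sigma_of.
pose G j := sigma_of (observed (D j) s).
have mG : \bigcup_(j in J) G j `<=` measurable by move=> X [j _ /ssub/mH].
apply: (@indep2S _ _ _ _ <<s (\bigcup_(j in J) G j) `|` P.-negligible >> K) => //.
  apply: sigma_sub => A [[X [j Jj oX] [B mB ->]]|nA]; apply: sub_sigma_algebra.
    by left; exists j => //; exact: meas_sigma_of.
  by right.
apply: indep2_completion => //; first by move=> X /KH/mH.
apply: (@indep2_join _ _ _ _ _ (fun j => sigma_of (observed (D j) T)) G K J i) => //.
- by move=> j; exact: sigmaI.
- by move=> j _; split; [exact: ssub|exact: sigmaI|exact: sigmaT].
Qed.

Lemma history_indep J J' i : ~ J i -> J' `<=` [set i] ->
  indep2 P (history P D J T) (history P D J' T).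
Proof.
move=> nJ J'i; apply: indep2C.
have mH j : sigma_of (observed (D j) T) `<=` measurable.
  by apply: sigma_of_measurable => X; exact: observed_meas.
apply: (@indep2S _ _ _ _ <<s sigma_of (observed (D i) T) `|` P.-negligible >>
  (history P D J T)) => //.
  apply: sigma_sub => A [[X [j /J'i -> oX] [B mB ->]]|nA]; apply: sub_sigma_algebra.
    by left; exact: meas_sigma_of.
  by right.
apply: indep2_completion => //; first exact: history_measurable.
apply: (@indep2S _ _ _ _ (sigma_of (observed (D i) T)) (history P D J T)) => //.
  by apply: sigma_sub.
by apply: indep2C; apply: (@history_indep_gen J T i) => // /nJ.
Qed.

Let event_increment i s u k t A B C E : 0 <= s -> s <= u -> u <= T ->
  (forall i, 0 <= t i <= T) ->
  measurable A -> (forall i, measurable (B i)) -> (forall i, measurable (C i)) ->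
  measurable E ->
  P (cylinder (D i) k t A B C `&` (fun w => lev (D i) u w - lev (D i) s w) @^-1` E) =
  P (cylinder D0 k t A B C `&` (fun w => lev D0 u w - lev D0 s w) @^-1` E).
Proof.
move=> *; have [/(_ i) cp _] := D_copies.
exact: (copy_increment D0_driver).
Qed.

Lemma increment_law i s u (E : set R) : 0 <= s -> s <= u -> u <= T -> measurable E ->
  P ((fun w => lev (D i) u w - lev (D i) s w) @^-1` E) = P (lev D0 (u - s) @^-1` E).
Proof.
move=> s0 su uT mE; have [_ [_ _ _ stat] _ _] := D0_driver.
rewrite -(stat s (u - s))// ?subr_ge0//; last by rewrite addrC subrK.
rewrite [s + _]addrC subrK.
have T0 : 0 <= T by rewrite (le_trans s0) ?(le_trans su).
have := @event_increment i s u 0%N (fun=> 0) setT (fun=> setT) (fun=> setT) E s0 su uT.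
have cyl X : cylinder X 0 (fun=> 0) setT (fun=> setT) (fun=> setT) = setT.
  by apply/seteqP; split.
by rewrite !cyl !setTI; apply => // _; rewrite lexx.
Qed.

(** Only [D0] is known to be a driver: cylinders and increments of [D i] are carried to [D0],
    factorized there, and carried back. The other drivers and the null sets enter through
    [history_indep_gen]. *)
Lemma increment_indep J i s u : 0 <= s -> s <= u -> u <= T ->
  indep2 P (history P D J s)
    (preimages [set fun w => lev (D i) u w - lev (D i) s w]).
Proof.
move=> s0 su uT.
have sT : s <= T by exact: le_trans uT.
have inc_meas : meas_wrt (sigma_of (observed (D i) T))
    (fun w => lev (D i) u w - lev (D i) s w).
  apply/meas_wrtP; apply: measurable_funB; apply/meas_wrtP; apply: meas_sigma_of.
    by left; right; exists u => //; rewrite /= in_itv/= uT (le_trans s0).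
  by left; right; exists s => //; rewrite /= in_itv/= sT s0.
have mH : sigma_of (observed (D i) T) `<=` measurable.
  by apply: sigma_of_measurable => X; exact: observed_meas.
have KH : preimages [set fun w => lev (D i) u w - lev (D i) s w] `<=`
    sigma_of (observed (D i) T).
  by move=> _ [_ -> [E mE ->]]; exact: inc_meas.
apply: (history_indep_gen sT KH) => _.
apply: (@indep2S _ _ _ _ <<s cylinders (D i) s >>
  (preimages [set fun w => lev (D i) u w - lev (D i) s w])) => //.
  exact: observed_cylinders.
have [mi mlc _ _] := (D_copies.1 i).
apply: indep2_sigma.
- exact: cylindersI.
- exact: cylindersT.
- move=> _ [k [t [A [B [C [ts mA mB mC ->]]]]]].
  have tT j : 0 <= t j <= T by have /andP[-> h] := ts j; exact: le_trans h sT.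
  apply: measurableI; first exact: measurable_preim.
  rewrite bigcap_mkord; apply: bigsetI_measurable => j _.
  by apply: measurableI; apply: measurable_preim; auto; case: (mlc _ (tT j)).
- exact: subset_trans KH mH.
move=> _ _ [k [t [A [B [C [ts mA mB mC ->]]]]]] [_ -> [E mE ->]].
have tT j : 0 <= t j <= T by have /andP[-> h] := ts j; exact: le_trans h sT.
rewrite event_increment// (driver_indep_fd D0_driver)//; congr (_ * _)%E.
  have [/(_ i)[_ _ _ cp] _] := D_copies.
  exact/esym/(cp k t A B C tT mA mB mC).
have := @event_increment i s u 0%N t setT (fun=> setT) (fun=> setT) E s0 su uT tT.
have cyl X : cylinder X 0 t setT (fun=> setT) (fun=> setT) = setT.
  by apply/seteqP; split.
by rewrite !cyl !setTI => ->.
Qed.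

Lemma chain_law i t (E : set R) : 0 <= t <= T -> measurable E ->
  P (chain (D i) t @^-1` E) = P (chain D0 t @^-1` E).
Proof.
move=> tT mE; have [/(_ i)[_ _ _ cp] _] := D_copies.
have := cp 1%N (fun=> t) setT (fun=> setT) (fun=> E).
have e (X : @driver R disp Omega) : ini X @^-1` setT `&` \bigcap_(j in `I_1)
    (lev X t @^-1` setT `&` chain X t @^-1` E) = chain X t @^-1` E.
  by apply/seteqP; split => [w [_ /(_ 0%N)[]]|w].
by rewrite /= !e; apply.
Qed.

End CopiesIndep.

(** * Maximal inequalities for finite sums *)

Section RunningMax.
Context {R : realType}.
Implicit Types M : nat -> R.

(** The start at 0 makes this the running maximum of the positive part. The negative part is reached
    through the opposite sequence, in [runmax_sqr_ge]. *)
Fixpoint runmax M n : R :=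
  if n is n'.+1 then Num.max (runmax M n') (M n) else 0.

Lemma runmax_ge0 M n : 0 <= runmax M n.
Proof. by elim: n => //= n ih; rewrite le_max ih. Qed.

Lemma runmax_ge M n j : M 0%N = 0 -> (j <= n)%N -> M j <= runmax M n.
Proof.
move=> M0; elim: n => [|n ih]; first by rewrite leqn0 => /eqP ->; rewrite M0.
rewrite leq_eqVlt ltnS => /predU1P[->/=|/ih h]; first by rewrite le_max lexx orbT.
by rewrite /= le_max h.
Qed.

(* Doob's L^2 inequality in pathwise form: for a martingale [M] the sum on the right has mean zero. *)
Lemma runmax_pathwise M n : M 0%N = 0 ->
  runmax M n ^+ 2 <= 4 * M n ^+ 2 -
    4 * \sum_(k < n) runmax M k * (M k.+1 - M k).
Proof.
move=> M0; set S := \sum_(k < n) _.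
(* Summation by parts against the maximum; then [runmax * M] is at most [runmax ^ 2 / 4 + M ^ 2]. *)
suff : runmax M n ^+ 2 / 2 + S <= runmax M n * M n.
  by have := sqr_ge0 (runmax M n - 2 * M n); lra.
rewrite /S {S}; elim: n => [|n ih]; first by rewrite big_ord0 M0 /=; lra.
rewrite big_ord_recr/=; set S := \sum_(k < n) _ in ih *.
have r0 := runmax_ge0 M n.
have [le|lt] := leP (runmax M n) (M n.+1).
  by have := sqr_ge0 (M n.+1 - runmax M n); lra.
by lra.
Qed.

Lemma runmax_sqr_ge M n j : M 0%N = 0 -> (j <= n)%N ->
  M j ^+ 2 <= runmax M n ^+ 2 + runmax (fun k => - M k) n ^+ 2.
Proof.
move=> M0 jn; have h1 := runmax_ge M0 jn.
have h2 : - M j <= runmax (fun k => - M k) n by apply: runmax_ge => //; rewrite M0 oppr0.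
have := runmax_ge0 M n; have := runmax_ge0 (fun k => - M k) n.
set A := runmax M n in h1 *; set B := runmax _ n in h2 *.
move=> B0 A0; have [M0'|M0'] := leP 0 (M j).
  have : M j ^+ 2 <= A ^+ 2 by rewrite lerXn2r// nnegrE.
  by have := sqr_ge0 B; lra.
have : (- M j) ^+ 2 <= B ^+ 2 by rewrite lerXn2r// nnegrE; lra.
by rewrite sqrrN; have := sqr_ge0 A; lra.
Qed.

Lemma sqr_sum_le (n : nat) (u : nat -> R) J : (J <= n)%N ->
  (\sum_(k < J) u k) ^+ 2 <= n%:R * \sum_(k < n) u k ^+ 2.
Proof.
move=> Jn; apply: (@le_trans _ _ (J%:R * \sum_(k < J) u k ^+ 2)); last first.
  apply: ler_pM => //.
  - by apply: sumr_ge0 => k _; exact: sqr_ge0.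
  - by rewrite ler_nat.
  - rewrite (big_ord_widen _ (fun k => u k ^+ 2) Jn) [leRHS](bigID (fun k : 'I_n => (k < J)%N))/=.
    by rewrite lerDl; apply: sumr_ge0 => k _; exact: sqr_ge0.
elim: J {Jn} => [|J ih]; first by rewrite !big_ord0; lra.
rewrite !big_ord_recr/=; set S := \sum_(i < J) u i in ih *.
set Q := \sum_(i < J) u i ^+ 2 in ih *; set v := u J.
have h : 2 * (S * v) <= Q + J%:R * v ^+ 2.
  have -> : J%:R * v ^+ 2 = \sum_(i < J) v ^+ 2.
    by rewrite sumr_const card_ord mulr_natl.
  rewrite /S /Q mulr_suml mulr_sumr -big_split/=; apply: ler_sum => i _.
  by have := sqr_ge0 (u i - v); lra.
by rewrite -natr1; lra.
Qed.

(** The test at [k] includes the term [k], so the bound [c] is never overshot, while the test still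
    depends on terms up to [k] only and keeps the truncation adapted. The induction also carries
    that the truncated sum is below the full one. *)
Lemma truncated_sqr_sum (n : nat) (u : nat -> R) (c : R) : 0 <= c ->
  \sum_(k < n) (if \sum_(i < k.+1) u i ^+ 2 <= c then u k else 0) ^+ 2 <= c.
Proof.
move=> c0; pose u' k := if \sum_(i < k.+1) u i ^+ 2 <= c then u k else 0.
suff : \sum_(k < n) u' k ^+ 2 <= c /\ \sum_(k < n) u' k ^+ 2 <= \sum_(k < n) u k ^+ 2.
  by case.
elim: n => [|n [ih1 ih2]]; first by rewrite !big_ord0.
rewrite !big_ord_recr/= {2 4}/u'; case: ifPn => [h|_].
  move: h; rewrite big_ord_recr/= => h; split; last by rewrite lerD2r.
  by apply: le_trans h; rewrite lerD2r.
rewrite expr0n/= addr0; split => //.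
by apply: (le_trans ih2); rewrite lerDl sqr_ge0.
Qed.

End RunningMax.

Section DiscreteIntegral.
Context {R : realType} {disp : measure_display} {Omega : measurableType disp}.
Variable P : probability Omega R.
Variables (n : nat) (G : nat -> set (set Omega)) (D : nat -> Omega -> R) (m a : R).
Local Notation F k := (<<s G k >>).
Local Notation E f := (\int[P]_w (f w)).
Hypothesis mG : forall k, (k <= n)%N -> F k `<=` measurable.
Hypothesis FS : forall k, (k < n)%N -> F k `<=` F k.+1.
Hypothesis D_F : forall k, (k < n)%N -> meas_wrt (F k.+1) (D k).
Hypothesis D_ind : forall k, (k < n)%N -> indep2 P (F k) (preimages [set D k]).
Hypothesis D_L2 : forall k, (k < n)%N -> L2 P (D k).
Hypothesis D_mean : forall k, (k < n)%N -> E (D k) = m.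
Hypothesis D_var : forall k, (k < n)%N -> E (fun w => D k w ^+ 2) <= a.

Lemma meas_wrt_measurable k (X : Omega -> R) : (k <= n)%N -> meas_wrt (F k) X ->
  measurable_fun setT X.
Proof. by move=> kn mX _ B mB; rewrite setTI; apply: (mG kn); exact: mX. Qed.

Lemma Fmono j k : (j <= k)%N -> (k <= n)%N -> F j `<=` F k.
Proof.
elim: k => [|k ih]; first by rewrite leqn0 => /eqP -> _.
rewrite leq_eqVlt => /predU1P[-> _ //|]; rewrite ltnS => jk kn.
by apply: subset_trans (FS kn); apply: ih => //; exact: ltnW.
Qed.

Let C k w := D k w - m.

Lemma C_L2 k : (k < n)%N -> L2 P (C k).
Proof. by move=> kn; apply: L2B; [exact: D_L2|exact: L2_cst]. Qed.

Lemma C_mean k : (k < n)%N -> E (C k) = 0.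
Proof.
move=> kn; rewrite EB; first by rewrite D_mean// E_cst subrr.
  by apply: L2_L1; exact: D_L2.
exact: L1_cst.
Qed.

Lemma C_var k : (k < n)%N -> E (fun w => C k w ^+ 2) <= a.
Proof.
move=> kn; have [_ d2] := D_L2 kn; have d1 := L2_L1 (D_L2 kn).
have -> : E (fun w => C k w ^+ 2) = E (fun w => D k w ^+ 2) - m ^+ 2.
  have -> : (fun w => C k w ^+ 2) =
      fun w => (D k w ^+ 2 - (2 * m) * D k w) + m ^+ 2.
    by apply/funext => w; rewrite /C; ring.
  have l : L1 P (fun w => D k w ^+ 2 - (2 * m) * D k w).
    by apply: L1B => //; exact: L1Z.
  rewrite ED//; last exact: L1_cst.
  rewrite EB//; last exact: L1Z.
  by rewrite EZ// E_cst D_mean//; ring.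
by have := D_var kn; have := sqr_ge0 m; lra.
Qed.

Lemma meas_wrt_indep k X (f : R -> R) : (k < n)%N -> meas_wrt (F k) X ->
  measurable_fun setT f ->
  forall A B : set R, measurable A -> measurable B ->
  P (X @^-1` A `&` (fun w => f (D k w)) @^-1` B) =
  (P (X @^-1` A) * P ((fun w => f (D k w)) @^-1` B))%E.
Proof.
move=> kn mX mf A B mA mB; apply: (D_ind kn); first exact: mX.
exists (D k) => //; exists (f @^-1` B) => //.
by rewrite -[X in measurable X]setTI; exact: mf.
Qed.

(** This stands in for conditional expectation: a centered increment is orthogonal to every
    integrable variable of its past. *)
Lemma C_orth k X : (k < n)%N -> meas_wrt (F k) X -> L1 P X ->
  L1 P (fun w => X w * C k w) /\ E (fun w => X w * C k w) = 0.
Proof.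
move=> kn mX lX.
have mf : measurable_fun setT (fun x : R => x - m) by apply: measurable_funB.
have [l e] := indep_EM lX (L2_L1 (C_L2 kn)) (meas_wrt_indep kn mX mf).
by split => //; rewrite [LHS]e C_mean// mulr0.
Qed.

Lemma C_sqr k X : (k < n)%N -> meas_wrt (F k) X -> L2 P X ->
  L2 P (fun w => X w * C k w) /\
  E (fun w => (X w * C k w) ^+ 2) <= a * E (fun w => X w ^+ 2).
Proof.
move=> kn mX lX; have [mX' lX2] := lX; have [mC lC2] := C_L2 kn.
have mf : measurable_fun setT (fun x : R => (x - m) ^+ 2).
  by apply: measurable_funX; apply: measurable_funB.
have mX2 : meas_wrt (F k) (fun w => X w ^+ 2).
  by apply/meas_wrtP; apply: measurable_funX; apply/meas_wrtP.
have [l e] := indep_EM lX2 lC2 (meas_wrt_indep kn mX2 mf).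
have eE : (fun w => (X w * C k w) ^+ 2) = fun w => X w ^+ 2 * C k w ^+ 2.
  by apply/funext => w; rewrite exprMn.
split; first by split; [exact: measurable_funM|rewrite eE].
rewrite eE [X in X <= _]e mulrC; apply: ler_wpM2r; first exact: E_sqr_ge0.
exact: C_var.
Qed.

Section Martingale.
Variable h : nat -> Omega -> R.
Hypothesis h_F : forall k, (k < n)%N -> meas_wrt (F k) (h k).
Hypothesis h_L2 : forall k, (k < n)%N -> L2 P (h k).

Let M J w := \sum_(k < J) h k w * C k w.

Lemma M_F J k : (J <= k)%N -> (k <= n)%N -> meas_wrt (F k) (M J).
Proof.
move=> Jk kn; apply/meas_wrtP; apply: measurable_sum => j.
have jn : (j < n)%N by exact: leq_trans (leq_trans (ltn_ord j) Jk) kn.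
have jk : (j < k)%N by exact: leq_trans Jk.
apply: measurable_funM; apply/meas_wrtP.
  apply: meas_wrtS (h_F jn); apply: Fmono => //; exact: ltnW.
apply/meas_wrtP; apply: measurable_funB => //.
by apply/meas_wrtP; apply: meas_wrtS (D_F jn); exact: Fmono.
Qed.

Lemma M_L2 J : (J <= n)%N -> L2 P (M J).
Proof.
move=> Jn; apply: L2_sum => j _.
have jn : (j < n)%N by exact: leq_trans Jn.
by have [] := C_sqr jn (h_F jn) (h_L2 jn).
Qed.

Lemma M_var J : (J <= n)%N ->
  E (fun w => M J w ^+ 2) <= a * \sum_(k < J) E (fun w => h k w ^+ 2).
Proof.
elim: J => [_|J ih Jn].
  rewrite big_ord0 mulr0 /M; under eq_Rintegral do rewrite big_ord0 expr0n.
  by rewrite E_cst.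
have lM := M_L2 (ltnW Jn); have [_ lM2] := lM.
have [[mC lC] vC] := C_sqr Jn (h_F Jn) (h_L2 Jn).
have lhM : L1 P (fun w => h J w * M J w) by apply: L1M_sqr => //; exact: h_L2.
have [l0 e0] : L1 P (fun w => (h J w * M J w) * C J w) /\
    E (fun w => (h J w * M J w) * C J w) = 0.
  apply: C_orth => //; apply/meas_wrtP; apply: measurable_funM; apply/meas_wrtP.
    exact: h_F.
  by apply: M_F => //; exact: ltnW.
have -> : (fun w => M J.+1 w ^+ 2) =
    fun w => (M J w ^+ 2 + 2 * ((h J w * M J w) * C J w)) + (h J w * C J w) ^+ 2.
  by apply/funext => w; rewrite /M big_ord_recr/=; ring.
have l1 : L1 P (fun w => 2 * ((h J w * M J w) * C J w)) by exact: L1Z.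
rewrite ED//; last exact: L1D.
rewrite ED// EZ// e0 mulr0 addr0 big_ord_recr/= mulrDr.
by apply: lerD => //; apply: ih; exact: ltnW.
Qed.

Let S J w := runmax (M ^~ w) J.

Lemma S_F J k : (J <= k)%N -> (k <= n)%N -> meas_wrt (F k) (S J).
Proof.
elim: J => [_ kn|J ih Jk kn]; first by apply/meas_wrtP; exact: measurable_cst.
apply/meas_wrtP; apply: measurable_maxr; apply/meas_wrtP; first exact: ih (ltnW Jk) kn.
exact: M_F.
Qed.

Lemma S_L2 J : (J <= n)%N -> L2 P (S J).
Proof.
elim: J => [_|J ih Jn]; first exact: L2_cst.
have l1 := ih (ltnW Jn); have l2 := M_L2 Jn.
have mS : measurable_fun setT (S J.+1) by exact: meas_wrt_measurable (S_F (leqnn _) Jn).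
split => //; apply: (L1_le _ (L1D l1.2 l2.2)); first exact: measurable_funX.
move=> w; rewrite ger0_norm ?sqr_ge0//= /S/=.
have := sqr_ge0 (runmax (M^~ w) J); have := sqr_ge0 (M J.+1 w).
by case: (leP (runmax (M^~ w) J) (M J.+1 w)) => _; lra.
Qed.

Lemma S_var : E (fun w => S n w ^+ 2) <= 4 * a * \sum_(k < n) E (fun w => h k w ^+ 2).
Proof.
have lt (k : 'I_n) : L1 P (fun w => S k w * (M k.+1 w - M k w)) /\
    E (fun w => S k w * (M k.+1 w - M k w)) = 0.
  have eE : (fun w => S k w * (M k.+1 w - M k w)) = fun w => (h k w * S k w) * C k w.
    by apply/funext => w; rewrite /M big_ord_recr/=; ring.
  rewrite eE; have kn := ltn_ord k; have kn' := ltnW kn.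
  apply: C_orth => //.
    apply/meas_wrtP; apply: measurable_funM; apply/meas_wrtP; first exact: h_F.
    exact: S_F.
  by apply: L1M_sqr; [exact: h_L2|exact: S_L2].
have lsum : L1 P (fun w => \sum_(k < n) S k w * (M k.+1 w - M k w)).
  by apply: L1_sum => k _; have [] := lt k.
have := M_var (leqnn n); have [_ lM] := M_L2 (leqnn n); have [_ lS] := S_L2 (leqnn n).
have : E (fun w => S n w ^+ 2) <= E (fun w => 4 * M n w ^+ 2 -
    4 * \sum_(k < n) S k w * (M k.+1 w - M k w)).
  apply: E_le => //; first by apply: L1B; exact: L1Z.
  by move=> w; apply: runmax_pathwise; rewrite /M big_ord0.
rewrite EB; [|exact: L1Z|exact: L1Z].
rewrite !EZ// E_sum; last by move=> k _; have [] := lt k.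
rewrite [X in _ - 4 * X]big1; last by move=> k _; have [] := lt k.
lra.
Qed.

End Martingale.

(** Write [D k] as [C k + m]. The martingale part has two one-sided maxima at a cost of 4a each,
    doubled when the square of a sum is split: this gives 16a. The drift part is at most [n * m ^ 2]
    times the sum of squares by Cauchy-Schwarz, doubled as well. *)
Lemma doob_max (h : nat -> Omega -> R) :
  (forall k, (k < n)%N -> meas_wrt (F k) (h k)) ->
  (forall k, (k < n)%N -> L2 P (h k)) ->
  exists Z : Omega -> R, [/\ L1 P Z,
    forall w J, (J <= n)%N -> (\sum_(k < J) h k w * D k w) ^+ 2 <= Z w &
    E Z <= (16 * a + 2 * n%:R * m ^+ 2) * \sum_(k < n) E (fun w => h k w ^+ 2)].
Proof.
move=> hF hL.
pose h' k w := - h k w.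
have h'F k : (k < n)%N -> meas_wrt (F k) (h' k).
  by move=> kn; apply/meas_wrtP; apply: measurable_funN; apply/meas_wrtP; exact: hF.
have h'L k : (k < n)%N -> L2 P (h' k).
  move=> kn; have := L2Z (-1) (hL _ kn); congr L2.
  by apply/funext => w; rewrite mulN1r.
have [_ l1] := S_L2 hF hL (leqnn n); have v1 := S_var hF hL.
have [_ l2] := S_L2 h'F h'L (leqnn n); have v2 := S_var h'F h'L.
have hh k : (fun w => h' k w ^+ 2) = (fun w => h k w ^+ 2).
  by apply/funext => w; rewrite sqrrN.
have hs : \sum_(k < n) E (fun w => h' k w ^+ 2) = \sum_(k < n) E (fun w => h k w ^+ 2).
  by apply: eq_bigr => k _; rewrite hh.
rewrite hs in v2.
have lQ : L1 P (fun w => \sum_(k < n) h k w ^+ 2).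
  by apply: L1_sum => k _; have [] := hL _ (ltn_ord k).
set s1 := (fun w : Omega => _ : R) in l1 v1; set s2 := (fun w : Omega => _ : R) in l2 v2.
exists (fun w => 2 * (s1 w + s2 w) + (2 * n%:R * m ^+ 2) * \sum_(k < n) h k w ^+ 2).
split.
- by apply: L1D; apply: L1Z => //; exact: L1D.
- move=> w J Jn.
  have -> : \sum_(k < J) h k w * D k w =
      \sum_(k < J) h k w * C k w + m * \sum_(k < J) h k w.
    by rewrite mulr_sumr -big_split/=; apply: eq_bigr => k _; rewrite /C; ring.
  have M0 : \sum_(k < 0) h k w * C k w = 0 by rewrite big_ord0.
  have := @runmax_sqr_ge _ (fun J => \sum_(k < J) h k w * C k w) n J M0 Jn.
  have -> : runmax (fun k => - \sum_(k0 < k) h k0 w * C k0 w) n ^+ 2 = s2 w.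
    rewrite /s2; congr (runmax _ _ ^+ 2); apply/funext => k.
    by rewrite -sumrN; apply: eq_bigr => i _; rewrite /h' mulNr.
  rewrite -/(s1 w); have := @sqr_sum_le _ n (h ^~ w) J Jn.
  set A := \sum_(k < J) h k w * C k w; set B := \sum_(k < J) h k w.
  set Q := \sum_(k < n) h k w ^+ 2 => BQ AS.
  have mB : m ^+ 2 * B ^+ 2 <= m ^+ 2 * (n%:R * Q) by rewrite ler_wpM2l ?sqr_ge0.
  by have := sqr_ge0 (A - m * B); lra.
- rewrite ED; [|by apply: L1Z; exact: L1D|exact: L1Z].
  rewrite !EZ//; last exact: L1D.
  rewrite ED// E_sum; last by move=> k _; have [] := hL _ (ltn_ord k).
  set Q := \sum_(k < n) _ in v1 v2 *.
  lra.
Qed.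

(** Lenglart's domination inequality, without any integrability of [h]: the integrand is switched
    off once its sum of squares exceeds [c]. Below the level [c] nothing is changed, and the
    truncated sum is handled by [doob_max] and Markov's inequality. *)
Lemma lenglart (h : nat -> Omega -> R) (c e : R) J :
  (forall k, (k < n)%N -> meas_wrt (F k) (h k)) -> 0 <= a -> 0 < c -> 0 < e -> (J <= n)%N ->
  (P [set w | (e <= `|\sum_(k < J) h k w * D k w|)%R] <=
   P [set w | (c <= \sum_(k < n) h k w ^+ 2)%R] +
   ((16 * a + 2 * n%:R * m ^+ 2) * c / e ^+ 2)%:E)%E.
Proof.
move=> hF a0 c0 e0 Jn.
pose h' k w := if \sum_(i < k.+1) h i w ^+ 2 <= c then h k w else 0.
have mh k : (k < n)%N -> measurable_fun setT (h k).
  by move=> kn; apply: (meas_wrt_measurable (ltnW kn)); exact: hF.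
have h'F k : (k < n)%N -> meas_wrt (F k) (h' k).
  move=> kn; apply/meas_wrtP; rewrite /h'.
  apply: measurable_fun_ifT => //; last by apply/meas_wrtP; exact: hF.
  apply: measurable_fun_ler => //; apply: measurable_sum => i.
  apply: measurable_funX; apply/meas_wrtP.
  have ik : (i <= k)%N by rewrite -ltnS.
  apply: meas_wrtS (hF i (leq_ltn_trans ik kn)).
  by apply: Fmono => //; exact: ltnW.
have h'b k w : h' k w ^+ 2 <= c.
  have := @truncated_sqr_sum _ k.+1 (h ^~ w) c (ltW c0).
  rewrite big_ord_recr/=; apply: le_trans.
  by rewrite lerDr; apply: sumr_ge0 => i _; exact: sqr_ge0.
have h'L k : (k < n)%N -> L2 P (h' k).
  move=> kn; apply: (@L2_bounded _ _ _ _ _ (Num.sqrt c)).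
    by apply: (meas_wrt_measurable (ltnW kn)); exact: h'F.
  by move=> w; rewrite -sqrtr_sqr; apply: ler_wsqrtr.
have [Z [lZ XZ EZ]] := doob_max h'F h'L.
have Z0 w : 0 <= Z w.
  by apply: le_trans (XZ w 0%N _) => //; exact: sqr_ge0.
have mV : measurable [set w | c <= \sum_(k < n) h k w ^+ 2].
  rewrite -[X in measurable X]setTI; apply: measurable_fun_le => //.
  by apply: measurable_sum => k; apply: measurable_funX; exact: mh.
have mX : measurable [set w | e <= `|\sum_(k < J) h k w * D k w|].
  rewrite -[X in measurable X]setTI; apply: measurable_fun_le => //.
  apply: measurableT_comp => //; apply: measurable_sum => k.
  have kn : (k < n)%N by exact: leq_trans Jn.
  by apply: measurable_funM; [exact: mh|case: (D_L2 kn)].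
have mZ : measurable [set w | e ^+ 2 <= Z w].
  rewrite -[X in measurable X]setTI; apply: measurable_fun_le => //.
  exact: L1_meas lZ.
have : (P [set w | (e <= `|\sum_(k < J) h k w * D k w|)%R] <=
    P ([set w | (c <= \sum_(k < n) h k w ^+ 2)%R] `|` [set w | (e ^+ 2 <= Z w)%R]))%E.
  apply: le_measure; rewrite ?inE//; first exact: measurableU.
  move=> w /= ew; have [|Vc] := leP c (\sum_(k < n) h k w ^+ 2); [by left|right].
  apply: le_trans (XZ w J Jn).
  have -> : \sum_(k < J) h' k w * D k w = \sum_(k < J) h k w * D k w.
    apply: eq_bigr => k _; rewrite /h' ifT//; apply: le_trans (ltW Vc).
    have kn : (k < n)%N by exact: leq_trans Jn.
    rewrite (big_ord_widen _ (fun i => h i w ^+ 2) kn).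
    rewrite [leRHS](bigID (fun i : 'I_n => (i < k.+1)%N))/=.
    by rewrite lerDl; apply: sumr_ge0 => i _; exact: sqr_ge0.
  by rewrite -[leRHS]real_normK ?num_real// lerXn2r// nnegrE// ltW.
move=> /le_trans; apply; apply: (le_trans (measureU2 _ mV mZ)).
apply: leeD => //.
have e2 : 0 < e ^+ 2 by rewrite exprn_gt0.
apply: (@le_trans _ _ ((\int[P]_w Z w) / e ^+ 2)%:E).
  exact: (prob_le_E mZ lZ e2 Z0).
rewrite lee_fin ler_pM2r ?invr_gt0 ?exprn_gt0//.
apply: (le_trans EZ); apply: ler_wpM2l.
  apply: addr_ge0; first by rewrite mulr_ge0.
  by apply: mulr_ge0; [rewrite mulr_ge0|exact: sqr_ge0].
have l1 k : (k < n)%N -> L1 P (fun w => h' k w ^+ 2) by move=> /h'L[].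
have -> : \sum_(k < n) E (fun w => h' k w ^+ 2) = E (fun w => \sum_(k < n) h' k w ^+ 2).
  by rewrite (@E_sum _ _ _ P _ _ (fun (k : 'I_n) w => h' k w ^+ 2))// => k _; exact: (l1 k (ltn_ord k)).
rewrite -[leRHS](E_cst P); apply: E_le.
- by apply: (@L1_sum _ _ _ P _ _ (fun (k : 'I_n) w => h' k w ^+ 2)) => k _; exact: (l1 k (ltn_ord k)).
- exact: L1_cst.
- by move=> w; exact: (@truncated_sqr_sum _ n (h ^~ w) c (ltW c0)).
Qed.

End DiscreteIntegral.

(** * Paths on dyadic grids *)

Section Paths.
Context {R : realType}.
Variable T : R.
Hypothesis T0 : 0 < T.
Implicit Types (f U V : R -> R) (p k : nat).

(** Outside this section the horizon is an argument, and [dy t] with t <= T is used for the dyadic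
    grids of [0, t]. *)
Definition dy p k : R := T * (k%:R / 2 ^+ p).

Lemma dy0 p : dy p 0 = 0. Proof. by rewrite /dy mul0r mulr0. Qed.

Lemma exp2_gt0 p : 0 < 2 ^+ p :> R. Proof. by rewrite exprn_gt0. Qed.

Lemma dy_full p : dy p (2 ^ p) = T.
Proof. by rewrite /dy natrX divff ?mulr1// gt_eqF// exp2_gt0. Qed.

Lemma dy_le p k l : (dy p k <= dy p l) = (k <= l)%N.
Proof. by rewrite /dy ler_pM2l// ler_pM2r ?invr_gt0 ?exp2_gt0// ler_nat. Qed.

Lemma dy_lt p k l : (dy p k < dy p l) = (k < l)%N.
Proof. by rewrite ltNge dy_le -ltnNge. Qed.

Lemma dy_ge0 p k : 0 <= dy p k.
Proof. by rewrite -(dy0 p) dy_le. Qed.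

Lemma dy_leT p k : (k <= 2 ^ p)%N -> dy p k <= T.
Proof. by move=> kp; rewrite -(dy_full p) dy_le. Qed.

Lemma dy_in p k : (k <= 2 ^ p)%N -> 0 <= dy p k <= T.
Proof. by move=> kp; rewrite dy_ge0 dy_leT. Qed.

Lemma dyS p k : dy p k.+1 = dy p k + T / 2 ^+ p.
Proof. by rewrite /dy -natr1; ring. Qed.

Lemma dy_refine p q k : (p <= q)%N -> dy p k = dy q (k * 2 ^ (q - p)).
Proof.
move=> pq; rewrite /dy natrM natrX; congr (_ * _).
rewrite -{2}(subnK pq) exprD; field.
by rewrite !gt_eqF// exp2_gt0.
Qed.

Lemma dy_step_small (e : R) : 0 < e -> exists p0, forall p, (p0 <= p)%N -> T / 2 ^+ p < e.
Proof.
move=> e0; have /(_ (e / T))[|p0 _ hp] : forall e : R, 0 < e -> \forall p \near \oo, 2 ^- p < e.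
  move=> e' e'0; have := @cvg_geometric _ (1:R) (2^-1).
  have h : `|2^-1 : R| < 1 by rewrite ger0_norm ?invr_ge0// invf_lt1// ltr1n.
  move=> /(_ h)/cvgr0_norm_lt/(_ _ e'0); apply: filterS => p.
  by rewrite /geometric/= mul1r exprVn ger0_norm// invr_ge0 ltW// exp2_gt0.
  by rewrite divr_gt0.
by exists p0 => p /hp/=; rewrite ltr_pdivlMr// mulrC.
Qed.

Lemma dy_locate p (s : R) : 0 < s <= T ->
  exists k, (k < 2 ^ p)%N /\ dy p k < s <= dy p k.+1.
Proof.
move=> /andP[s0 sT].
have ex : exists k, s <= dy p k by exists (2 ^ p)%N; rewrite dy_full.
case: (ex_minnP ex) => -[|k] sk kmin; first by move: sk; rewrite dy0 leNgt s0.
exists k; split; last first.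
  by rewrite sk andbT ltNge; apply/negP => /kmin; rewrite ltnn.
by apply: kmin; rewrite dy_full.
Qed.

Lemma dy_locate_right p (s : R) : 0 <= s < T ->
  exists k, (k < 2 ^ p)%N /\ dy p k <= s < dy p k.+1.
Proof.
move=> /andP[s0 sT].
have ex : exists k, s < dy p k by exists (2 ^ p)%N; rewrite dy_full.
case: (ex_minnP ex) => -[|k] sk kmin; first by move: sk; rewrite dy0 ltNge s0.
exists k; split; last first.
  by rewrite sk andbT leNgt; apply/negP => /kmin; rewrite ltnn.
by apply: kmin; rewrite dy_full.
Qed.

Lemma bounded_of_locally f :
  (forall t, 0 <= t <= T -> exists M : R, \forall s \near t, 0 <= s <= T -> `|f s| <= M) ->
  exists M : R, forall s, 0 <= s <= T -> `|f s| <= M.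
Proof.
move=> h; have := @segment_compact R 0 T.
move=> /compact_near_coveringP/(_ nat \oo (fun n s => 0 <= s <= T -> `|f s| <= n%:R)).
case=> [t|N _ /(_ N (leqnn N)) hN].
  rewrite /= in_itv/= => /h[M hM].
  exists ([set s : R | 0 <= s <= T -> `|f s| <= M], [set n : nat | M <= n%:R]).
    by split => //=; exact: nbhs_infty_ger.
  by move=> [s n] /= [h1 h2] sT; exact: le_trans (h1 sT) h2.
by exists N%:R => s sT; apply: hN => //=; rewrite in_itv.
Qed.

Lemma near_split (t : R) (Q : R -> Prop) :
  (\forall s \near t^'-, Q s) -> (\forall s \near t^'+, Q s) -> Q t ->
  \forall s \near t, Q s.
Proof.
rewrite !near_withinE => h1 h2 h3; near=> s.
have [st|ts|->//] := ltgtP s t.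
  by move: st; near: s.
by move: ts; near: s.
Unshelve. all: by end_near. Qed.

Lemma cvg_near_bounded (F : set_system R) f (l : R) : Filter F -> f @ F --> l ->
  \forall s \near F, `|f s| <= `|l| + 1.
Proof.
move=> FF /cvgr_dist_lt /(_ 1 ltr01); apply: filterS => s h.
have := ler_normB l (l - f s); rewrite subKr; lra.
Qed.

Lemma left_right_bounded f :
  (forall t, 0 < t <= T -> cvg (f s @[s --> t^'-])) ->
  (forall t, 0 <= t < T -> cvg (f s @[s --> t^'+])) ->
  exists M : R, forall s, 0 <= s <= T -> `|f s| <= M.
Proof.
move=> hl hr; apply: bounded_of_locally => t /andP[t0 tT].
have [Ml hMl] : exists M, \forall s \near t^'-, 0 <= s <= T -> `|f s| <= M.
  move: t0; rewrite le_eqVlt => /predU1P[<-|t0].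
    exists 0; rewrite near_withinE; near=> s => s0 /andP[]; lra.
  have := hl t; rewrite t0 tT => /(_ isT) /cvg_near_bounded h.
  by eexists; apply: filterS h => s h _; exact: h.
have [Mr hMr] : exists M, \forall s \near t^'+, 0 <= s <= T -> `|f s| <= M.
  move: tT; rewrite le_eqVlt => /predU1P[->|tT].
    exists 0; rewrite near_withinE; near=> s => s0 /andP[]; lra.
  have := hr t; rewrite t0 tT => /(_ isT) /cvg_near_bounded h.
  by eexists; apply: filterS h => s h _; exact: h.
exists (Num.max (Num.max Ml Mr) `|f t|).
apply: near_split.
- by apply: filterS hMl => s h /h h'; rewrite !le_max h'.
- by apply: filterS hMr => s h /h h'; rewrite !le_max h' orbT.
- by rewrite le_max lexx orbT.
Unshelve. all: by end_near. Qed.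

Lemma cadlag_bounded f : cadlag T f -> exists M : R, forall s, 0 <= s <= T -> `|f s| <= M.
Proof.
by move=> [h1 h2]; apply: left_right_bounded => // t /h1 h; apply/cvg_ex; exists (f t).
Qed.

Lemma caglad_bounded f : caglad T f -> exists M : R, forall s, 0 <= s <= T -> `|f s| <= M.
Proof.
by move=> [h1 h2]; apply: left_right_bounded => // t /h1 h; apply/cvg_ex; exists (f t).
Qed.

Lemma lpart_cvg f t : cadlag T f -> 0 < t <= T -> f s @[s --> t^'-] --> lpart f t.
Proof. by move=> [_ h] tT; rewrite /lpart leNgt; case/andP: (tT) => -> _ /=; exact: h. Qed.

Lemma lpart0 f : lpart f 0 = f 0.
Proof. by rewrite /lpart lexx. Qed.

Lemma lpart_closed f t (Q : set R) : cadlag T f -> 0 <= t <= T -> closed Q ->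
  (forall s, 0 <= s <= t -> Q (f s)) -> Q (lpart f t).
Proof.
move=> cf /andP[t0 tT] cQ fQ; move: t0; rewrite le_eqVlt => /predU1P[t0|t0].
  by rewrite -t0 lpart0; apply: fQ; rewrite lexx t0 lexx.
have ct : f s @[s --> t^'-] --> lpart f t by apply: lpart_cvg => //; rewrite t0.
apply: (closed_cvg Q _ _ _ ct) => //.
near=> s; apply: fQ; apply/andP; split; near: s.
  exact: nbhs_left_ge.
exact: nbhs_left_le.
Unshelve. all: by end_near. Qed.

Lemma closed_normle (M : R) : closed [set x : R | `|x| <= M].
Proof.
rewrite (_ : [set x : R | `|x| <= M] = [set x : R | - M <= x] `&` [set x : R | x <= M]).
  by apply: closedI; [exact: closed_ge|exact: closed_le].
by apply/seteqP; split => x /=; rewrite ler_norml => /andP.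
Qed.

Lemma lpart_bound f t (M : R) : cadlag T f -> 0 <= t <= T ->
  (forall s, 0 <= s <= T -> `|f s| <= M) -> `|lpart f t| <= M.
Proof.
move=> cf tT h.
suff : [set x : R | `|x| <= M] (lpart f t) by [].
apply: (lpart_closed cf tT (@closed_normle M)) => s /andP[s0 st] /=.
by apply: h; rewrite s0 (le_trans st)//; case/andP: tT.
Qed.

(** All values of [f] shortly before [t] lie in a closed ball around the left limit at [t]; the left
    limits taken at those times remain in it. *)
Lemma lpart_left_cont f t : cadlag T f -> 0 < t <= T ->
  lpart f s @[s --> t^'-] --> lpart f t.
Proof.
move=> cf tT; have ct := lpart_cvg cf tT; have /andP[t0 tT'] := tT.
apply/cvgrPdist_le => e e0.
have /cvgrPdist_le/(_ _ e0) := ct; rewrite !near_withinE.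
move=> /nbhs_ballP[d /= d0 hd].
have hd' s : t - d < s -> s < t -> `|lpart f t - f s| <= e.
  by move=> h1 h2; apply: hd => //=; rewrite /ball/= ger0_norm; lra.
near=> s => st.
have sd : t - d < s.
  near: s; apply/nbhs_ballP; exists d => // u; rewrite /ball/= ltr_norml; lra.
have s0 : 0 < s.
  near: s; apply/nbhs_ballP; exists t => // u; rewrite /ball/= ltr_norml; lra.
have sT : 0 < s <= T by rewrite s0; lra.
have cs := lpart_cvg cf sT.
have := @closed_cvg _ _ _ _ f [set x : R | `|lpart f t - x| <= e] _ _ _ cs; apply.
  rewrite (_ : [set x : R | _] = [set x : R | lpart f t - e <= x] `&` [set x : R | x <= lpart f t + e]).
    by apply: closedI; [exact: closed_ge|exact: closed_le].
  by apply/seteqP; split => x /=; rewrite ler_norml => /andP[] *; [split|apply/andP; split]; lra.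
have : \forall u \near s^'-, t - d < u < t.
  near=> u; apply/andP; split; first by near: u; exact: nbhs_left_gt.
  by apply: lt_trans st; near: u; exact: nbhs_left_lt.
by apply: filterS => u /andP[]; exact: hd'.
Unshelve. all: by end_near. Qed.

Lemma at_left_seq f (l t : R) (u : nat -> R) : f s @[s --> t^'-] --> l ->
  (forall n, u n < t) -> u n @[n --> \oo] --> t -> f (u n) @[n --> \oo] --> l.
Proof.
move=> /cvgrPdist_lt h ut cu; apply/cvgrPdist_lt => e /h.
rewrite near_withinE => /cu[N _ hN].
by exists N => // n Nn; apply: (hN n Nn); exact: ut.
Qed.


Lemma at_right_seq f (t : R) (u : nat -> R) : f s @[s --> t^'+] --> f t ->
  (forall n, t <= u n) -> u n @[n --> \oo] --> t -> f (u n) @[n --> \oo] --> f t.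
Proof.
move=> /cvg_at_right_within/cvgrPdist_lt h ut cu; apply/cvgrPdist_lt => e /h.
rewrite near_withinE => /cu[N _ hN].
by exists N => // n Nn; apply: (hN n Nn); exact: ut.
Qed.

Lemma dist_cvg (u : nat -> R) (t : R) : (forall p, `|u p - t| <= T / 2 ^+ p) ->
  u p @[p --> \oo] --> t.
Proof.
move=> h; apply/cvgrPdist_lt => e /dy_step_small[p0 hp].
by exists p0 => // p /= /hp; apply: le_lt_trans; rewrite distrC.
Qed.

Lemma dy_left_seq (t : R) : 0 < t <= T -> exists k : nat -> nat,
  [/\ forall p, (k p < 2 ^ p)%N, forall p, dy p (k p) < t <= dy p (k p).+1 &
    dy p (k p) @[p --> \oo] --> t].
Proof.
move=> tT; have [k hk] := choice (fun p => dy_locate p tT).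
exists k; split => [p|p|]; [by have [] := hk p|by have [] := hk p|].
apply: dist_cvg => p; have [_ /andP[h1 h2]] := hk p; rewrite dyS in h2.
by rewrite distrC ger0_norm; lra.
Qed.

Lemma dy_right_seq (t : R) : 0 <= t < T -> exists k : nat -> nat,
  [/\ forall p, (k p <= 2 ^ p)%N, forall p, t <= dy p (k p) &
    dy p (k p) @[p --> \oo] --> t].
Proof.
move=> tT; have [k hk] := choice (fun p => dy_locate_right p tT).
exists (fun p => (k p).+1); split => [p|p|]; [by have [] := hk p|by have [_ /andP[_ /ltW]] := hk p|].
apply: dist_cvg => p; have [_ /andP[h1]] := hk p; rewrite dyS => h2.
by rewrite ger0_norm; lra.
Qed.

(** Right continuity reaches each time before [T] from dyadic times on its right. The time [T] has
    none, but it is itself a grid point. *)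
Lemma supsq_le f (c : \bar R) : (forall t, 0 <= t < T -> f s @[s --> t^'+] --> f t) ->
  (forall p k, (k <= 2 ^ p)%N -> ((`|f (dy p k)| ^+ 2)%:E <= c)%E) ->
  (supsq T f <= c)%E.
Proof.
move=> rc h; apply: ge_ereal_sup => _ [t tT <-].
move: tT; rewrite /= in_itv/= => /andP[t0]; rewrite le_eqVlt => /predU1P[->|tT].
  by rewrite -(dy_full 0); exact: h.
have [k [kp tk ck]] : exists k : nat -> nat, [/\ forall p, (k p <= 2 ^ p)%N,
    forall p, t <= dy p (k p) & dy p (k p) @[p --> \oo] --> t].
  by apply: dy_right_seq; rewrite t0.
have cf : f (dy p (k p)) @[p --> \oo] --> f t.
  by apply: at_right_seq => //; apply: rc; rewrite t0.
have cf2 : (`|f (dy p (k p))| ^+ 2)%:E @[p --> \oo] --> (`|f t| ^+ 2)%:E.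
  apply: cvg_EFin; first exact: nearW.
  rewrite /comp/= expr2; under eq_fun do rewrite expr2.
  by apply: cvgM; exact: cvg_norm.
apply: (closed_cvg (fun x => (x <= c)%E) _ _ _ cf2).
  exact: closed_ereal_ge_ereal.
by apply: nearW => p; apply: h.
Qed.

Lemma supsq_ge f t : 0 <= t <= T -> ((`|f t| ^+ 2)%:E <= supsq T f)%E.
Proof. by move=> tT; apply: ereal_sup_ubound; exists t => //; rewrite /= in_itv. Qed.

Definition stepf p U (s : R) : R :=
  \sum_(k < 2 ^ p) U (dy p k) * \1_(`]dy p k, dy p k.+1]) s.

Lemma stepf_val p U s k : (k < 2 ^ p)%N -> dy p k < s <= dy p k.+1 ->
  stepf p U s = U (dy p k).
Proof.
move=> kp /andP[ks sk]; rewrite /stepf (bigD1 (Ordinal kp))//= indicE mem_set/=; last first.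
  by rewrite in_itv/= ks.
rewrite mulr1 big1 ?addr0// => j /eqP jk; rewrite indicE memNset ?mulr0//=.
rewrite in_itv/= => /andP[js sj]; apply: jk; apply: val_inj => /=.
apply/eqP; rewrite eqn_leq; apply/andP; split.
  by rewrite -ltnS -(dy_lt p); exact: lt_le_trans sk.
by rewrite -ltnS -(dy_lt p); exact: lt_le_trans sj.
Qed.

Lemma stepf_meas p U : measurable_fun setT (stepf p U).
Proof.
apply: measurable_sum => k; apply: measurable_funM => //.
Qed.

Lemma stepf_cvg U (l s : R) : 0 < s <= T -> U u @[u --> s^'-] --> l ->
  stepf p U s @[p --> \oo] --> l.
Proof.
move=> sT cU; have [k [kp ks ck]] := dy_left_seq sT.
have -> : (fun p => stepf p U s) = (fun p => U (dy p (k p))).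
  by apply/funext => p; exact: stepf_val.
by apply: (at_left_seq cU _ ck) => p; have /andP[] := ks p.
Qed.

Lemma stepf_bound U (M s : R) p : (forall s, 0 <= s <= T -> `|U s| <= M) ->
  0 < s <= T -> `|stepf p U s| <= M.
Proof.
move=> UM /(dy_locate p)[k [kp ks]]; rewrite (stepf_val _ kp ks).
by apply: UM; apply: dy_in; exact: ltnW.
Qed.

Lemma integral_stepf p U :
  (\int[lebesgue_measure]_(s in `[0%R, T]) ((stepf p U s) ^+ 2)%:E =
   (\sum_(k < 2 ^ p) U (dy p k) ^+ 2 * (T / 2 ^+ p))%:E)%E.
Proof.
have e : {in `[0%R, T]%classic, forall s, ((stepf p U s) ^+ 2)%:E =
   (\sum_(k < 2 ^ p) (U (dy p k) ^+ 2)%:E * (\1_(`]dy p k, dy p k.+1]) s)%:E)%E}.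
  move=> s _; rewrite sumEFin; congr EFin.
  have [[k [kp ks]]|ns] := pselect (exists k, (k < 2 ^ p)%N /\ dy p k < s <= dy p k.+1).
    rewrite (stepf_val _ kp ks).
    have := @stepf_val p (fun s => U s ^+ 2) s k kp ks; rewrite /stepf => <-.
    by [].
  rewrite /stepf !big1 ?expr0n// => k _; rewrite indicE memNset ?mulr0//=.
    by rewrite in_itv/= => h; apply: ns; exists k.
  by rewrite in_itv/= => h; apply: ns; exists k.
under eq_integral => s sT do rewrite (e s sT).
rewrite ge0_integral_sum//=; last 2 first.
- move=> k; apply: measurable_funeM; apply/measurable_EFinP.
  by apply: measurable_indic.
- by move=> k s _; rewrite -EFinM lee_fin mulr_ge0 ?sqr_ge0.
rewrite -sumEFin; apply: eq_bigr => k _.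
rewrite ge0_integralZl//; last 2 first.
- by apply/measurable_EFinP; apply: measurable_indic.
- by rewrite lee_fin sqr_ge0.
rewrite integral_indic//= [RHS]EFinM; congr (_ * _)%E.
rewrite setIidl; last first.
  move=> s /=; rewrite !in_itv/= => /andP[h1 h2]; apply/andP; split.
    by apply: le_trans (ltW h1); exact: dy_ge0.
  by apply: le_trans h2 _; exact: dy_leT.
rewrite lebesgue_measure_itv/= lte_fin dy_lt ltnSn -EFinB dyS.
by congr EFin; ring.
Qed.

(** The step functions built on [U] converge to its left limits [V]. The two functions are kept
    apart because a right-continuous version of a simple process, which is adapted, is sampled here
    to integrate the left-continuous one. *)
Lemma integral_stepf_cvg U V (M : R) :
  (forall s, 0 <= s <= T -> `|U s| <= M) ->
  (forall s, 0 < s <= T -> U u @[u --> s^'-] --> V s) ->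
  (\sum_(k < 2 ^ p) U (dy p k) ^+ 2 * (T / 2 ^+ p))%:E @[p --> \oo] -->
  (\int[lebesgue_measure]_(s in `[0%R, T]) (`|V s| ^+ 2)%:E)%E.
Proof.
move=> UM UV.
have mI : measurable (`[0%R, T]%classic : set R) by [].
have mI' : measurable (`]0%R, T]%classic : set R) by [].
have inI s : s \in `]0%R, T] -> 0 < s <= T by rewrite in_itv.
have VM s : 0 < s <= T -> `|V s| <= M.
  move=> sT; have := stepf_cvg sT (UV s sT).
  move=> /cvg_norm c; apply: (closed_cvg (fun x : R => x <= M) _ _ _ c).
    exact: closed_le.
  by apply: nearW => p; apply: stepf_bound.
have mV : measurable_fun (`]0%R, T]%classic : set R) V.
  apply: (@measurable_fun_cvg _ _ _ _ (fun p => stepf p U)).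
    by move=> p; apply: measurable_funTS; exact: stepf_meas.
  by move=> s /inI sT; apply: stepf_cvg => //; exact: UV.
(* Convergence to [V] is given on ]0, T] only; the point 0 is Lebesgue-null. *)
have reduce (g : R -> R) : measurable_fun (`]0%R, T]%classic : set R) g ->
   (\int[lebesgue_measure]_(s in `[0%R, T]) (g s)%:E =
    \int[lebesgue_measure]_(s in `]0%R, T]) (g s)%:E)%E.
  move=> mg; rewrite integral_itv_obnd_cbnd//.
  exact/measurable_EFinP.
rewrite reduce; last first.
  by apply: measurable_funX; apply: measurableT_comp.
have -> : (fun p => (\sum_(k < 2 ^ p) U (dy p k) ^+ 2 * (T / 2 ^+ p))%:E) =
    (fun p => \int[lebesgue_measure]_(s in `]0%R, T]) (stepf p U s ^+ 2)%:E)%E.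
  apply/funext => p; rewrite -integral_stepf reduce//.
  by apply: measurable_funX; apply: measurable_funTS; exact: stepf_meas.
have [||||| _ _] := @dominated_convergence _ _ R lebesgue_measure (`]0%R, T]%classic : set R) mI'
   (fun p s => ((stepf p U s) ^+ 2)%:E) (fun s => (`|V s| ^+ 2)%:E) (fun=> (M ^+ 2)%:E).
- move=> p; apply/measurable_EFinP; apply: measurable_funX; apply: measurable_funTS.
  exact: stepf_meas.
- apply/measurable_EFinP; apply: measurable_funX; exact: measurableT_comp.
- apply: aeW => s /inI sT; apply: cvg_EFin; first exact: nearW.
  rewrite /comp/= real_normK ?num_real// expr2; under eq_fun do rewrite expr2.
  by apply: cvgM; apply: stepf_cvg => //; exact: UV.
- apply/integrableP; split => //; rewrite integral_cst//=.
  rewrite lebesgue_measure_itv/= lte_fin T0 oppr0 adde0 -EFinM.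
  exact: ltry.
- apply: aeW => s p /inI sT; rewrite /= lee_fin normrX lerXn2r ?nnegrE//.
    by apply: le_trans (VM _ sT).
  exact: stepf_bound.
exact.
Qed.

End Paths.

(** * Dyadic increments of the driving noise *)

Section DyadicIncrements.
Context {R : realType} {disp : measure_display} {Omega : measurableType disp}.
Variable P : probability Omega R.
Hypothesis cP : measure_is_complete P.
Variables (T : R) (d : nat) (D0 : @driver R disp Omega).
Variable D : nat -> @driver R disp Omega.
Hypothesis T0 : 0 < T.
Hypothesis D0_driver : is_driver P T d D0.
Hypothesis D0_sqint : square_integrable P T (lev D0).
Hypothesis D_copies : independent_copies P T D0 D.
Local Notation E f := (\int[P]_w (f w)).
Local Notation dy := (dy T).

Definition incr i p k (w : Omega) := lev (D i) (dy p k.+1) w - lev (D i) (dy p k) w.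

Let Y p := lev D0 (T / 2 ^+ p).

Let stepT p : 0 <= T / 2 ^+ p <= T.
Proof.
have -> : T / 2 ^+ p = dy p 1 by rewrite (@dyS _ T p 0) dy0 add0r.
by apply: dy_in => //; rewrite expn_gt0.
Qed.

Let Y_L2 p : L2 P (Y p).
Proof.
have [_ [mz _ _ _] _ _] := D0_driver.
split; first by apply: mz; exact: stepT.
apply: L1_lty; first by apply: measurable_funX; apply: mz; exact: stepT.
  by move=> w; exact: sqr_ge0.
have := D0_sqint (stepT p).
by under eq_integral do rewrite real_normK ?num_real//.
Qed.

Lemma incr_meas i p k : (k < 2 ^ p)%N -> measurable_fun setT (incr i p k).
Proof.
move=> kp; apply: measurable_funB; apply: (lev_meas D_copies); apply: dy_in => //.
exact: ltnW.
Qed.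

Let incr_lawY i p k (B : set R) : (k < 2 ^ p)%N -> measurable B ->
  P (incr i p k @^-1` B) = P (Y p @^-1` B).
Proof.
move=> kp mB.
have -> : Y p = lev D0 (dy p k.+1 - dy p k) by rewrite dyS addrC addKr.
apply: (increment_law D0_driver D_copies) => //.
- exact: dy_ge0.
- by rewrite dy_le.
- by apply: dy_leT.
Qed.

Lemma incr_L2 i p k : (k < 2 ^ p)%N -> L2 P (incr i p k).
Proof.
move=> kp; split; first exact: incr_meas.
have [mY lY] := Y_L2 p.
apply: (eq_law_L1 (f := fun x => x ^+ 2) mY _ _ _ lY).1 => //; first exact: incr_meas.
by move=> B mB; rewrite incr_lawY.
Qed.

Let incr_E1 i p k : (k < 2 ^ p)%N -> E (incr i p k) = E (Y p).
Proof.
move=> kp; have [mY lY] := Y_L2 p.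
have law (B : set R) (mB : measurable B) := esym (incr_lawY i kp mB).
by have [_ ->] := eq_law_L1 (P := P) (f := fun x => x) mY (incr_meas i kp)
  (@measurable_id _ _ _) law (L2_L1 (Y_L2 p)).
Qed.

Let incr_E2 i p k : (k < 2 ^ p)%N ->
  E (fun w => incr i p k w ^+ 2) = E (fun w => Y p w ^+ 2).
Proof.
move=> kp; have [mY lY] := Y_L2 p.
have law (B : set R) (mB : measurable B) := esym (incr_lawY i kp mB).
have mf : measurable_fun setT (fun x : R => x ^+ 2) by apply: measurable_funX.
by have [_ ->] := eq_law_L1 mY (incr_meas i kp) mf law lY.
Qed.

Lemma incr_F J i p k : J i -> meas_wrt (history P D J (dy p k.+1)) (incr i p k).
Proof.
move=> Ji; have ob s : 0 <= s <= dy p k.+1 ->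
    meas_wrt (history P D J (dy p k.+1)) (lev (D i) s).
  move=> h B mB; apply: sub_sigma_algebra; left; exists (lev (D i) s); last by exists B.
  by exists i => //; left; right; exists s => //; rewrite /= in_itv.
apply/meas_wrtP; apply: measurable_funB; apply/meas_wrtP; apply: ob.
  by rewrite lexx dy_ge0.
by rewrite dy_ge0//= dy_le.
Qed.

Lemma incr_ind J i p k : (k < 2 ^ p)%N ->
  indep2 P (history P D J (dy p k)) (preimages [set incr i p k]).
Proof.
move=> kp; apply: (increment_indep cP D0_driver D_copies).
- exact: dy_ge0.
- by rewrite dy_le.
- exact: dy_leT.
Qed.

(** An increment of level p is the sum of two independent ones of level p+1. The cross term in its
    second moment is the square of a mean, hence nonnegative, and is dropped: this is why the second
    part is only an inequality. *)
Let halve p : E (Y p) = 2 * E (Y p.+1) /\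
  2 * E (fun w => Y p.+1 w ^+ 2) <= E (fun w => Y p w ^+ 2).
Proof.
have p1 : (1 < 2 ^ p.+1)%N by rewrite expnS; have := expn_gt0 2 p; lia.
have p0 : (0 < 2 ^ p.+1)%N by exact: ltnW.
have p2 : (0 < 2 ^ p)%N by rewrite expn_gt0.
have e w : incr 0 p 0 w = incr 0 p.+1 0 w + incr 0 p.+1 1 w.
  have e1 : dy p 1 = dy p.+1 2.
    by rewrite (@dy_refine _ T p p.+1)// subSnn expn1 mul1n.
  by rewrite /incr e1 !dy0; ring.
have l0 := incr_L2 0 p0; have l1 := incr_L2 0 p1.
split.
  rewrite -(incr_E1 0 p2); under eq_Rintegral do rewrite e.
  rewrite ED; [|exact: L2_L1|exact: L2_L1].
  by rewrite !incr_E1//; ring.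
have [lc ec] : L1 P (fun w => incr 0 p.+1 0 w * incr 0 p.+1 1 w) /\
    E (fun w => incr 0 p.+1 0 w * incr 0 p.+1 1 w) =
    E (incr 0 p.+1 0) * E (incr 0 p.+1 1).
  apply: indep_EM; [exact: L2_L1|exact: L2_L1|] => A B mA mB.
  have H := @incr_ind [set 0%N] 0%N _ _ p1; apply: H.
    by apply: (@incr_F [set 0%N] 0).
  by exists (incr 0 p.+1 1) => //; exists B.
have -> : E (fun w => Y p w ^+ 2) = E (fun w => (incr 0 p.+1 0 w ^+ 2 +
    2 * (incr 0 p.+1 0 w * incr 0 p.+1 1 w)) + incr 0 p.+1 1 w ^+ 2).
  rewrite -(incr_E2 0 p2); apply: eq_Rintegral => w _; rewrite e; ring.
rewrite ED; [|by apply: L1D; [case: l0|exact: L1Z]|by case: l1].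
rewrite ED; [|by case: l0|exact: L1Z].
rewrite EZ// ec !incr_E1// !incr_E2//.
by have := sqr_ge0 (E (Y p.+1)); lra.
Qed.

Definition mean0 := E (lev D0 T).
Definition var0 := E (fun w => lev D0 T w ^+ 2).

(* Two consecutive increments of step [T / 2^(p+1)] have the same law and add up to one of step
   [T / 2^p]. *)
Lemma incr_mean i p k : (k < 2 ^ p)%N -> E (incr i p k) = mean0 / 2 ^+ p.
Proof.
move=> kp; rewrite incr_E1//; elim: p {k kp} => [|p ih].
  by rewrite /Y /mean0 expr0 !divr1.
have [h _] := halve p; move: ih; rewrite h exprS => ih.
have e2 : 2 ^+ p != 0 :> R by rewrite gt_eqF// exp2_gt0.
have -> : mean0 / (2 * 2 ^+ p) = (mean0 / 2 ^+ p) / 2 by field.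
by rewrite -ih; field.
Qed.

Lemma incr_var i p k : (k < 2 ^ p)%N -> E (fun w => incr i p k w ^+ 2) <= var0 / 2 ^+ p.
Proof.
move=> kp; rewrite incr_E2//; elim: p {k kp} => [|p ih].
  by rewrite /Y /var0 expr0 !divr1.
have [_ h] := halve p; rewrite exprS.
have e2 : 2 ^+ p != 0 :> R by rewrite gt_eqF// exp2_gt0.
have -> : var0 / (2 * 2 ^+ p) = (var0 / 2 ^+ p) / 2 by field.
lra.
Qed.

Lemma var0_ge0 : 0 <= var0. Proof. exact: E_sqr_ge0. Qed.

(** The constant of [doob_max] at level p, rescaled: with a = var0 / 2^p, m = mean0 / 2^p and n =
    2^p it equals K0 / 2^p, the drift included. *)
Definition K0 := 16 * var0 + 2 * mean0 ^+ 2.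

Lemma K0_ge0 : 0 <= K0.
Proof.
by rewrite /K0 addr_ge0// mulr_ge0// ?sqr_ge0// var0_ge0.
Qed.

Let K0E p : 16 * (var0 / 2 ^+ p) + 2 * (2 ^ p)%:R * (mean0 / 2 ^+ p) ^+ 2 = K0 / 2 ^+ p.
Proof. by rewrite /K0 natrX; field; rewrite gt_eqF// exp2_gt0. Qed.

Section Dyadic.
Variables (J : set nat) (i p : nat).
Hypothesis Ji : J i.

Let G k := preimages (\bigcup_(j in J) observed (D j) (dy p k)) `|` P.-negligible.

Let mG k : (k <= 2 ^ p)%N -> <<s G k >> `<=` measurable.
Proof. by move=> kp; apply: (history_measurable cP D_copies); exact: dy_leT. Qed.

Let FS k : (k < 2 ^ p)%N -> <<s G k >> `<=` <<s G k.+1 >>.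
Proof. by move=> kp; apply: history_mono => //; rewrite dy_le. Qed.

Let D_F k : (k < 2 ^ p)%N -> meas_wrt <<s G k.+1 >> (incr i p k).
Proof. by move=> kp; exact: incr_F. Qed.

Let D_ind k : (k < 2 ^ p)%N -> indep2 P <<s G k >> (preimages [set incr i p k]).
Proof. exact: incr_ind. Qed.

Lemma dyadic_doob (h : nat -> Omega -> R) :
  (forall k, (k < 2 ^ p)%N -> meas_wrt (history P D J (dy p k)) (h k)) ->
  (forall k, (k < 2 ^ p)%N -> L2 P (h k)) ->
  exists Z : Omega -> R, [/\ L1 P Z,
    forall w j, (j <= 2 ^ p)%N -> (\sum_(k < j) h k w * incr i p k w) ^+ 2 <= Z w &
    E Z <= K0 / 2 ^+ p * \sum_(k < 2 ^ p) E (fun w => h k w ^+ 2)].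
Proof.
move=> hF hL; rewrite -K0E.
exact: (doob_max mG FS D_F D_ind (@incr_L2 i p) (@incr_mean i p) (@incr_var i p)).
Qed.

(** The threshold is put on the Riemann sum of [h ^ 2] over [0, T], so that the remainder does not
    depend on the level p. *)
Lemma dyadic_lenglart (h : nat -> Omega -> R) (c e : R) j :
  (forall k, (k < 2 ^ p)%N -> meas_wrt (history P D J (dy p k)) (h k)) ->
  0 < c -> 0 < e -> (j <= 2 ^ p)%N ->
  (P [set w | (e <= `|\sum_(k < j) h k w * incr i p k w|)%R] <=
   P [set w | (c <= \sum_(k < 2 ^ p) h k w ^+ 2 * (T / 2 ^+ p))%R] +
   (K0 * c / (T * e ^+ 2))%:E)%E.
Proof.
move=> hF c0 e0 jp.
have s0 : 0 < T / 2 ^+ p by rewrite divr_gt0 ?exp2_gt0.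
have c0' : 0 < c / (T / 2 ^+ p) by rewrite divr_gt0.
have v0 : 0 <= var0 / 2 ^+ p by rewrite divr_ge0 ?var0_ge0// ltW// exp2_gt0.
have := @lenglart _ _ _ _ _ G (incr i p) _ _ mG FS D_F D_ind (@incr_L2 i p)
  (@incr_mean i p) (@incr_var i p) h (c / (T / 2 ^+ p)) e j hF v0 c0' e0 jp.
rewrite K0E.
have -> : K0 / 2 ^+ p * (c / (T / 2 ^+ p)) / e ^+ 2 = K0 * c / (T * e ^+ 2).
  by field; rewrite !gt_eqF// exp2_gt0.
congr (_ <= P _ + _)%E; apply/seteqP; split => w /=;
  by rewrite -mulr_suml ler_pdivrMr.
Qed.

End Dyadic.

End DyadicIncrements.

(** * Ito integrals as limits of Riemann sums *)

Section AlmostSure.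
Context {R : realType} {disp : measure_display} {Omega : measurableType disp}.
Variable P : probability Omega R.
Hypothesis cP : measure_is_complete P.

Lemma meas_set_le (f g : Omega -> R) : measurable_fun setT f -> measurable_fun setT g ->
  measurable [set w | f w <= g w].
Proof. by move=> mf mg; rewrite -[X in measurable X]setTI; exact: measurable_fun_le. Qed.

Lemma meas_set_lee (f : Omega -> \bar R) (c : R) : measurable_fun setT f ->
  measurable [set w | (c%:E <= f w)%E].
Proof.
move=> mf; rewrite -[X in measurable X]setTI.
by apply: emeasurable_fun_le.
Qed.

Lemma cvg_e0 (u : nat -> \bar R) : u n @[n --> \oo] --> 0%E ->
  forall e : R, 0 < e -> exists N, forall n, (N <= n)%N -> (u n <= e%:E)%E.
Proof.
move=> /fine_cvgP[[N1 _ h1] /cvgrPdist_lt h2] e e0.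
have [N2 _ h3] := h2 _ e0.
exists (maxn N1 N2) => n; rewrite geq_max => /andP[n1 n2].
have := h3 n n2; rewrite /= sub0r normrN => /ltW h.
by rewrite -(fineK (h1 n n1)) lee_fin (le_trans (ler_norm _)).
Qed.

Lemma P_eventually (A : nat -> set Omega) : (forall p, measurable (A p)) ->
  {ae P, forall w, exists N, forall p, (N <= p)%N -> ~ A p w} ->
  forall e : R, 0 < e -> exists N, forall p, (N <= p)%N -> (P (A p) <= e%:E)%E.
Proof.
move=> mA aeA e e0.
have [|||||_ c] := @E_dominated _ _ _ P (fun p => \1_(A p)) (fun=> 0) (fun=> 1).
- by move=> p; exact: measurable_indic.
- exact: measurable_cst.
- apply: filterS aeA => w [N hN].
  apply/cvgrPdist_lt => e' e'0; exists N => // p /= /hN nA.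
  by rewrite indicE memNset// subr0 normr0.
- exact: L1_cst.
- apply: aeW => w p; rewrite indicE.
  by case: (_ \in _); rewrite ?normr1 ?normr0.
rewrite E_cst in c.
have /cvgrPdist_lt/(_ _ e0)[N _ hN] := c.
exists N => p /hN; rewrite /= sub0r normrN E_indic//.
rewrite ger0_norm ?fine_ge0// => h.
by rewrite -(fineK (fin_num_measure P _ (mA p))) lee_fin ltW.
Qed.

Lemma ae_cvg_prob (Y : nat -> Omega -> R) : (forall p, measurable_fun setT (Y p)) ->
  {ae P, forall w, Y p w @[p --> \oo] --> 0} ->
  forall e c : R, 0 < e -> 0 < c ->
  exists N, forall p, (N <= p)%N -> (P [set w | (c <= `|Y p w|)%R] <= e%:E)%E.
Proof.
move=> mY aeY e c e0 c0.
apply: (P_eventually _ _ e0) => [p|].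
  apply: meas_set_le => //; exact: measurableT_comp.
apply: filterS aeY => w /cvgrPdist_lt/(_ _ c0)[N _ hN].
exists N => p /hN /=; rewrite sub0r normrN => h; apply/negP.
by rewrite -ltNge.
Qed.

Lemma ae_cvg_prob_le (Y : nat -> Omega -> R) (V : Omega -> \bar R) :
  (forall p, measurable_fun setT (Y p)) -> measurable_fun setT V ->
  {ae P, forall w, (Y p w)%:E @[p --> \oo] --> V w} ->
  forall e c : R, 0 < e -> 0 < c ->
  exists N, forall p, (N <= p)%N ->
    (P [set w | (2 * c <= Y p w)%R] <= P [set w | (c%:E <= V w)%E] + e%:E)%E.
Proof.
move=> mY mV aeY e c e0 c0.
have mA p : measurable [set w | 2 * c <= Y p w] by exact: meas_set_le.
have mB : measurable [set w | (c%:E <= V w)%E] by exact: meas_set_lee.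
have [||N hN] := @P_eventually
    (fun p => [set w | 2 * c <= Y p w] `\` [set w | (c%:E <= V w)%E]) _ _ e e0.
- by move=> p; exact: measurableD.
- apply: filterS aeY => w cw.
  have [h|h] := leP c%:E (V w); first by exists 0%N => p _ [].
  have : \forall p \near \oo, ((Y p w)%:E < (2 * c)%:E)%E.
    have : (V w < (2 * c)%:E)%E by apply: lt_trans h _; rewrite lte_fin; lra.
    move=> h'; have hn : nbhs (V w) [set x | (x < (2 * c)%:E)%E].
      by apply: open_nbhs_nbhs; split => //; exact: open_ereal_lt_ereal.
    exact: (cw _ hn).
  move=> [N _ hN]; exists N => p /hN /=; rewrite lte_fin => h1 [h2 _].
  by move: h2; rewrite leNgt h1.
exists N => p /hN h.
apply: (@le_trans _ _ (P ([set w | (c%:E <= V w)%E] `|`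
    ([set w | 2 * c <= Y p w] `\` [set w | (c%:E <= V w)%E])))).
  apply: le_measure; rewrite ?inE//.
    by apply: measurableU => //; exact: measurableD.
  move=> w /= hw; have [h1|h1] := pselect (c%:E <= V w)%E; [by left|by right].
apply: (le_trans (measureU2 _ mB _)); first exact: measurableD.
exact: leeD2l.
Qed.

Variable T : R.
Hypothesis T0 : 0 < T.

Lemma supsq_measurable (f : R -> Omega -> R) :
  (forall t, 0 <= t <= T -> measurable_fun setT (f t)) ->
  {ae P, forall w t, 0 <= t < T -> f s w @[s --> t^'+] --> f t w} ->
  measurable_fun setT (fun w => supsq T (f ^~ w)).
Proof.
move=> mf aef.
(* A countable supremum over the dyadic times, enumerated by codes of pairs; the default 0 for other
   codes is harmless because [supsq] is nonnegative. It equals [supsq] only where the path is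
   right-continuous, and completeness does the rest. *)
pose g n w : \bar R := if @unpickle (nat * nat)%type n is Some pk then
  if (pk.2 <= 2 ^ pk.1)%N then (`|f (dy T pk.1 pk.2) w| ^+ 2)%:E else 0%E else 0%E.
have mg : measurable_fun setT (fun w => esups (fun n => g n w) 0%N).
  apply: measurable_fun_esups => n; rewrite /g.
  case: (unpickle n) => [[p k]|]/=; last exact: measurable_cst.
  case: (boolP (k <= 2 ^ p)%N) => kp; last exact: measurable_cst.
  apply/measurable_EFinP; apply: measurable_funX; apply: measurableT_comp => //.
  by apply: mf; exact: dy_in.
apply: (ae_measurable_fun cP _ mg); apply: filterS aef => w rc _.
apply/eqP; rewrite eq_le; apply/andP; split.
  apply: ge_ereal_sup => _ [n _ <-]; rewrite /g.
  have s0 : (0 <= supsq T (f ^~ w))%E.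
    apply: (le_trans _ (@supsq_ge _ T (f ^~ w) 0 _)); first by rewrite lee_fin sqr_ge0.
    by rewrite lexx ltW.
  case: (unpickle n) => [[p k]|]//=; case: ifPn => // kp.
  by apply: supsq_ge; exact: dy_in.
apply: supsq_le => // p k kp; apply: ereal_sup_ubound; exists (pickle (p, k)) => //.
by rewrite /g pickleK/= kp.
Qed.

End AlmostSure.

Lemma cvg_fin_sum {R : realType} (X : Type) (F : set_system X) (FF : Filter F)
    (I : finType) (f : I -> X -> R) (l : I -> R) :
  (forall i, f i x @[x --> F] --> l i) ->
  \sum_i f i x @[x --> F] --> \sum_i l i.
Proof.
move=> h; elim: (index_enum I) => [|i s ih].
  by under eq_fun do rewrite big_nil; rewrite big_nil; exact: cvg_cst.
by under eq_fun do rewrite big_cons; rewrite big_cons; exact: cvgD.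
Qed.

Section StepProcess.
Context {R : realType} {disp : measure_display} {Omega : measurableType disp}.
Implicit Types S : @simple_process R disp Omega.

(* The right-continuous version of [simple_val]: evaluated at the left end of a small interval, it
   gives the value of the simple process inside that interval, and it is adapted. *)
Definition simple_rval S (t : R) (w : Omega) : R :=
  \sum_(k < pieces S) coef S k w * (knot S k <= t < knot S k.+1)%R%:R.

(** For u just to the left of s, a <= u holds exactly when a < s; this turns each [knot, next
    knot[ into ]knot, next knot]. *)
Lemma simple_rval_left S s w :
  simple_rval S u w @[u --> s^'-] --> simple_val S s w.
Proof.
rewrite /simple_rval /simple_val; apply: cvg_fin_sum => k.
apply: cvgM; first exact: cvg_cst.
have h (a : R) : \forall u \near s^'-, (a <= u) = (a < s).
  have [as_|sa] := ltP a s; near=> u.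
    by apply/idP; near: u; exact: nbhs_left_ge.
  apply/negbTE; rewrite -ltNge; apply: lt_le_trans sa; near: u; exact: nbhs_left_lt.
apply: cvg_near_cst.
near=> u; congr (nat_of_bool _)%:R.
rewrite [u < _]ltNge [s <= _]leNgt; congr (_ && ~~ _); near: u; exact: h.
Unshelve. all: by end_near. Qed.

Variable T : R.
Hypothesis T0 : 0 < T.

Lemma grid_in k (t : nat -> R) j : grid T k t -> (j <= k)%N -> 0 <= t j <= T.
Proof.
move=> [t0 tm tT] jk.
have mono a b : (a <= b)%N -> (b <= k)%N -> t a <= t b.
  elim: b => [|b ih]; first by rewrite leqn0 => /eqP ->.
  rewrite leq_eqVlt => /predU1P[->//|]; rewrite ltnS => ab bk.
  by apply: le_trans (tm _ bk); apply: ih => //; exact: ltnW.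
by rewrite (le_trans t0 (mono _ _ _ jk))//= (le_trans _ tT)// mono.
Qed.

Variables (F : R -> set (set Omega)).

Lemma simple_rval_bound S : simple_predictable T F S ->
  exists M : R, forall t w, `|simple_rval S t w| <= M.
Proof.
move=> [_ hS].
have : forall k, exists M : R, (k < pieces S)%N -> forall w, `|coef S k w| <= M.
  move=> k; have [kp|] := boolP (k < pieces S)%N; last by exists 0.
  by have [_ [M hM]] := hS k kp; exists M.
move=> /choice[M hM]; exists (\sum_(k < pieces S) M k) => t w.
apply: (le_trans (ler_norm_sum _ _ _)); apply: ler_sum => k _.
rewrite normrM; have := hM k (ltn_ord k) w.
case: (_ && _); first by rewrite normr1 mulr1.
by rewrite normr0 mulr0; exact: le_trans.
Qed.

(** The sum telescopes from the first grid point not below [a]. These points decrease to [a] within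
    one mesh, so right continuity of [z] gives the limit; if the end point is at most [a], all terms
    vanish. *)
Lemma dyadic_tail (z : R -> R) (a : R) q j : (j <= 2 ^ q)%N -> 0 <= a <= T ->
  (forall t, 0 <= t < T -> z s @[s --> t^'+] --> z t) ->
  \sum_(l < j * 2 ^ (p - q)) (a <= dy T p l)%R%:R *
     (z (dy T p l.+1) - z (dy T p l)) @[p --> \oo] -->
  z (dy T q j) - z (Num.min (dy T q j) a).
Proof.
move=> jq /andP[a0 aT] rc; set v := dy T q j.
have vE p : (q <= p)%N -> v = dy T p (j * 2 ^ (p - q)) by move=> qp; exact: dy_refine.
have [va|av] := leP v a.
  rewrite subrr; apply: cvg_near_cst; near=> p.
  have qp : (q <= p)%N by near: p; exists q.
  rewrite big1// => l _.
  rewrite lt_geF ?mul0r//; apply: lt_le_trans va; rewrite (vE p qp).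
  by rewrite dy_lt.
have aT' : 0 <= a < T by rewrite a0; apply: lt_le_trans av _; exact: dy_leT.
have ex p : exists k, a <= dy T p k by exists (2 ^ p)%N; rewrite dy_full.
pose c p := ex_minn (ex p).
have ac p : a <= dy T p (c p) by rewrite /c; case: ex_minnP.
have cmin p k : a <= dy T p k -> (c p <= k)%N by rewrite /c; case: ex_minnP => ? _; apply.
have cl p l : (a <= dy T p l) = (c p <= l)%N.
  apply/idP/idP => [/cmin//|h]; apply: le_trans (ac p) _; by rewrite dy_le.
have cc : dy T p (c p) @[p --> \oo] --> a.
  apply: (@dist_cvg _ T) => // p; rewrite ger0_norm ?subr_ge0//.
  have [c0|c0] := posnP (c p).
    rewrite c0 dy0; apply: (@le_trans _ _ 0); first by lra.
    by rewrite divr_ge0 ?ltW// exp2_gt0.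
  have : ~~ (a <= dy T p (c p).-1) by rewrite cl -ltnNge prednK.
  rewrite -ltNge => h; have := @dyS _ T p (c p).-1; rewrite prednK// => ->; lra.
have cz : z (dy T p (c p)) @[p --> \oo] --> z a.
  by apply: at_right_seq => //; exact: rc.
have : z v - z (dy T p (c p)) @[p --> \oo] --> z v - z a.
  by apply: cvgB => //; exact: cvg_cst.
apply: cvg_trans; apply: near_eq_cvg; near=> p.
have qp : (q <= p)%N by near: p; exists q.
have cJ : (c p <= j * 2 ^ (p - q))%N by apply: cmin; rewrite -(vE p qp) ltW.
rewrite -(big_mkord xpredT (fun l => (a <= dy T p l)%R%:R * (z (dy T p l.+1) - z (dy T p l)))).
rewrite (big_cat_nat (leq0n _) cJ)//= big_nat_cond big1 ?add0r; last first.
  by move=> l /andP[/andP[_ lc] _]; rewrite cl leqNgt lc mul0r.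
rewrite (eq_big_nat _ _ (F2 := fun l => z (dy T p l.+1) - z (dy T p l))); last first.
  by move=> l /andP[cl' _]; rewrite cl cl' mul1r.
by rewrite telescope_sumr// -(vE p qp).
Unshelve. all: by end_near. Qed.

(** The indicator of a half-open interval is a difference of indicators of two half-lines, so each
    term of the simple process is a difference of two cases of [dyadic_tail]. *)
Lemma simple_rval_int S (z : R -> Omega -> R) w q j : (j <= 2 ^ q)%N ->
  simple_predictable T F S ->
  (forall t, 0 <= t < T -> z s w @[s --> t^'+] --> z t w) ->
  \sum_(l < j * 2 ^ (p - q)) simple_rval S (dy T p l) w *
     (z (dy T p l.+1) w - z (dy T p l) w) @[p --> \oo] -->
  simple_int S z (dy T q j) w.
Proof.
move=> jq [gr hS] rc.
pose A a p := \sum_(l < j * 2 ^ (p - q)) (a <= dy T p l)%R%:R *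
     (z (dy T p l.+1) w - z (dy T p l) w).
have -> : (fun p => \sum_(l < j * 2 ^ (p - q)) simple_rval S (dy T p l) w *
     (z (dy T p l.+1) w - z (dy T p l) w)) =
  (fun p => \sum_(k < pieces S) coef S k w * (A (knot S k) p - A (knot S k.+1) p)).
  apply/funext => p; rewrite /simple_rval.
  under eq_bigr do rewrite mulr_suml.
  rewrite exchange_big/=; apply: eq_bigr => k _.
  rewrite /A -sumrB mulr_sumr; apply: eq_bigr => l _.
  rewrite -mulrA -mulrBl; congr (_ * (_ * _)).
  have [_ tm _] := gr; have km := tm _ (ltn_ord k).
  rewrite ltNge; have [h1|h1] := leP (knot S k.+1) (dy T p l).
    by rewrite (le_trans km h1)/= subrr.
  by rewrite andbT subr0.
rewrite /simple_int; apply: cvg_fin_sum => k; apply: cvgM; first exact: cvg_cst.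
have k1 : 0 <= knot S k <= T by apply: (grid_in gr); exact: ltnW.
have k2 : 0 <= knot S k.+1 <= T by exact: (grid_in gr).
have c1 := dyadic_tail (z := z ^~ w) jq k1 rc.
have c2 := dyadic_tail (z := z ^~ w) jq k2 rc.
have -> : z (Num.min (dy T q j) (knot S k.+1)) w - z (Num.min (dy T q j) (knot S k)) w =
  (z (dy T q j) w - z (Num.min (dy T q j) (knot S k)) w) -
  (z (dy T q j) w - z (Num.min (dy T q j) (knot S k.+1)) w) by ring.
exact: cvgB.
Qed.

End StepProcess.

Section ItoRiemann.
Context {R : realType} {disp : measure_display} {Omega : measurableType disp}.
Variable P : probability Omega R.
Hypothesis cP : measure_is_complete P.
Variables (T : R) (d : nat) (D0 : @driver R disp Omega).
Variable D : nat -> @driver R disp Omega.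
Hypothesis T0 : 0 < T.
Hypothesis D0_driver : is_driver P T d D0.
Hypothesis D0_sqint : square_integrable P T (lev D0).
Hypothesis D_copies : independent_copies P T D0 D.
Variables (J : set nat) (i : nat).
Hypothesis Ji : J i.
Variables (H I : R -> Omega -> R).
Local Notation dy := (dy T).

Hypothesis HF : forall p k, (k < 2 ^ p)%N -> meas_wrt (history P D J (dy p k)) (H (dy p k)).
Hypothesis Hbounded : {ae P, forall w, exists M : R, forall s, 0 <= s <= T -> `|H s w| <= M}.
Hypothesis Hleft : {ae P, forall w s, 0 < s <= T -> H u w @[u --> s^'-] --> H s w}.
Hypothesis Imeas : forall t, 0 <= t <= T -> measurable_fun setT (I t).
Hypothesis Iright : {ae P, forall w t, 0 <= t < T -> I s w @[s --> t^'+] --> I t w}.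
Hypothesis ito : ito_integral P T (history P D J) (lev (D i)) H I.

Definition riemann p j (w : Omega) := \sum_(k < j) H (dy p k) w * incr T D i p k w.

Lemma lev_right : {ae P, forall w t, 0 <= t < T -> lev (D i) s w @[s --> t^'+] --> lev (D i) t w}.
Proof.
by have [/(_ i)[_ _ + _] _] := D_copies; apply: filterS => w [[h _] _].
Qed.

Lemma history_meas s (X : Omega -> R) : s <= T -> meas_wrt (history P D J s) X ->
  measurable_fun setT X.
Proof.
move=> sT mX _ B mB; rewrite setTI.
by apply: (history_measurable cP D_copies sT); exact: mX.
Qed.

Lemma H_meas p k : (k < 2 ^ p)%N -> measurable_fun setT (H (dy p k)).
Proof.
by move=> kp; apply: (history_meas (s := dy p k)); [apply: dy_leT => //; exact: ltnW|exact: HF].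
Qed.

Lemma riemann_meas p j : (j <= 2 ^ p)%N -> measurable_fun setT (riemann p j).
Proof.
move=> jp; apply: measurable_sum => k.
have kp : (k < 2 ^ p)%N by exact: leq_trans jp.
by apply: measurable_funM; [exact: H_meas|exact: (incr_meas T0 D_copies)].
Qed.

Lemma simple_rval_F S t : simple_predictable T (history P D J) S -> t <= T ->
  meas_wrt (history P D J t) (simple_rval S t).
Proof.
move=> [gr hS] tT; apply/meas_wrtP; apply: measurable_sum => k.
have [mc _] := hS k (ltn_ord k).
case: (boolP (knot S k <= t < knot S k.+1)) => [/andP[kt _]|_]; last first.
  rewrite [X in measurable_fun _ X](_ : _ = fun=> 0); first exact: measurable_cst.
  by apply/funext => x; rewrite mulr0.
apply: measurable_funM => //; apply/meas_wrtP; apply: meas_wrtS mc.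
by apply: history_mono.
Qed.

Lemma simple_coef_meas S k : simple_predictable T (history P D J) S ->
  (k < pieces S)%N -> measurable_fun setT (coef S k).
Proof.
move=> [gr hS] kS; have [mc _] := hS k kS.
apply: (history_meas _ mc); have := grid_in gr (ltnW kS).
by case/andP.
Qed.

Lemma simple_int_meas S t : simple_predictable T (history P D J) S -> 0 <= t <= T ->
  measurable_fun setT (simple_int S (lev (D i)) t).
Proof.
move=> pS tT; have [gr _] := pS; apply: measurable_sum => k.
have h j : (j <= pieces S)%N -> measurable_fun setT (lev (D i) (Num.min t (knot S j))).
  move=> jS; apply: (lev_meas D_copies); have /andP[a b] := grid_in gr jS.
  by case/andP: tT => c e; rewrite le_min c a ge_min e.
apply: measurable_funM; first exact: simple_coef_meas.
by apply: measurable_funB; apply: h => //; exact: ltnW.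
Qed.

Lemma simple_int_right S w : simple_predictable T (history P D J) S ->
  (forall t, 0 <= t < T -> lev (D i) s w @[s --> t^'+] --> lev (D i) t w) ->
  forall t, 0 <= t < T -> simple_int S (lev (D i)) s w @[s --> t^'+] -->
    simple_int S (lev (D i)) t w.
Proof.
move=> [gr _] rc t tT.
have h (a : R) : lev (D i) (Num.min s a) w @[s --> t^'+] --> lev (D i) (Num.min t a) w.
  have [ta|at_] := ltP t a.
    apply: cvg_trans (rc t tT); apply: near_eq_cvg; near=> s.
    rewrite min_l// ltW//; near: s; exact: nbhs_right_lt.
  apply: cvg_near_cst; near=> s; rewrite min_r//.
  by apply: le_trans at_ _; near: s; exact: nbhs_right_ge.
apply: cvg_fin_sum => k; apply: cvgM; first exact: cvg_cst.
by apply: cvgB; exact: h.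
Unshelve. all: by end_near. Qed.

(* By [dyadic_lenglart] the Riemann sums of [H] are close in probability to those of a simple
   process close to [H] in L^2(dt), and for a simple process with right-continuous integrator the
   Riemann sums converge pathwise. *)
Lemma riemann_cvg q j (e c : R) : (j <= 2 ^ q)%N -> 0 < e -> 0 < c ->
  exists N, forall p, (N <= p)%N -> (q <= p)%N ->
    (P [set w | (c <= `|riemann p (j * 2 ^ (p - q)) w - I (dy q j) w|)%R] <= e%:E)%E.
Proof.
move=> jq e0 c0.
have vT : 0 <= dy q j <= T by exact: dy_in.
have [S [pS cS1 cS2]] := ito.
(* The five shares: the L^2 distance of the simple process to [H], its replacement by a Riemann sum,
   the remainder of [dyadic_lenglart], the Riemann sums of the simple process, and the distance of
   its integral to [I]. *)
have e4 : 0 < e / 5 by rewrite divr_gt0.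
have c3 : 0 < c / 3 by rewrite divr_gt0.
have c32 : 0 < (c / 3) ^+ 2 by rewrite exprn_gt0.
have K1 : 0 < K0 P T D0 + 1 by rewrite ltr_wpDl// K0_ge0.
(* Chosen so that the remainder of [dyadic_lenglart] at the threshold [2 * g] is at most e / 5; the
   added 1 covers [K0] = 0. *)
pose g := (e / 5) * (T * (c / 3) ^+ 2) / (2 * (K0 P T D0 + 1)).
have g0 : 0 < g by rewrite divr_gt0 ?mulr_gt0.
have gK : K0 P T D0 * (2 * g) / (T * (c / 3) ^+ 2) <= e / 5.
  rewrite ler_pdivrMr ?mulr_gt0//.
  have -> : e / 5 * (T * (c / 3) ^+ 2) = (K0 P T D0 + 1) * (2 * g).
    by rewrite /g; field; rewrite !gt_eqF// addrC.
  by apply: ler_wpM2r; [rewrite mulr_ge0// ltW|lra].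
have [N1 h1] := cvg_e0 (cS1 g g0) e4.
have [N2 h2] := cvg_e0 (cS2 _ c32) e4.
pose m := maxn N1 N2.
have {}h1 := h1 m (leq_maxl _ _); have {}h2 := h2 m (leq_maxr _ _).
have pSm := pS m; have lr := lev_right.
pose V w := (\int[lebesgue_measure]_(s in `[0%R, T])
        (`|simple_val (S m) s w - H s w| ^+ 2)%:E)%E.
pose U p k w := simple_rval (S m) (dy p k) w - H (dy p k) w.
have mU p k : (k < 2 ^ p)%N -> meas_wrt (history P D J (dy p k)) (U p k).
  move=> kp; apply/meas_wrtP; apply: measurable_funB; apply/meas_wrtP; last exact: HF.
  by apply: simple_rval_F => //; apply: dy_leT => //; exact: ltnW.
pose W p w := \sum_(k < 2 ^ p) U p k w ^+ 2 * (T / 2 ^+ p).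
have mW p : measurable_fun setT (W p).
  apply: measurable_sum => k; apply: measurable_funM => //; apply: measurable_funX.
  apply: (history_meas (s := dy p k)); last exact: mU.
  by apply: dy_leT => //; exact: ltnW.
have WV : {ae P, forall w, (W p w)%:E @[p --> \oo] --> V w}.
  apply: filterS2 Hbounded Hleft => w [M hM] hl.
  have [M' hM'] := simple_rval_bound pSm.
  apply: (@integral_stepf_cvg _ T T0 (fun s => simple_rval (S m) s w - H s w)
    (fun s => simple_val (S m) s w - H s w) (M' + M)).
    by move=> s sT; apply: (le_trans (ler_normB _ _)); apply: lerD; [exact: hM'|exact: hM].
  by move=> s sT; apply: cvgB; [exact: simple_rval_left|exact: hl].
(* No joint measurability in time and [w] is available: [V] is measurable as an almost sure limit of
   the Riemann sums [W]. *)
have mV : measurable_fun setT V.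
  apply: (ae_measurable_fun cP (f := fun w => limn_esup (fun p => (W p w)%:E))).
    apply: filterS WV => w h _; rewrite is_cvg_limn_esupE; last by apply/cvg_ex; exists (V w).
    exact: cvg_lim h.
  by apply: measurable_fun_limn_esup => p; exact/measurable_EFinP.
have [N3 h3] := ae_cvg_prob_le mW mV WV e4 g0.
(* For p < q the truncated subtraction would leave an index range that may exceed the grid of level
   p. *)
pose Y p w := if (q <= p)%N then
  \sum_(l < j * 2 ^ (p - q)) simple_rval (S m) (dy p l) w * incr T D i p l w -
  simple_int (S m) (lev (D i)) (dy q j) w else 0.
have jqp p : (q <= p)%N -> (j * 2 ^ (p - q) <= 2 ^ p)%N.
  by move=> qp; rewrite -{2}(subnKC qp) expnD leq_pmul2r// expn_gt0.
have mS p l : (l < 2 ^ p)%N -> measurable_fun setT (simple_rval (S m) (dy p l)).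
  move=> lp; have lT : dy p l <= T by apply: dy_leT => //; exact: ltnW.
  by apply: (history_meas lT); exact: simple_rval_F.
have mY p : measurable_fun setT (Y p).
  rewrite /Y; case: (boolP (q <= p)%N) => qp; last exact: measurable_cst.
  apply: measurable_funB; last exact: simple_int_meas.
  apply: measurable_sum => l; have lp : (l < 2 ^ p)%N by exact: leq_trans (jqp _ qp).
  by apply: measurable_funM; [exact: mS|exact: (incr_meas T0 D_copies)].
have Y0 : {ae P, forall w, Y p w @[p --> \oo] --> 0}.
  apply: filterS lr => w rc.
  have := simple_rval_int T0 jq pSm rc => h.
  have : (\sum_(l < j * 2 ^ (p - q)) simple_rval (S m) (dy p l) w * incr T D i p l w -
    simple_int (S m) (lev (D i)) (dy q j) w) @[p --> \oo] --> 0.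
    rewrite -[X in _ --> X](subrr (simple_int (S m) (lev (D i)) (dy q j) w)).
    by apply: cvgB; [exact: h|exact: cvg_cst].
  apply: cvg_trans; apply: near_eq_cvg; exists q => // p /= qp.
  by rewrite /Y qp.
have [N4 h4] := ae_cvg_prob mY Y0 e4 c3.
exists (maxn N3 N4) => p; rewrite geq_max => /andP[p3 p4] qp.
have {}h3 := h3 p p3; have {}h4 := h4 p p4.
have h5 := @dyadic_lenglart _ _ _ P cP T d D0 D T0 D0_driver D0_sqint D_copies J i p Ji
  (U p) (2 * g) (c / 3) _ (mU p) (mulr_gt0 (ltr0Sn _ 1) g0) c3 (jqp p qp).
set A5 := [set w | (c / 3 <= _)%R] in h5; set A4 := [set w | (c / 3 <= _)%R] in h4.
set A2 := [set w | _] in h2.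
have mA5 : measurable A5.
  apply: meas_set_le => //; apply: measurableT_comp => //; apply: measurable_sum => k.
  have kp : (k < 2 ^ p)%N by exact: leq_trans (jqp _ qp).
  apply: measurable_funM; last exact: (incr_meas T0 D_copies).
  apply: (history_meas (s := dy p k)); last exact: mU.
  by apply: dy_leT => //; exact: ltnW.
have mA4 : measurable A4 by apply: meas_set_le => //; exact: measurableT_comp.
have mA2 : measurable A2.
  apply: meas_set_lee; apply: (@supsq_measurable _ _ _ P cP T T0
    (fun t w => simple_int (S m) (lev (D i)) t w - I t w)).
    by move=> t tT; apply: measurable_funB; [exact: simple_int_meas|exact: Imeas].
  apply: filterS2 lr Iright => w r1 r2 t tT; apply: cvgB; last exact: r2.
  exact: simple_int_right.
apply: (@le_trans _ _ (P ((A5 `|` A4) `|` A2))).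
  apply: le_measure; rewrite ?inE.
  - apply: meas_set_le => //; apply: measurableT_comp => //; apply: measurable_funB.
      by apply: riemann_meas; exact: jqp.
    exact: Imeas.
  - by apply: measurableU => //; exact: measurableU.
  move=> w /= cw; apply: contrapT => nA.
  have n5 : `|\sum_(k < j * 2 ^ (p - q)) U p k w * incr T D i p k w| < c / 3.
    by rewrite ltNge; apply/negP => h; apply: nA; left; left.
  have n4 : `|Y p w| < c / 3.
    by rewrite ltNge; apply/negP => h; apply: nA; left; right.
  have n2 : `|simple_int (S m) (lev (D i)) (dy q j) w - I (dy q j) w| < c / 3.
    rewrite ltNge; apply/negP => h; apply: nA; right.
    apply: (le_trans _ (supsq_ge _ vT)).
    by rewrite lee_fin lerXn2r// nnegrE// ltW.
  rewrite /Y qp in n4.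
  have e' : riemann p (j * 2 ^ (p - q)) w =
    \sum_(l < j * 2 ^ (p - q)) simple_rval (S m) (dy p l) w * incr T D i p l w -
    \sum_(k < j * 2 ^ (p - q)) U p k w * incr T D i p k w.
    rewrite -sumrB; apply: eq_bigr => l _; rewrite /U; ring.
  move: cw n5 n4 n2; rewrite e'.
  set a := \sum_(k < _) U p k w * _; set b := \sum_(l < _) simple_rval _ _ _ * _.
  set s := simple_int _ _ _ _; set v := I _ _.
  move=> cw; rewrite !ltr_norml => /andP[? ?] /andP[? ?] /andP[? ?].
  have : `|b - a - v| < c by rewrite ltr_norml; apply/andP; split; lra.
  by rewrite ltNge cw.
have m54 : measurable (A5 `|` A4) by exact: measurableU.
apply: (le_trans (measureU2 _ m54 mA2)).
apply: (@le_trans _ _ ((P A5 + P A4) + P A2)%E).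
  by apply: leeD2r; exact: measureU2.
apply: (@le_trans _ _ ((((e / 5)%:E + (e / 5)%:E) + (e / 5)%:E) + (e / 5)%:E + (e / 5)%:E)%E).
  apply: leeD => //; apply: leeD => //.
  apply: (le_trans h5); apply: leeD; last by rewrite lee_fin.
  apply: (le_trans h3); apply: leeD => //.
by rewrite -!EFinD lee_fin; lra.
Qed.

End ItoRiemann.

(** * Empirical measures and couplings *)

Section Discrete.
Context {R : realType} d (E : measurableType d).

(** The measure is known only through its values on sets; it is identified with a finite sum of
    scaled Dirac masses indexed by an enumeration of [I], with the empty [I] apart for want of a
    default element. *)
Lemma discrete_integral (nu : {measure set E -> \bar R}) (I : finType) (c : I -> R) (f : I -> E)
    (g : E -> R) :
  (forall i, 0 <= c i) ->
  (forall A, measurable A -> nu A = (\sum_i c i * \1_A (f i))%:E) ->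
  measurable_fun setT g -> (forall x, 0 <= g x) ->
  (\int[nu]_x (g x)%:E = (\sum_i c i * g (f i))%:E)%E.
Proof.
move=> c0 nuE mg g0.
have mg' : measurable_fun setT (EFin \o g) by exact/measurable_EFinP.
have [/card0_eq I0|] := posnP #|I|.
  have nu0 A : measurable A -> nu A = mzero A.
    by move=> mA; rewrite nuE// big_pred0// => i; have := I0 i; rewrite inE.
  rewrite (eq_measure_integral mzero); last by move=> A mA _; exact: nu0.
  by rewrite integral_measure_zero big_pred0// => i; have := I0 i; rewrite inE.
move=> /card_gt0P[i0 _].
have sumE (F : I -> \bar R) : (\sum_i F i = \sum_(j < #|I|) F (nth i0 (enum I) j))%E.
  rewrite -big_enum (big_nth i0) big_mkord -cardE.
  by apply: eq_bigl => j; rewrite ?cardE.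
pose m (j : nat) : {measure set E -> \bar R} :=
  mscale (NngNum (c0 (nth i0 (enum I) j))) (\d_(f (nth i0 (enum I) j))).
have nuE' A : measurable A -> A `<=` setT -> nu A = msum m #|I| A.
  move=> mA _; rewrite nuE// -sumEFin sumE /msum; apply: eq_bigr => j _.
  by rewrite /m /mscale/= /dirac EFinM.
rewrite (eq_measure_integral _ nuE') ge0_integral_measure_sum//; last first.
  by move=> x _; rewrite lee_fin.
rewrite -sumEFin sumE; apply: eq_bigr => j _.
rewrite /m ge0_integral_mscale//=; last by move=> x _; rewrite lee_fin.
by rewrite integral_dirac// diracT mul1e EFinM.
Qed.

Lemma mnormalize_fin (mu : {measure set E -> \bar R}) (P : probability E R) (r : R) A :
  0 < r -> mu setT = r%:E -> mnormalize mu P A = (mu A * r^-1%:E)%E.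
Proof.
move=> r0 mur; rewrite /mnormalize mur; case: ifPn => //.
by rewrite orbF eqe gt_eqF.
Qed.

Lemma discrete_probability (I : finType) (i0 : I) (c : I -> R) (f : I -> E) :
  (forall i, 0 <= c i) -> \sum_i c i = 1 ->
  exists nu : probability E R, forall A, measurable A ->
    nu A = (\sum_i c i * \1_A (f i))%:E.
Proof.
move=> c0 c1.
have sumE (F : I -> \bar R) : (\sum_i F i = \sum_(j < #|I|) F (nth i0 (enum I) j))%E.
  rewrite -big_enum (big_nth i0) big_mkord -cardE.
  by apply: eq_bigl => j; rewrite ?cardE.
pose m (j : nat) : {measure set E -> \bar R} :=
  mscale (NngNum (c0 (nth i0 (enum I) j))) (\d_(f (nth i0 (enum I) j))).
have mE A : msum m #|I| A = (\sum_i c i * \1_A (f i))%:E.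
  rewrite -sumEFin sumE /msum; apply: eq_bigr => j _.
  by rewrite /m /mscale/= /dirac EFinM.
exists (mnormalize (msum m #|I|) (\d_(f i0))) => A mA.
have m1 : msum m #|I| setT = 1%E.
  rewrite mE -c1; congr EFin; apply: eq_bigr => i _.
  by rewrite indicE mem_set// mulr1.
transitivity (msum m #|I| A * 1^-1%:E)%E; first exact: mnormalize_fin.
by rewrite invr1 mule1 mE.
Qed.

End Discrete.

Section Empirical.
Context {R : realType}.
Implicit Types (y : nat -> R).

Lemma measurable_sqnorm : measurable_fun setT (fun x : R => `|x| ^+ 2).
Proof. by apply: measurable_funX; exact: normr_measurable. Qed.

Lemma empiricalE n y (A : set R) : (0 < n)%N ->
  empirical n y A = (\sum_(j < n) n%:R^-1 * \1_A (y j))%:E.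
Proof.
move=> n0.
pose mm : {measure set (measurableTypeR R) -> \bar R} :=
  msum (fun j => \d_(y j : measurableTypeR R)) n.
have mE B : mm B = (\sum_(j < n) \1_B (y j))%:E.
  by rewrite /mm /= /msum -sumEFin.
have m1 : mm setT = n%:R%:E.
  rewrite mE; congr EFin; rewrite (eq_bigr (fun=> 1)) => [|i _].
    by rewrite sumr_const card_ord.
  by rewrite indicE mem_set.
transitivity (mm A * (n%:R^-1)%:E)%E.
  by apply: mnormalize_fin => //; rewrite ltr0n.
by rewrite mE -EFinM mulr_suml; congr EFin; apply: eq_bigr => j _; rewrite mulrC.
Qed.

Lemma empirical_integral n y (g : R -> R) : (0 < n)%N -> measurable_fun setT g ->
  (forall x, 0 <= g x) ->
  (\int[empirical n y]_x (g x)%:E = (\sum_(j < n) n%:R^-1 * g (y j))%:E)%E.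
Proof.
move=> n0 mg g0.
apply: (@discrete_integral R _ (measurableTypeR R) (empirical n y) 'I_n
  (fun=> n%:R^-1) (fun j => y j)) => //.
by move=> A mA; exact: empiricalE.
Qed.

Lemma empirical_P2 n y : (0 < n)%N -> P2 (empirical n y).
Proof.
move=> n0; rewrite /P2/= (@empirical_integral n y (fun x => `|x| ^+ 2))// ?ltry//.
exact: measurable_sqnorm.
Qed.

End Empirical.

Section SigmaLipschitz.
Context {R : realType}.
Variables (T : R) (sigma : R -> R -> probR R -> R).
Local Notation M2 := (measurableTypeR R * measurableTypeR R)%type.

Let msq : measurable_fun setT (fun z : M2 => `|z.1 - z.2| ^+ 2).
Proof.
apply: measurable_funX; apply: measurableT_comp => //.
by apply: measurable_funB.
Qed.

(** The Lipschitz condition tested on one coupling at a time. Every later estimate exhibits an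
    explicit coupling, so the infimum defining [vaserstein] occurs only in [lipschitz_sigma_lip]. *)
Definition sigma_lip (L : R) := forall t, 0 <= t <= T ->
  forall (x y : R) (mu nu : probR R) (Q : probability M2 R) (c : R),
  P2 mu -> P2 nu -> coupling mu nu Q -> 0 <= c ->
  (\int[Q]_z (`|z.1 - z.2| ^+ 2)%:E <= c%:E)%E ->
  `|sigma t x mu - sigma t y nu| <= L * (`|x - y| + Num.sqrt c).

Lemma lipschitz_sigma_lip : lipschitz_coef T sigma -> exists L, 0 <= L /\ sigma_lip L.
Proof.
move=> [L hL]; exists `|L|; split => // t tT x y mu nu Q c P2mu P2nu cQ c0 Qc.
have W : (vaserstein mu nu <= (Num.sqrt c)%:E)%E.
  apply: (@le_trans _ _ ((\int[Q]_z (`|z.1 - z.2| ^+ 2)%:E) `^ 2^-1)%E).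
    by apply: ereal_inf_lbound; exists Q.
  rewrite -powR12_sqrt// -poweR_EFin; apply: gt0_ler_poweR => //.
  - by rewrite in_itv/= leey andbT integral_ge0// => z _; rewrite lee_fin sqr_ge0.
  - by rewrite in_itv/= leey andbT lee_fin.
have W0 : (0 <= vaserstein mu nu)%E.
  by apply: le_ereal_inf_tmp => _ [Q' _ <-]; exact: poweR_ge0.
rewrite -lee_fin; apply: (le_trans (hL t tT x y mu nu P2mu P2nu)).
rewrite EFinM; apply: (@le_trans _ _ (`|L|%:E * (`|x - y|%:E + vaserstein mu nu))%E).
  apply: lee_wpmul2r; last by rewrite lee_fin ler_norm.
  by apply: adde_ge0.
by apply: lee_wpmul2l => //; rewrite EFinD leeD2l.
Qed.

Variable L : R.
Hypothesis L0 : 0 <= L.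
Hypothesis sigL : sigma_lip L.

(** The coupling puts mass 1/n on each pair of atoms with the same index. *)
Lemma sigma_empirical n (a a' t : R) (y y' : nat -> R) : (0 < n)%N -> 0 <= t <= T ->
  `|sigma t a (empirical n y) - sigma t a' (empirical n y')| <=
  L * (`|a - a'| + Num.sqrt (\sum_(j < n) n%:R^-1 * (y j - y' j) ^+ 2)).
Proof.
move=> n0 tT.
have ni0 : 0 <= n%:R^-1 :> R by rewrite invr_ge0.
have s1 : \sum_(j < n) n%:R^-1 = 1 :> R.
  by rewrite sumr_const card_ord -(mulr_natr n%:R^-1) mulVf// pnatr_eq0; lia.
have [Q hQ] := @discrete_probability R _ M2 'I_n (Ordinal n0) (fun=> n%:R^-1)
   (fun j => (y j, y' j)) (fun=> ni0) s1.
apply: (@sigL t tT a a' _ _ Q).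
- exact: empirical_P2.
- exact: empirical_P2.
- split => A mA; rewrite hQ.
  + by rewrite empiricalE//; congr EFin; apply: eq_bigr => j _; rewrite !indicE in_setX in_setT andbT.
  + exact: measurableX.
  + by rewrite empiricalE//; congr EFin; apply: eq_bigr => j _; rewrite !indicE in_setX in_setT.
  + exact: measurableX.
- by apply: sumr_ge0 => j _; rewrite mulr_ge0// sqr_ge0.
rewrite (@discrete_integral R _ M2 Q 'I_n (fun=> n%:R^-1) (fun j => (y j, y' j))
  (fun z => `|z.1 - z.2| ^+ 2))//.
by rewrite lee_fin; apply: ler_sum => j _ /=; rewrite real_normK ?num_real.
Qed.

Section Law.
Context {disp : measure_display} {Omega : measurableType disp}.
Variable P : probability Omega R.

Lemma law_integral (X : Omega -> R) (mu : probR R) (g : R -> R) :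
  is_law P X mu -> measurable_fun setT g -> (forall x, 0 <= g x) ->
  (\int[mu]_x (g x)%:E = \int[P]_w (g (X w))%:E)%E.
Proof.
move=> [mX muX] mg g0.
pose X' : {mfun Omega >-> measurableTypeR R} := @mfun_Sub _ _ Omega (measurableTypeR R) X (mem_set mX).
rewrite (eq_measure_integral (distribution P X')); last by move=> A mA _; exact: muX.
apply: (@ge0_integral_distribution _ _ _ _ _ P X' (fun x => (g x)%:E)).
  exact/measurable_EFinP.
by move=> x; rewrite lee_fin.
Qed.

Lemma law_P2 (X : Omega -> R) (mu : probR R) : is_law P X mu -> L2 P X -> P2 mu.
Proof.
move=> lX [mX l2].
rewrite /P2/= (law_integral lX measurable_sqnorm (fun x => sqr_ge0 `|x|)).
under eq_integral do rewrite real_normK ?num_real//.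
by rewrite -EFin_E// ltry.
Qed.

(** The coupling is the joint law of [X] and [Y]. *)
Lemma sigma_law (X Y : Omega -> R) (mu nu : probR R) (a a' t : R) :
  is_law P X mu -> is_law P Y nu -> L2 P X -> L2 P Y -> 0 <= t <= T ->
  `|sigma t a mu - sigma t a' nu| <=
  L * (`|a - a'| + Num.sqrt (\int[P]_w ((X w - Y w) ^+ 2))).
Proof.
move=> lX lY X2 Y2 tT; have [mX muX] := lX; have [mY muY] := lY.
have mXY : measurable_fun setT (fun w => (X w, Y w) : M2).
  by apply/measurable_fun_pairP; split.
pose XY : {mfun Omega >-> M2} := @mfun_Sub _ _ Omega M2 _ (mem_set mXY).
apply: (@sigL t tT a a' mu nu (distribution P XY)).
- exact: law_P2 lX X2.
- exact: law_P2 lY Y2.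
- split => A mA.
    by rewrite muX//; congr (P _); apply/seteqP; split => [w []|w].
  by rewrite muY//; congr (P _); apply/seteqP; split => [w []|w].
- exact: E_sqr_ge0.
have f0 (z : M2) : (0 <= (`|z.1 - z.2| ^+ 2)%:E)%E by rewrite lee_fin sqr_ge0.
have mf : measurable_fun setT (fun z : M2 => (`|z.1 - z.2| ^+ 2)%:E) by exact/measurable_EFinP.
rewrite (@ge0_integral_distribution _ _ _ _ _ P XY _ mf f0).
have [_ l2] := L2B X2 Y2.
rewrite EFin_E//; apply: ge0_le_integral => //.
- by move=> w _; rewrite lee_fin sqr_ge0.
- apply: measurableT_comp => //; exact/measurable_EFinP.
- by apply/measurable_EFinP; exact: L1_meas l2.
- by move=> w _ /=; rewrite lee_fin real_normK ?num_real.
Qed.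

End Law.

(** The mass that has to move is at most the sum of the |u i - v i|, and it moves by at most 2B,
    whence the factor 4B^2. *)
Lemma sigma_finite_support (I : finType) (i0 : I) (u v : I -> R) (a : I -> R) (B t x : R)
    (mu nu : probR R) : 0 <= t <= T ->
  (forall i, 0 <= u i) -> (forall i, 0 <= v i) -> (forall i, `|a i| <= B) ->
  (forall A : set R, measurable A -> mu A = (\sum_i u i * \1_A (a i))%:E) ->
  (forall A : set R, measurable A -> nu A = (\sum_i v i * \1_A (a i))%:E) ->
  `|sigma t x mu - sigma t x nu| <= L * Num.sqrt (4 * B ^+ 2 * \sum_i `|u i - v i|).
Proof.
move=> tT u0 v0 aB muE nuE.
have total (w : I -> R) (m : probR R) :
    (forall A : set R, measurable A -> m A = (\sum_i w i * \1_A (a i))%:E) -> \sum_i w i = 1.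
  move=> mE; apply: EFin_inj; rewrite -[RHS](@probability_setT _ _ _ m) mE//.
  by congr EFin; apply: eq_bigr => i _; rewrite indicE mem_set// mulr1.
have u1 := total _ _ muE; have v1 := total _ _ nuE.
have P2d (w : I -> R) (m : probR R) : (forall i, 0 <= w i) ->
    (forall A : set R, measurable A -> m A = (\sum_i w i * \1_A (a i))%:E) -> P2 m.
  move=> w0 mE; rewrite /P2/= (@discrete_integral R _ (measurableTypeR R) m I w a
    (fun x => `|x| ^+ 2) w0 mE measurable_sqnorm)//.
  exact: ltry.
pose mi i := Num.min (u i) (v i).
have mi0 i : 0 <= mi i by rewrite le_min u0 v0.
have mu' i : 0 <= u i - mi i by rewrite subr_ge0 ge_min lexx.
have mv' i : 0 <= v i - mi i by rewrite subr_ge0 ge_min lexx orbT.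
pose res := \sum_i (u i - mi i).
have res' : res = \sum_i (v i - mi i) by rewrite /res !sumrB u1 v1.
have res0 : 0 <= res by exact: sumr_ge0.
have resle : res <= \sum_i `|u i - v i|.
  apply: ler_sum => i _; rewrite /mi; case: (leP (u i) (v i)) => h.
    by rewrite subrr.
  exact: ler_norm.
(* the common mass stays in place and the residual masses are coupled independently *)
pose c (k : I * I) := mi k.1 * (k.1 == k.2)%:R + (u k.1 - mi k.1) * (v k.2 - mi k.2) / res.
have c0 k : 0 <= c k.
  by rewrite /c addr_ge0// ?divr_ge0// mulr_ge0.
have sumdelta (w : I -> R) (i : I) : \sum_j w j * (i == j)%:R = w i.
  rewrite (bigD1 i)//= eqxx mulr1 big1 ?addr0// => j /negbTE ji.
  by rewrite eq_sym ji mulr0.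
(* True also for [res] = 0, where division returns 0: all residual masses then vanish. *)
have quot (w : I -> R) (i : I) : (forall i, 0 <= w i) -> \sum_i w i = res -> w i * res / res = w i.
  move=> w0 wr; have [r0|r0] := eqVneq res 0; last by rewrite mulfK.
  have : w i = 0.
    have := wr; rewrite r0 => /eqP; rewrite psumr_eq0// => /allP/(_ i).
    by rewrite mem_index_enum => /(_ isT)/eqP.
  by move=> ->; rewrite !mul0r.
have row i : \sum_j c (i, j) = u i.
  rewrite big_split/= -mulr_suml -!mulr_sumr -res'.
  have d1 : \sum_j (i == j)%:R = 1 :> R.
    by have := sumdelta (fun=> 1) i; under eq_bigr do rewrite mul1r.
  by rewrite d1 mulr1 (quot (fun i => u i - mi i))// addrC subrK.
have col j : \sum_i c (i, j) = v j.
  rewrite big_split/=; under eq_bigr do rewrite eq_sym; rewrite sumdelta.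
  by rewrite -!mulr_suml -/res [res * _]mulrC (quot (fun i => v i - mi i))// addrC subrK.
have c1 : \sum_k c k = 1.
  rewrite (eq_bigr (fun k => c (k.1, k.2))); last by move=> [].
  rewrite -(pair_bigA _ (fun i j => c (i, j)))/=.
  by under eq_bigr do rewrite row.
have [Q hQ] := @discrete_probability R _ M2 _ (i0, i0) c (fun k => (a k.1, a k.2)) c0 c1.
have := @sigL t tT x x mu nu Q (4 * B ^+ 2 * \sum_i `|u i - v i|)
  (P2d _ _ u0 muE) (P2d _ _ v0 nuE).
rewrite subrr normr0 add0r; apply.
- split => A mA; rewrite hQ; try exact: measurableX.
    rewrite muE//; congr EFin; rewrite (eq_bigr (fun k => c (k.1, k.2) * \1_A (a k.1))); last first.
      by move=> [i j] _; rewrite !indicE in_setX in_setT andbT.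
    rewrite -(pair_bigA _ (fun i j => c (i, j) * \1_A (a i)))/=.
    by apply: eq_bigr => i _; rewrite -mulr_suml row.
  rewrite nuE//; congr EFin; rewrite (eq_bigr (fun k => c (k.1, k.2) * \1_A (a k.2))); last first.
    by move=> [i j] _; rewrite !indicE in_setX in_setT.
  rewrite -(pair_bigA _ (fun i j => c (i, j) * \1_A (a j)))/= exchange_big/=.
  by apply: eq_bigr => i _; rewrite -mulr_suml col.
- by apply: mulr_ge0; [rewrite mulr_ge0 ?sqr_ge0|exact: sumr_ge0].
rewrite (@discrete_integral R _ M2 Q _ c _ (fun z => `|z.1 - z.2| ^+ 2) c0 hQ)//.
rewrite lee_fin; apply: (@le_trans _ _ (\sum_k (u k.1 - mi k.1) * (v k.2 - mi k.2) / res * (4 * B ^+ 2))).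
  apply: ler_sum => -[i j] _ /=; rewrite /c/=.
  have h : `|a i - a j| ^+ 2 <= 4 * B ^+ 2.
    have -> : 4 * B ^+ 2 = (2 * B) ^+ 2 by ring.
    have B0 : 0 <= B by apply: le_trans (aB i).
    rewrite lerXn2r ?nnegrE ?mulr_ge0//.
    by apply: (le_trans (ler_normB _ _)); have := aB i; have := aB j; lra.
  have [->|ij] := eqVneq i j.
    rewrite subrr normr0 expr0n/= mulr0; apply: mulr_ge0.
      by apply: divr_ge0 => //; exact: mulr_ge0.
    by apply: mulr_ge0 => //; exact: sqr_ge0.
  by rewrite mulr0 add0r ler_wpM2l// divr_ge0// mulr_ge0.
rewrite -mulr_suml mulrC; apply: ler_wpM2l.
  by apply: mulr_ge0 => //; exact: sqr_ge0.
apply: le_trans resle.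
rewrite -(pair_bigA _ (fun i j => (u i - mi i) * (v j - mi j) / res))/=.
under eq_bigr do rewrite -mulr_suml -mulr_sumr -res'.
rewrite -mulr_suml -mulr_suml -/res.
have [r0|r0] := eqVneq res 0; first by rewrite r0 !mul0r.
by rewrite mulfK.
Qed.

End SigmaLipschitz.

(** * Continuous functions of finitely many measurable variables *)

Section MeasurableContinuous.
Context {R : realType} d (E : measurableType d).

Let rd (k : nat) (x : R) : R := (Num.floor (2 ^+ k * x))%:~R / 2 ^+ k.

Let rd_cvg x : rd k x @[k --> \oo] --> x.
Proof.
apply: (@dist_cvg _ 1) => // k.
have e2 := @exp2_gt0 R k.
have := floor_itv (2 ^+ k * x) => /andP[h1 h2].
rewrite /rd distrC ger0_norm.
  rewrite ler_pdivlMr// mulrBl divfK ?gt_eqF//.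
  by rewrite intrD in h2; lra.
by rewrite subr_ge0 ler_pdivrMr// [leRHS]mulrC.
Qed.

(** Meant for coefficients evaluated at empirical measures, with sequential continuity in the atoms
    as the only input, so that no sigma-algebra on measures is needed. Rounding the variables down
    to multiples of 2^-k gives functions with countably many values, which converge pointwise. *)
Lemma measurable_seq_continuous n (X : nat -> E -> R) (g : (nat -> R) -> R) :
  (forall j, (j < n)%N -> measurable_fun setT (X j)) ->
  (forall (y : nat -> R) (u : nat -> nat -> R),
    (forall j, (j < n)%N -> u k j @[k --> \oo] --> y j) -> g (u k) @[k --> \oo] --> g y) ->
  measurable_fun setT (fun w => g (X ^~ w)).
Proof.
move=> mX gc.
pose code k w : n.-tuple int := [tuple Num.floor (2 ^+ k * X j w) | j < n].
pose dec k (c : n.-tuple int) (j : nat) : R := (nth 0 c j)%:~R / 2 ^+ k.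
apply: (@measurable_fun_cvg _ _ _ _ (fun k w => g (dec k (code k w)))); last first.
  move=> w _; apply: gc => j jn.
  have -> : (fun k => dec k (code k w) j) = (fun k => rd k (X j w)).
    apply/funext => k; rewrite /dec /rd /code.
    by rewrite -(tnth_nth 0 _ (Ordinal jn)) tnth_mktuple.
  exact: rd_cvg.
move=> k _ B mB; rewrite setTI.
have -> : (fun w => g (dec k (code k w))) @^-1` B =
    \bigcup_m [set w | if @unpickle (n.-tuple int) m is Some c then
       code k w = c /\ B (g (dec k c)) else False].
  apply/seteqP; split => w /=.
    by move=> h; exists (pickle (code k w)) => //=; rewrite pickleK.
  by move=> [m _ /=]; case: (unpickle m) => // c [->].
apply: bigcupT_measurable => m; case: (unpickle m) => [c|]; last exact: measurable0.
have [Bc|nB] := pselect (B (g (dec k c))); last first.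
  by rewrite (_ : [set w | _] = set0)//; apply/seteqP; split => w // -[].
rewrite (_ : [set w | _] = \bigcap_(j in `I_n) [set w | (nth 0 c j)%:~R <= 2 ^+ k * X j w < (nth 0 c j + 1)%:~R]).
  rewrite bigcap_mkord; apply: bigsetI_measurable => j _.
  have mj : measurable_fun setT (fun w => 2 ^+ k * X j w).
    by apply: measurable_funM => //; exact: mX.
  rewrite (_ : [set w | _] = (fun w => 2 ^+ k * X j w) @^-1` `[(nth 0 c j)%:~R, (nth 0 c j + 1)%:~R[ ).
    by rewrite -[X in measurable X]setTI; exact: mj.
  by apply/seteqP; split => w /=; rewrite in_itv.
have fl (w : E) (j : 'I_n) : tnth (code k w) j = Num.floor (2 ^+ k * X j w) by rewrite tnth_mktuple.
apply/seteqP; split => w /=.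
  move=> [wc _] j jn /=; rewrite -wc -(tnth_nth 0 _ (Ordinal jn)) fl/=.
  exact: floor_itv.
move=> h; split => //; apply: eq_from_tnth => j.
rewrite fl (tnth_nth 0); apply/eqP; rewrite eq_le; have /= := h j (ltn_ord j).
by move=> hj; rewrite (floor_def hj) lexx.
Qed.

End MeasurableContinuous.

(** * Laws of large numbers *)

Section Averages.
Context {R : realType} {disp : measure_display} {Omega : measurableType disp}.
Variable P : probability Omega R.
Local Notation E f := (\int[P]_w (f w)).

Lemma orthogonal_average n (u : nat -> Omega -> R) (C : R) : (0 < n)%N ->
  (forall j, (j < n)%N -> L2 P (u j)) ->
  (forall j k, (j < n)%N -> (k < n)%N -> j != k -> E (fun w => u j w * u k w) = 0) ->
  (forall j, (j < n)%N -> E (fun w => u j w ^+ 2) <= C) ->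
  L1 P (fun w => (\sum_(j < n) n%:R^-1 * u j w) ^+ 2) /\
  E (fun w => (\sum_(j < n) n%:R^-1 * u j w) ^+ 2) <= C / n%:R.
Proof.
move=> n0 lu ou Cu; have n0' : 0 < n%:R :> R by rewrite ltr0n.
have lS : L2 P (fun w => \sum_(j < n) n%:R^-1 * u j w).
  by apply: L2_sum => j _; apply: L2Z; exact: lu.
split; first by case: lS.
have e : (fun w => (\sum_(j < n) n%:R^-1 * u j w) ^+ 2) =
    (fun w => \sum_(j < n) \sum_(k < n) n%:R^-1 ^+ 2 * (u j w * u k w)).
  apply/funext => w; rewrite expr2 mulr_suml; apply: eq_bigr => j _.
  by rewrite mulr_sumr; apply: eq_bigr => k _; ring.
have ljk (j k : 'I_n) : L1 P (fun w => u j w * u k w) by apply: L1M_sqr; exact: lu.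
rewrite e E_sum; last by move=> j _; apply: L1_sum => k _; exact: L1Z.
apply: (@le_trans _ _ (\sum_(j < n) n%:R^-1 ^+ 2 * C)); last first.
  rewrite sumr_const card_ord -mulr_natr.
  by rewrite le_eqVlt; apply/orP; left; apply/eqP; field; rewrite gt_eqF.
apply: ler_sum => j _; rewrite E_sum; last by move=> k _; exact: L1Z.
rewrite (bigD1 j)//= big1 ?addr0; last first.
  move=> k kj; rewrite EZ// ou// ?mulr0//.
  by rewrite eq_sym.
rewrite EZ//; apply: ler_wpM2l; first exact: sqr_ge0.
exact: Cu.
Qed.

End Averages.

(** Cells of width [h] cover ]-A, A[ and are represented by their left ends, with an error below
    [h]. One further cell, [None], collects the rest and is represented by 0, with the error x^2. *)
Lemma quantizer_exists (R : realType) (h A : R) : 0 < h -> 0 < A ->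
  exists (I : finType) (cell : R -> I) (a : I -> R) (B : R),
  [/\ forall i, measurable (cell @^-1` [set i]), forall i, `|a i| <= B &
    forall x, (a (cell x) - x) ^+ 2 <= h ^+ 2 + x ^+ 2 * (A <= `|x|)%R%:R].
Proof.
move=> h0 A0; pose m := (Num.truncn (2 * A / h)).+1.
have hm : 2 * A / h < m%:R.
  by have /andP[] := truncn_itv (ltW (divr_gt0 (mulr_gt0 (ltr0n R 2) A0) h0)).
pose b (k : 'I_m) := k%:R * h - A.
pose p x (k : 'I_m) := (`|x| < A) && (b k <= x < b k + h).
have p_le x k k' : p x k -> p x k' -> (k <= k')%N.
  move=> /andP[_ /andP[k1 _]] /andP[_ /andP[_ k2]].
  rewrite -ltnS -(ltr_nat R) -(ltr_pM2r h0) -natr1.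
  by rewrite /b in k1 k2; lra.
have p_inj x k k' : p x k -> p x k' -> k = k'.
  by move=> pk pk'; apply/val_inj/eqP; rewrite eqn_leq (p_le x)//= (p_le x).
have mp k : measurable [set x | p x k].
  rewrite (_ : [set x | p x k] = `]-A, A[%classic `&` `[b k, b k + h[%classic).
    by apply: measurableI; exact: measurable_itv.
  apply/seteqP; split => x /=; rewrite /p !in_itv/= ltr_norml.
    by move=> /andP[-> ->].
  by move=> [-> ->].
pose cell x : option 'I_m := [pick k | p x k].
exists (option 'I_m), cell, (fun o => if o is Some k then b k else 0), (m%:R * h + A); split.
- move=> [k|].
    rewrite (_ : _ @^-1` _ = [set x | p x k])//; apply/seteqP; split => x /=; rewrite /cell.
      by case: pickP => // k' pk' [<-].
    by move=> pk; case: pickP => [k' /p_inj /(_ pk) ->//|/(_ k)]; rewrite pk.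
  rewrite (_ : _ @^-1` _ = ~` (\bigcup_(k in [set: 'I_m]) [set x | p x k])).
    by apply: measurableC; apply: fin_bigcup_measurable => //; exact: finite_finset.
  apply/seteqP; split => x /=; rewrite /cell.
    by case: pickP => // h' _ [k _] /=; rewrite h'.
  by move=> np; case: pickP => // k pk; exfalso; apply: np; exists k.
- case=> [k|]; last by rewrite normr0 addr_ge0 ?mulr_ge0// ltW.
  rewrite /b; apply: (le_trans (ler_normB _ _)).
  rewrite (gtr0_norm A0) lerD2r ger0_norm ?mulr_ge0// ?(ltW h0)//.
  by rewrite ler_wpM2r ?(ltW h0)// ler_nat ltnW.
move=> x; rewrite /cell; case: pickP => [k /andP[xA /andP[k1 k2]]|np].
  apply: (@le_trans _ _ (h ^+ 2)); last by rewrite lerDl mulr_ge0 ?sqr_ge0.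
  by nra.
have -> : A <= `|x|.
  rewrite leNgt; apply/negP => xA.
  have x0 : 0 <= (x + A) / h.
    by rewrite divr_ge0 ?(ltW h0)//; move: xA; rewrite ltr_norml; lra.
  have /andP[t1 t2] := truncn_itv x0.
  have tm : (Num.truncn ((x + A) / h) < m)%N.
    rewrite -(ltr_nat R); apply: (le_lt_trans t1); apply: lt_trans hm.
    by rewrite ltr_pM2r ?invr_gt0//; move: xA; rewrite ltr_norml; lra.
  have := np (Ordinal tm); rewrite /p xA /b/=.
  move: t1 t2; rewrite ler_pdivlMr// ltr_pdivrMr// -(natr1 (Num.truncn ((x + A) / h))) => t1 t2.
  by move=> /negP; apply; apply/andP; split; lra.
by rewrite sub0r sqrrN mulr1 lerDr sqr_ge0.
Qed.

Section LLN.
Context {R : realType} {disp : measure_display} {Omega : measurableType disp}.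
Variable P : probability Omega R.
Local Notation E f := (\int[P]_w (f w)).
Variables (T : R) (sigma : R -> R -> probR R -> R) (L : R).
Hypothesis L0 : 0 <= L.
Hypothesis sigL : sigma_lip T sigma L.
Variables (t : R) (n : nat) (X : nat -> Omega -> R) (mu : probR R).
Hypothesis tT : 0 <= t <= T.
Hypothesis n0 : (0 < n)%N.
Hypothesis Xlaw : forall j, is_law P (X j) mu.
Hypothesis X_L2 : forall j, L2 P (X j).
Hypothesis Xind : forall i j k (U : set (R * R)) (B : set R), k != i -> k != j ->
  measurable U -> measurable B ->
  P ((fun w => (X i w, X j w)) @^-1` U `&` X k @^-1` B) =
  (P ((fun w => (X i w, X j w)) @^-1` U) * P (X k @^-1` B))%E.

Let n0' : 0 < n%:R :> R. Proof. by rewrite ltr0n. Qed.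

Let mX j : measurable_fun setT (X j). Proof. by have [] := X_L2 j. Qed.

Let law0 j (B : set R) : measurable B -> P (X j @^-1` B) = P (X 0 @^-1` B).
Proof. by move=> mB; have [_ h] := Xlaw j; have [_ h0] := Xlaw 0; rewrite -h// h0. Qed.

Lemma same_expectation j (f : R -> R) : measurable_fun setT f ->
  L1 P (fun w => f (X 0 w)) ->
  L1 P (fun w => f (X j w)) /\ E (fun w => f (X j w)) = E (fun w => f (X 0 w)).
Proof.
move=> mf l; have [l' e] := eq_law_L1 (mX 0) (mX j) mf (fun B mB => esym (law0 j mB)) l.
by split => //; rewrite e.
Qed.

Section Quantized.
Variables (I : finType) (cell : R -> I) (a : I -> R) (B : R).
Hypothesis mcell : forall i, measurable (cell @^-1` [set i]).
Hypothesis aB : forall i, `|a i| <= B.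

Let q x := a (cell x).
Let ind i x : R := \1_(cell @^-1` [set i]) x.

Let indE i x : ind i x = (cell x == i)%:R.
Proof.
rewrite /ind indicE; congr (nat_of_bool _)%:R.
by apply/idP/eqP => [/set_mem|h]; [|apply/mem_set].
Qed.

Let mind i : measurable_fun setT (ind i). Proof. exact: measurable_indic. Qed.

Let sum_ind (f : I -> R) x : \sum_i f i * ind i x = f (cell x).
Proof.
rewrite (bigD1 (cell x))//= indE eqxx mulr1 big1 ?addr0// => i /negbTE ix.
by rewrite indE eq_sym ix mulr0.
Qed.

Let mcomp (f : I -> R) : measurable_fun setT (fun x => f (cell x)).
Proof.
rewrite (_ : (fun x => f (cell x)) = fun x => \sum_i f i * ind i x).
  by apply: measurable_sum => i; apply: measurable_funM.
by apply/funext => x; rewrite sum_ind.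
Qed.

Let v i := E (fun w => ind i (X 0 w)).

Let ind_L2 i j : L2 P (fun w => ind i (X j w)).
Proof.
apply: (@L2_bounded _ _ _ _ _ 1); first exact: measurableT_comp.
by move=> w; rewrite indE; case: eqP; rewrite ?normr1 ?normr0.
Qed.

Let ind_E i j : E (fun w => ind i (X j w)) = v i.
Proof. by have [_ ->] := same_expectation j (mind i) (L2_L1 (ind_L2 i 0)). Qed.

Let p i w := \sum_(j < n) n%:R^-1 * ind i (X j w).

(** The centered indicators are orthogonal and bounded by 1, so the variance of the frequency is at
    most 1/n. *)
Let freq i : L1 P (fun w => `|p i w - v i|) /\
  E (fun w => `|p i w - v i|) <= (Num.sqrt n%:R)^-1.
Proof.
pose u j w := ind i (X j w) - v i.
have lu j : L2 P (u j) by apply: L2B => //; exact: L2_cst.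
have s0 : 0 < Num.sqrt n%:R :> R by rewrite sqrtr_gt0.
have ss : Num.sqrt n%:R ^+ 2 = n%:R :> R by rewrite sqr_sqrtr// ltW.
have pE w : p i w - v i = \sum_(j < n) n%:R^-1 * u j w.
  rewrite /u /p; under [RHS]eq_bigr do rewrite mulrBr.
  rewrite sumrB; congr (_ - _).
  by rewrite sumr_const card_ord -(mulr_natr (_ * _)) mulrAC mulVf ?mul1r// gt_eqF.
have Cu j : (j < n)%N -> E (fun w => u j w ^+ 2) <= 1.
  move=> _; rewrite -[leRHS](E_cst P); apply: E_le => //.
  - by case: (lu j).
  - exact: L1_cst.
  move=> w; rewrite /u indE.
  have v01 : 0 <= v i <= 1.
    rewrite E_ge0/=; last by move=> x; rewrite indE.
    rewrite -[leRHS](E_cst P); apply: E_le => //.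
    - exact: L2_L1.
    - exact: L1_cst.
    by move=> x; rewrite indE; case: eqP.
  by case: eqP => _ /=; nra.
have ou j k : (j < n)%N -> (k < n)%N -> j != k -> E (fun w => u j w * u k w) = 0.
  move=> jn kn jk.
  have mf : measurable_fun setT (fun x => ind i x - v i) by apply: measurable_funB.
  have iu : forall A A' : set R, measurable A -> measurable A' ->
      P (u j @^-1` A `&` u k @^-1` A') = (P (u j @^-1` A) * P (u k @^-1` A'))%E.
    (* Pairwise independence is [Xind] with both indices of the pair equal to [j]. *)
    move=> A A' mA mA'; pose U := (fun z : R * R => ind i z.1 - v i) @^-1` A.
    have mU : measurable U.
      rewrite -[U]setTI; have : measurable_fun setT (fun z : R * R => ind i z.1 - v i).
        by apply: (measurableT_comp (f := fun x => ind i x - v i)).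
      by apply.
    have mV : measurable ((fun x => ind i x - v i) @^-1` A').
      by rewrite -[X in measurable X]setTI; exact: mf.
    by have := @Xind j j k U _ _ _ mU mV; apply; rewrite eq_sym.
  have [_ ->] := @indep_EM _ _ _ P (u j) (u k) (L2_L1 (lu j)) (L2_L1 (lu k)) iu.
  by rewrite EB ?ind_E ?E_cst ?subrr ?mul0r//; [exact: L2_L1|exact: L1_cst].
have [l e] := orthogonal_average n0 (fun j _ => lu j) ou Cu.
have lp : L1 P (fun w => (p i w - v i) ^+ 2).
  by under [X in L1 P X]funext do rewrite pE.
have lpa : L1 P (fun w => `|p i w - v i|).
  apply: L1_norm; apply: L1B; last exact: L1_cst.
  by apply: L1_sum => j _; apply: L1Z; exact: L2_L1.
split => //.
pose s := Num.sqrt n%:R : R.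
(* The arithmetic-geometric inequality in place of Cauchy-Schwarz; with s the root of n both terms
   contribute 1 / (2s). *)
apply: (@le_trans _ _ (E (fun w => s^-1 / 2 + s / 2 * (p i w - v i) ^+ 2))).
  apply: E_le => //.
    by apply: L1D; [exact: L1_cst|exact: L1Z].
  move=> w; rewrite -[(p i w - v i) ^+ 2]real_normK ?num_real//.
  set x := `|_|; rewrite -subr_ge0.
  have -> : s^-1 / 2 + s / 2 * x ^+ 2 - x = (s * x - 1) ^+ 2 / (2 * s).
    by field; rewrite gt_eqF.
  by rewrite divr_ge0 ?sqr_ge0// mulr_ge0// ltW.
rewrite ED; [|exact: L1_cst|exact: L1Z].
rewrite E_cst EZ//.
have e' : E (fun w => (p i w - v i) ^+ 2) <= 1 / n%:R.
  by apply: le_trans e; under eq_Rintegral do rewrite pE.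
rewrite -/s in ss s0 *.
have : s / 2 * E (fun w => (p i w - v i) ^+ 2) <= s / 2 * (1 / n%:R).
  by rewrite ler_wpM2l// divr_ge0// ltW.
have -> : s / 2 * (1 / n%:R) = s^-1 / 2.
  by rewrite -ss; field; rewrite gt_eqF.
lra.
Qed.

Let V := E (fun w => (q (X 0 w) - X 0 w) ^+ 2).

Let qX_L2 j : L2 P (fun w => q (X j w)).
Proof.
apply: (@L2_bounded _ _ _ _ _ B); first exact: measurableT_comp (mcomp a) (mX j).
by move=> w; exact: aB.
Qed.

(* Between [sigma t x (empirical n X)] and [sigma t x mu] insert the same two values at the quantized
   measures: the outer differences cost the quantization error, the middle one the fluctuation of
   the frequencies of finitely many cells. *)
Lemma quantized_bound : exists Z : Omega -> R, [/\ L1 P Z,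
  E Z <= 3 * L ^+ 2 * (2 * V + 4 * B ^+ 2 * (#|I|%:R / Num.sqrt n%:R)) &
  forall w x, (sigma t x (empirical n (X ^~ w)) - sigma t x mu) ^+ 2 <= Z w].
Proof.
pose S w := \sum_(j < n) n%:R^-1 * (q (X j w) - X j w) ^+ 2.
pose Fr w := \sum_i `|p i w - v i|.
have lq j : L1 P (fun w => (q (X j w) - X j w) ^+ 2).
  by have [] : L2 P (fun w => q (X j w) - X j w) by exact: L2B.
have eq j : E (fun w => (q (X j w) - X j w) ^+ 2) = V.
  have mf : measurable_fun setT (fun x => (q x - x) ^+ 2).
    by apply: measurable_funX; apply: measurable_funB => //; exact: mcomp.
  by have [_] := same_expectation j mf (lq 0).
have lS : L1 P S by apply: L1_sum => j _; exact: L1Z.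
have ES : E S = V.
  rewrite /S E_sum; last by move=> j _; exact: L1Z.
  under eq_bigr do rewrite EZ// eq.
  by rewrite sumr_const card_ord -(mulr_natr (_ * _)) mulrAC mulVf ?mul1r// gt_eqF.
have lF : L1 P Fr by apply: L1_sum => i _; case: (freq i).
have EF : E Fr <= #|I|%:R / Num.sqrt n%:R.
  rewrite /Fr E_sum; last by move=> i _; case: (freq i).
  apply: (@le_trans _ _ (\sum_(i : I) (Num.sqrt n%:R)^-1)).
    by apply: ler_sum => i _; case: (freq i).
  by rewrite sumr_const -(mulr_natl (Num.sqrt n%:R)^-1).
exists (fun w => 3 * L ^+ 2 * (S w + (4 * B ^+ 2 * Fr w + V))); split.
- by apply: L1Z; apply: L1D => //; apply: L1D; [exact: L1Z|exact: L1_cst].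
- have l1 : L1 P (fun w => 4 * B ^+ 2 * Fr w + V).
    by apply: L1D; [exact: L1Z|exact: L1_cst].
  rewrite EZ; last exact: L1D.
  rewrite ED// ES ED; [|exact: L1Z|exact: L1_cst].
  rewrite EZ// E_cst; apply: ler_wpM2l; first by rewrite mulr_ge0// sqr_ge0.
  have : 4 * B ^+ 2 * E Fr <= 4 * B ^+ 2 * (#|I|%:R / Num.sqrt n%:R).
    by apply: ler_wpM2l => //; rewrite mulr_ge0// sqr_ge0.
  lra.
move=> w x.
have mqX : measurable_fun setT (fun w => q (X 0 w)) by have [] := qX_L2 0.
pose nu : probR R := distribution P (@mfun_Sub _ _ Omega (measurableTypeR R) _ (mem_set mqX)).
have nulaw : is_law P (fun w => q (X 0 w)) nu by split.
have V0 : 0 <= V by exact: E_sqr_ge0.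
have S0 w' : 0 <= S w' by apply: sumr_ge0 => j _; rewrite mulr_ge0 ?sqr_ge0// invr_ge0 ltW.
have F0 w' : 0 <= Fr w' by exact: sumr_ge0.
have d1 : `|sigma t x (empirical n (fun j => q (X j w))) - sigma t x (empirical n (X ^~ w))|
    <= L * Num.sqrt (S w).
  have := sigma_empirical L0 sigL x x (fun j => q (X j w)) (X ^~ w) n0 tT.
  by rewrite subrr normr0 add0r.
have d3 : `|sigma t x nu - sigma t x mu| <= L * Num.sqrt V.
  have := sigma_law sigL x x nulaw (Xlaw 0) (qX_L2 0) (X_L2 0) tT.
  by rewrite subrr normr0 add0r.
have d2 : `|sigma t x (empirical n (fun j => q (X j w))) - sigma t x nu| <=
    L * Num.sqrt (4 * B ^+ 2 * Fr w).
  have := @sigma_finite_support _ _ _ _ sigL I (cell 0) (fun i => p i w) v a B t x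
    (empirical n (fun j => q (X j w))) nu tT; apply.
  - by move=> i; apply: sumr_ge0 => j _; rewrite mulr_ge0 ?indE// invr_ge0 ltW.
  - by move=> i; apply: E_ge0 => w'; rewrite indE.
  - exact: aB.
  - move=> A mA; rewrite empiricalE//; congr EFin; rewrite /p.
    under [RHS]eq_bigr do rewrite mulr_suml.
    rewrite exchange_big/=; apply: eq_bigr => j _.
    rewrite -(sum_ind (fun i => \1_A (a i)) (X j w)) mulr_sumr.
    by apply: eq_bigr => i _; rewrite /=; ring.
  - move=> A mA; have [_ ->//] := nulaw.
    have mAq : measurable ((fun w => q (X 0 w)) @^-1` A) by exact: measurable_preim.
    rewrite -(fineK (fin_num_measure P _ mAq)) -(E_indic P mAq); congr EFin.
    rewrite /v; under [RHS]eq_bigr do rewrite mulrC -EZ ?(L2_L1 (ind_L2 _ _))//.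
    rewrite -E_sum; last by move=> i _; apply: L1Z; exact: L2_L1.
    apply: eq_Rintegral => w' _.
    have := sum_ind (fun i => \1_A (a i)) (X 0 w').
    by rewrite indicE => ->; rewrite indicE.
have F4 : 0 <= 4 * B ^+ 2 * Fr w.
  by apply: mulr_ge0 => //; apply: mulr_ge0 => //; exact: sqr_ge0.
have q1 := sqr_sqrtr (S0 w); have q2 := sqr_sqrtr F4; have q3 := sqr_sqrtr V0.
have -> : S w + (4 * B ^+ 2 * Fr w + V) = Num.sqrt (S w) ^+ 2 +
    (Num.sqrt (4 * B ^+ 2 * Fr w) ^+ 2 + Num.sqrt V ^+ 2) by rewrite q1 q2 q3.
move: d1 d2 d3; set s1 := Num.sqrt _; set s2 := Num.sqrt _; set s3 := Num.sqrt _.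
set A1 := sigma _ _ _; set A2 := sigma t x (empirical n _); set A3 := sigma t x nu.
set A4 := sigma t x mu.
rewrite !ler_norml => /andP[a1 a2] /andP[b1 b2] /andP[c1 c2].
have : `|A2 - A4| <= L * s1 + L * s2 + L * s3.
  by rewrite ler_norml; apply/andP; split; lra.
move=> h; have h2 : `|A2 - A4| ^+ 2 <= (L * s1 + L * s2 + L * s3) ^+ 2.
  rewrite lerXn2r ?nnegrE//; exact: le_trans h.
rewrite -[(_ - _) ^+ 2]real_normK ?num_real//; apply: (le_trans h2).
have := sqr_ge0 (L * s1 - L * s2); have := sqr_ge0 (L * s1 - L * s3).
by have := sqr_ge0 (L * s2 - L * s3); lra.
Qed.

End Quantized.

End LLN.

Section SignedIntegrals.
Context {R : realType} {disp : measure_display} {Omega : measurableType disp}.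
Variable P : probability Omega R.

(** The signed case follows from the nonnegative one by writing g as (g + |g|) - |g|. *)
Lemma empirical_Rintegral n (y : nat -> R) (g : R -> R) : (0 < n)%N ->
  measurable_fun setT g ->
  \int[empirical n y]_x g x = \sum_(j < n) n%:R^-1 * g (y j).
Proof.
move=> n0 mg.
have nonneg (f : R -> R) : measurable_fun setT f -> (forall x, 0 <= f x) ->
    @L1 R _ (measurableTypeR R) (empirical n y) f /\
    \int[empirical n y]_x f x = \sum_(j < n) n%:R^-1 * f (y j).
  move=> mf f0; have e := empirical_integral y n0 mf f0; split; last by rewrite /Rintegral e.
  by apply: (@L1_lty _ _ (measurableTypeR R)) => //; rewrite e ltry.
have mabs : measurable_fun setT (fun x => `|g x|) by exact: measurableT_comp.
have [l1 e1] := nonneg _ mabs (fun x => normr_ge0 _).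
have mplus : measurable_fun setT (fun x => g x + `|g x|) by exact: measurable_funD.
have plus0 x : 0 <= g x + `|g x|.
  by have := ler_norm (- g x); rewrite normrN; lra.
have [l2 e2] := nonneg _ mplus plus0.
have := EB l2 l1; rewrite e1 e2 -sumrB.
under eq_Rintegral do rewrite addrK.
by move=> ->; apply: eq_bigr => j _; rewrite -mulrBr addrK.
Qed.

Lemma law_Rintegral (X : Omega -> R) (mu : probR R) (g : R -> R) :
  is_law P X mu -> measurable_fun setT g -> L1 P (fun w => g (X w)) ->
  \int[mu]_x g x = \int[P]_w g (X w).
Proof.
move=> [mX muX] mg lg; congr fine.
pose X' : {mfun Omega >-> measurableTypeR R} := @mfun_Sub _ _ Omega (measurableTypeR R) X (mem_set mX).
rewrite (eq_measure_integral (distribution P X')); last by move=> A mA _; exact: muX.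
apply: (@integral_distribution _ _ _ _ _ P X' (fun x => (g x)%:E)) => //.
exact/measurable_EFinP.
Qed.

Lemma E_le_ae (f g : Omega -> R) : L1 P f -> L1 P g ->
  {ae P, forall w, f w <= g w} -> \int[P]_w f w <= \int[P]_w g w.
Proof.
move=> lf lg fg; have mf := L1_meas lf; have mg := L1_meas lg.
have mm : measurable_fun setT (fun w => Num.max (f w) (g w)) by exact: measurable_maxr.
have h : {ae P, forall w, g w = Num.max (f w) (g w)}.
  by apply: filterS fg => w fg; rewrite max_r.
rewrite [leRHS](ae_E_eq mg mm h); apply: E_le => //; first exact: ae_L1 h.
by move=> w; rewrite le_max lexx.
Qed.

Lemma L1_le_ae (f g : Omega -> R) : measurable_fun setT f -> L1 P g ->
  {ae P, forall w, `|f w| <= g w} -> L1 P f.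
Proof.
move=> mf lg fg; have mg := L1_meas lg.
have ma : measurable_fun setT (fun w => `|f w|) by exact: measurableT_comp.
have lm : L1 P (fun w => Num.min `|f w| `|g w|).
  apply: (L1_le _ (L1_norm lg)) => [|w].
    by apply: measurable_minr => //; exact: measurableT_comp.
  by rewrite ger0_norm ?le_min ?normr_ge0// ge_min lexx orbT.
have la : L1 P (fun w => `|f w|).
  apply: (ae_L1 ma lm); apply: filterS fg => w h.
  by rewrite min_l// (le_trans h)// ler_norm.
exact: (L1_le mf la).
Qed.

End SignedIntegrals.

Section UniformLLN.
Context {R : realType} {disp : measure_display} {Omega : measurableType disp}.
Variable P : probability Omega R.
Local Notation E f := (\int[P]_w (f w)).

Lemma truncated_tail (S : Omega -> R) (e : R) : L1 P S -> (forall w, 0 <= S w) -> 0 < e ->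
  exists2 A : R, 1 <= A & L1 P (fun w => S w * (A <= S w)%R%:R) /\
    E (fun w => S w * (A <= S w)%R%:R) <= e.
Proof.
move=> lS S0 e0; pose f k w := S w * (k.+1%:R <= S w)%R%:R.
have mf k : measurable_fun setT (f k).
  apply: measurable_funM; first exact: (L1_meas lS).
  rewrite (_ : (fun _ => _) = \1_[set w | k.+1%:R <= S w]).
    by apply: measurable_indic; apply: meas_set_le => //; exact: L1_meas lS.
  apply/funext => w; rewrite indicE; congr (nat_of_bool _)%:R.
  by apply/idP/idP => [h|/set_mem//]; apply/mem_set.
have f0 : {ae P, forall w, f k w @[k --> \oo] --> (0 : R)}.
  apply/aeW => w; apply: cvg_near_cst; near=> k.
  have kS : S w < k.+1%:R.
    have /andP[_ h] := truncn_itv (S0 w); apply: (lt_le_trans h).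
    by rewrite ler_nat ltnS; near: k; exact: nbhs_infty_ge.
  by rewrite /f leNgt kS mulr0.
have trunc_le w (b : bool) : `|S w * b%:R| <= S w.
  by rewrite normrM (ger0_norm (S0 w)); case: b; rewrite /= ?normr1 ?normr0 ?mulr1 ?mulr0.
have fS : {ae P, forall w k, `|f k w| <= S w}.
  apply/aeW => w k; exact: trunc_le.
have m0 : measurable_fun setT (fun _ : Omega => 0 : R) by exact: measurable_cst.
have [_ ] := E_dominated mf m0 f0 lS fS.
rewrite E_cst => /cvgrPdist_le /(_ e e0) [k _ /(_ k (leqnn k))].
rewrite sub0r normrN => h; exists k.+1%:R; first by rewrite ler1n.
split; last exact: le_trans (ler_norm _) h.
apply: (L1_le (mf k) lS) => w; exact: trunc_le.
Unshelve. all: by end_near. Qed.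

Variables (T : R) (sigma : R -> R -> probR R -> R) (L : R).
Hypothesis L0 : 0 <= L.
Hypothesis sigL : sigma_lip T sigma L.

(** The cells are fixed before the time: the tail outside them is controlled for all times at once
    by the common bound [S] on the squares. The bound holds for all [x] simultaneously, so it may be
    used at a random [x] that depends on the sample. *)
Lemma uniform_lln (times : set R) (X : R -> nat -> Omega -> R) (mu : R -> probR R)
    (S : Omega -> R) :
  times `<=` `[0, T] ->
  (forall t j, times t -> is_law P (X t j) (mu t)) ->
  (forall t j, times t -> L2 P (X t j)) ->
  (forall t i j k (U : set (R * R)) (B : set R), times t -> k != i -> k != j ->
    measurable U -> measurable B ->
    P ((fun w => (X t i w, X t j w)) @^-1` U `&` X t k @^-1` B) =
    (P ((fun w => (X t i w, X t j w)) @^-1` U) * P (X t k @^-1` B))%E) ->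
  L1 P S -> (forall w, 0 <= S w) ->
  (forall t, times t -> {ae P, forall w, X t 0%N w ^+ 2 <= S w}) ->
  forall e : R, 0 < e -> exists N, forall n t, (N < n)%N -> times t ->
    exists Z : Omega -> R, [/\ L1 P Z, E Z <= e &
      forall w x, (sigma t x (empirical n (X t ^~ w)) - sigma t x (mu t)) ^+ 2 <= Z w].
Proof.
move=> tT Xlaw X2 Xind lS S0 XS e e0.
pose K := 3 * L ^+ 2 + 1.
have K0 : 0 < K by rewrite ltr_wpDl// mulr_ge0// sqr_ge0.
(* Mesh and tail contribute [d] each to the quantization error, which counts twice: 4Kd = 2e/3. The
   frequencies take the remaining e/3. *)
pose d := e / (6 * K); have d0 : 0 < d by rewrite divr_gt0// mulr_gt0.
(* A >= 1 is used to pass from A <= |X| to A <= X^2 <= S. *)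
have [A A1 [lA EA]] := truncated_tail lS S0 d0.
have A0 : 0 < A by apply: lt_le_trans A1.
have h0 : 0 < Num.sqrt d by rewrite sqrtr_gt0.
have [I [cell [a [B [mcell aB q]]]]] := quantizer_exists h0 A0.
rewrite sqr_sqrtr ?(ltW d0)// in q.
pose c := 4 * B ^+ 2 * #|I|%:R.
have c0 : 0 <= c by rewrite /c; apply: mulr_ge0 => //; apply: mulr_ge0 => //; exact: sqr_ge0.
(* Beyond this rank, c divided by the root of n is at most e / (3K). *)
exists (Num.truncn ((c / (e / (3 * K))) ^+ 2)) => n t Nn tt.
have tI : 0 <= t <= T by have := tT _ tt; rewrite /= in_itv.
have n0 : (0 < n)%N by apply: leq_ltn_trans Nn.
have [Z [lZ EZ' Zb]] := quantized_bound L0 sigL tI n0 (fun j => Xlaw t j tt)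
  (fun j => X2 t j tt) (fun i j k U B' h1 h2 => Xind t i j k U B' tt h1 h2) mcell aB.
exists Z; split => //; apply: (le_trans EZ').
pose V := E (fun w => (a (cell (X t 0%N w)) - X t 0%N w) ^+ 2).
rewrite -/V.
have V0 : 0 <= V by exact: E_sqr_ge0.
have mcell_comp : measurable_fun setT (fun x => a (cell x)).
  rewrite (_ : (fun x => _) = (fun x => \sum_i a i * \1_(cell @^-1` [set i]) x)).
    by apply: measurable_sum => i; apply: measurable_funM => //; exact: measurable_indic.
  apply/funext => x; rewrite (bigD1 (cell x))//= indicE mem_set// mulr1 big1 ?addr0// => i ix.
  by rewrite indicE memNset ?mulr0//= => xi; rewrite xi eqxx in ix.
have mX : measurable_fun setT (X t 0%N) by have [] := X2 t 0%N tt.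
have VB : V <= d + d.
  apply: (@le_trans _ _ (E (fun w => d + S w * (A <= S w)%R%:R))).
    apply: E_le_ae.
    - have [] : L2 P (fun w => a (cell (X t 0%N w)) - X t 0%N w) => //.
      apply: L2B; last exact: X2.
      apply: (@L2_bounded _ _ _ _ _ B) => //.
      exact: (measurableT_comp mcell_comp mX).
    - by apply: L1D => //; exact: L1_cst.
    apply: filterS (XS t tt) => w hS; apply: (le_trans (q _)); rewrite lerD2l.
    have [hA|_] := boolP (A <= `|X t 0%N w|); last by rewrite mulr0 mulr_ge0.
    have -> : A <= S w.
      apply: le_trans hS; rewrite -real_normK ?num_real//; apply: (le_trans hA).
      by rewrite expr2 ler_peMr// (le_trans A1).
    by rewrite !mulr1.
  by rewrite ED ?E_cst ?lerD2l//; exact: L1_cst.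
have s0 : 0 < Num.sqrt n%:R :> R by rewrite sqrtr_gt0 ltr0n.
have fr : c / Num.sqrt n%:R <= e / (3 * K).
  have g0 : 0 < e / (3 * K) by rewrite divr_gt0// mulr_gt0.
  rewrite ler_pdivrMr// mulrC -ler_pdivrMr//.
  have g1 : 0 <= c / (e / (3 * K)) by rewrite divr_ge0// ltW.
  rewrite -(ger0_norm g1) -sqrtr_sqr ler_wsqrtr//.
  have /andP[_ h] := truncn_itv (sqr_ge0 (c / (e / (3 * K)))).
  by apply: (le_trans (ltW h)); rewrite ler_nat.
apply: (@le_trans _ _ (K * (2 * (d + d) + e / (3 * K)))).
  apply: (@le_trans _ _ (K * (2 * V + 4 * B ^+ 2 * (#|I|%:R / Num.sqrt n%:R)))).
    rewrite ler_wpM2r ?/K ?lerDl// mulrA -/c.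
    by apply: addr_ge0; [exact: mulr_ge0|apply: divr_ge0 => //; exact: ltW].
  rewrite ler_wpM2l ?(ltW K0)//; apply: lerD; first by rewrite ler_wpM2l.
  by apply: le_trans fr; rewrite /c mulrA.
rewrite /d le_eqVlt; apply/orP; left; apply/eqP; field; rewrite gt_eqF//.
Qed.

End UniformLLN.

(** * The law of large numbers at rate 1/n for a kernel *)

Section KernelLLN.
Context {R : realType} {disp : measure_display} {Omega : measurableType disp}.
Variable P : probability Omega R.
Local Notation E f := (\int[P]_w (f w)).
Variables (k : R -> R -> R) (L : R).
Hypothesis L0 : 0 <= L.
Hypothesis kL : forall x y x' y', `|k x y - k x' y'| <= L * (`|x - x'| + `|y - y'|).
Variables (n : nat) (X : nat -> Omega -> R) (mu : probR R).
Hypothesis n0 : (0 < n)%N.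
Hypothesis Xlaw : forall j, is_law P (X j) mu.
Hypothesis X_L2 : forall j, L2 P (X j).
Hypothesis Xind : forall i j k (U : set (R * R)) (B : set R), k != i -> k != j ->
  measurable U -> measurable B ->
  P ((fun w => (X i w, X j w)) @^-1` U `&` X k @^-1` B) =
  (P ((fun w => (X i w, X j w)) @^-1` U) * P (X k @^-1` B))%E.

Let mX j : measurable_fun setT (X j). Proof. by have [] := X_L2 j. Qed.

Let G a := \int[mu]_b k a b.

Let lip_measurable dE (U : measurableType dE) (f : R -> R -> R) (C : R) (Y1 Y2 : U -> R) :
  (forall x y x' y', `|f x y - f x' y'| <= C * (`|x - x'| + `|y - y'|)) ->
  measurable_fun setT Y1 -> measurable_fun setT Y2 ->
  measurable_fun setT (fun w => f (Y1 w) (Y2 w)).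
Proof.
move=> fC m1 m2; pose Y (j : nat) := if j is 0%N then Y1 else Y2.
apply: (@measurable_seq_continuous _ _ _ 2 Y (fun y => f (y 0%N) (y 1%N))) => [[|j]//|y u uy].
have u0 := uy 0%N isT; have u1 := uy 1%N isT.
have h : C * (`|y 0%N - u m 0%N| + `|y 1%N - u m 1%N|) @[m --> \oo] --> 0.
  rewrite -(mulr0 C); apply: cvgM; first exact: cvg_cst.
  rewrite -[0](addr0 0); apply: cvgD.
    rewrite -[0](normr0 R) -(subrr (y 0%N)); apply: cvg_norm.
    by apply: cvgB => //; exact: cvg_cst.
  rewrite -[0](normr0 R) -(subrr (y 1%N)); apply: cvg_norm.
  by apply: cvgB => //; exact: cvg_cst.
apply/cvgrPdist_le => e e0; move/cvgrPdist_le : h => /(_ e e0).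
apply: filterS => m; rewrite sub0r normrN => hm; apply: (le_trans (fC _ _ _ _)).
exact: le_trans (ler_norm _) hm.
Qed.

Let absX_L2 j : L2 P (fun w => `|X j w|).
Proof. by apply: (L2_le _ (X_L2 j)) => [|w]; [exact: measurableT_comp|rewrite normr_id]. Qed.

Let kX_L1 a j : L1 P (fun w => k a (X j w)).
Proof.
apply: L2_L1; apply: (@L2_le _ _ _ _ _ (fun w => L * `|X j w| + `|k a 0|)).
- by apply: (lip_measurable kL) => //; exact: measurable_cst.
- by apply: L2D; [exact: L2Z|exact: L2_cst].
move=> w; rewrite (ger0_norm (addr_ge0 (mulr_ge0 L0 (normr_ge0 _)) (normr_ge0 _))).
have := kL a (X j w) a 0; rewrite subrr normr0 add0r subr0 => h.
by rewrite -lerBlDr; apply: le_trans h; exact: lerB_dist.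
Qed.

Let mka a : measurable_fun setT (k a).
Proof. by apply: (lip_measurable kL) => //; exact: measurable_cst. Qed.

Let GE a j : G a = E (fun w => k a (X j w)).
Proof. exact: (law_Rintegral (Xlaw j)). Qed.

Let E_abs_le (f g : Omega -> R) : L1 P f -> L1 P g -> (forall w, `|f w| <= g w) ->
  `|E f| <= E g.
Proof.
move=> lf lg fg; rewrite ler_norml; apply/andP; split.
  rewrite -mulN1r -EZ//; apply: E_le => //; first exact: L1Z.
  by move=> w; have := fg w; rewrite ler_norml; lra.
by apply: E_le => // w; apply: le_trans (fg w); exact: ler_norm.
Qed.

Let phi a b := k a b - G a.

Let phi_lip x y x' y' : `|phi x y - phi x' y'| <= 2 * L * (`|x - x'| + `|y - y'|).
Proof.
have h : `|G x - G x'| <= L * `|x - x'|.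
  rewrite (GE x 0%N) (GE x' 0%N) -EB// -[leRHS](E_cst P); apply: E_abs_le.
  - exact: L1B.
  - exact: L1_cst.
  by move=> w; apply: (le_trans (kL _ _ _ _)); rewrite subrr normr0 addr0.
have := kL x y x' y'; rewrite /phi; have := mulr_ge0 L0 (normr_ge0 (y - y')).
move: h; rewrite !ler_norml => /andP[h1 h2] h3 /andP[h4 h5].
by apply/andP; split; lra.
Qed.

Let m1 := E (fun w => `|X 0%N w|).
Let m1_0 : 0 <= m1. Proof. exact: E_ge0. Qed.

(** [phi a b] is the mean of [k a b - k a (X 0)], so the Lipschitz bound in the second variable
    suffices and the estimate does not involve [a]. *)
Let phi_le a b : `|phi a b| <= L * (`|b| + m1).
Proof.
rewrite /phi (GE a 0%N) -[X in X - _](E_cst P (k a b)) -EB//; last exact: L1_cst.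
apply: (@le_trans _ _ (E (fun w => L * `|b| + L * `|X 0%N w|))).
  apply: E_abs_le.
  - by apply: L1B => //; exact: L1_cst.
  - by apply: L1D; [exact: L1_cst|apply: L1Z; exact: L2_L1].
  move=> w; apply: (le_trans (kL _ _ _ _)); rewrite subrr normr0 add0r -mulrDr.
  by rewrite ler_wpM2l// ler_normB.
by rewrite ED ?E_cst ?EZ ?mulrDr//; [exact: L2_L1|exact: L1_cst|apply: L1Z; exact: L2_L1].
Qed.

Let phiX_L2 i j : L2 P (fun w => phi (X i w) (X j w)).
Proof.
apply: (@L2_le _ _ _ _ _ (fun w => L * (`|X j w| + m1))).
- exact: (lip_measurable phi_lip).
- by apply: L2Z; apply: L2D => //; exact: L2_cst.
move=> w; rewrite (ger0_norm (mulr_ge0 L0 (addr_ge0 (normr_ge0 _) m1_0))).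
exact: phi_le.
Qed.

(** By [phi_le] the square is at most 2L^2 (X_j^2 + m1^2), and m1^2 is at most the second moment
    because a variance is nonnegative. *)
Let phiX_E2 i j : E (fun w => phi (X i w) (X j w) ^+ 2) <= 4 * L ^+ 2 * E (fun w => X 0%N w ^+ 2).
Proof.
pose s := E (fun w => X 0%N w ^+ 2).
have lsq l : L1 P (fun w => X l w ^+ 2) by have [] := X_L2 l.
have m1s : m1 ^+ 2 <= s.
  have v : 0 <= E (fun w => (`|X 0%N w| - m1) ^+ 2) by exact: E_sqr_ge0.
  have lax : L1 P (fun w => `|X 0%N w|) by exact: L2_L1.
  have : E (fun w => (`|X 0%N w| - m1) ^+ 2) =
      E (fun w => X 0%N w ^+ 2 + (- (2 * m1)) * `|X 0%N w| + m1 ^+ 2).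
    apply: eq_Rintegral => w _; rewrite -[X 0%N w ^+ 2]real_normK ?num_real//; ring.
  rewrite ED ?E_cst; [|by apply: L1D => //; exact: L1Z|exact: L1_cst].
  rewrite ED ?EZ//; last exact: L1Z.
  rewrite -/m1 -/s; nra.
have sE : E (fun w => X j w ^+ 2) = s.
  have m2 : measurable_fun setT (fun x : R => x ^+ 2) by exact: measurable_funX.
  by have [_] := same_expectation Xlaw X_L2 j m2 (lsq 0%N).
apply: (@le_trans _ _ (E (fun w => 2 * L ^+ 2 * X j w ^+ 2 + 2 * L ^+ 2 * m1 ^+ 2))).
  apply: E_le; first by have [] := phiX_L2 i j.
    by apply: L1D; [exact: L1Z|exact: L1_cst].
  move=> w; rewrite -[phi _ _ ^+ 2]real_normK ?num_real//.
  apply: (@le_trans _ _ ((L * (`|X j w| + m1)) ^+ 2)).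
    rewrite lerXn2r ?nnegrE ?phi_le// mulr_ge0 ?addr_ge0//.
  rewrite -[X j w ^+ 2]real_normK ?num_real//.
  by have := sqr_ge0 (L * (`|X j w| - m1)); nra.
rewrite ED ?E_cst; [|by apply: L1Z|exact: L1_cst].
rewrite EZ// sE -/s; have := sqr_ge0 L; nra.
Qed.

(* Given [X i] and [X j], the factor [phi (X i) (X l)] is centered. *)
Let phi_orth i j l : l != i -> l != j ->
  E (fun w => phi (X i w) (X j w) * phi (X i w) (X l w)) = 0.
Proof.
move=> li lj.
have mij : measurable_fun setT (fun w => (X i w, X j w)).
  by apply/measurable_fun_pairP; split; exact: mX.
pose Xij : {mfun Omega >-> (R * R)%type} := mfun_Sub (mem_set mij).
pose Xl : {mfun Omega >-> R} := mfun_Sub (mem_set (mX l)).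
pose f (z : (R * R) * R) := phi z.1.1 z.1.2 * phi z.1.1 z.2.
have m11 : measurable_fun setT (fun z : (R * R) * R => z.1.1).
  exact: (measurableT_comp measurable_fst measurable_fst).
have m12 : measurable_fun setT (fun z : (R * R) * R => z.1.2).
  exact: (measurableT_comp measurable_snd measurable_fst).
have mf : measurable_fun setT f.
  by apply: measurable_funM; apply: (lip_measurable phi_lip).
have lf : L1 P (fun w => f (Xij w, Xl w)) by exact: (L1M_sqr (phiX_L2 i j) (phiX_L2 i l)).
have iXl : forall A B, measurable A -> measurable B ->
    P (Xij @^-1` A `&` Xl @^-1` B) = (P (Xij @^-1` A) * P (Xl @^-1` B))%E.
  by move=> A B mA mB; exact: Xind.
have := indep_L1 iXl mf lf.
rewrite [RHS](_ : _ = 0%:E)%E; first by move=> [].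
apply: integral0_eq => -[a b] _ /=.
have lc : L1 P (fun w => phi a b * phi a (X l w)).
  by apply: L1Z; apply: L1B => //; exact: L1_cst.
have mc : measurable_fun setT (fun c : R => phi a b * phi a c).
  by apply: measurable_funM => //; apply: measurable_funB => //; exact: mka.
have := @integral_distribution _ _ _ _ _ P Xl (fun c => (phi a b * phi a c)%:E).
rewrite /comp/= => ->//; last exact/measurable_EFinP.
rewrite -EFin_E// EZ; last by apply: L1B => //; exact: L1_cst.
by rewrite EB ?E_cst -?GE ?subrr ?mulr0//; exact: L1_cst.
Qed.

Lemma kernel_lln i :
  L1 P (fun w => (\int[empirical n (X ^~ w)]_b k (X i w) b - \int[mu]_b k (X i w) b) ^+ 2) /\
  E (fun w => (\int[empirical n (X ^~ w)]_b k (X i w) b - \int[mu]_b k (X i w) b) ^+ 2)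
    <= 4 * L ^+ 2 * E (fun w => X 0%N w ^+ 2) / n%:R.
Proof.
have e w : \int[empirical n (X ^~ w)]_b k (X i w) b - \int[mu]_b k (X i w) b =
    \sum_(j < n) n%:R^-1 * phi (X i w) (X j w).
  rewrite empirical_Rintegral//; under [RHS]eq_bigr do rewrite mulrBr.
  rewrite sumrB sumr_const card_ord -(mulr_natr (_ * _)) mulrAC mulVf ?mul1r//.
  by rewrite pnatr_eq0 -lt0n.
under [X in L1 P X]funext do rewrite e.
under eq_Rintegral do rewrite e.
apply: (@orthogonal_average _ _ _ P n (fun j w => phi (X i w) (X j w)) _ n0) => //.
  (* The diagonal index i belongs to the average, but of two distinct indices at least one differs
     from i, and its factor is the centered one. *)
  move=> j l jn ln jl; have [li|li] := eqVneq l i; last by rewrite phi_orth// eq_sym.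
  under eq_Rintegral do rewrite mulrC.
  by rewrite phi_orth// -li.
Qed.

End KernelLLN.

(** * Continuity and adaptedness of the coefficients *)

Section Sequences.
Context {R : realType}.

Lemma cvg_close (F G b : nat -> R) (l : R) :
  (\forall m \near \oo, `|F m - G m| <= b m) -> b m @[m --> \oo] --> 0 ->
  G m @[m --> \oo] --> l -> F m @[m --> \oo] --> l.
Proof.
move=> FG b0 Gl; have h : F m - G m @[m --> \oo] --> 0.
  apply/cvgrPdist_le => e e0; move/cvgrPdist_le : b0 => /(_ e e0).
  apply: filterS2 FG => m h1; rewrite !sub0r !normrN => h2.
  by apply: (le_trans h1); apply: le_trans h2; exact: ler_norm.
rewrite (_ : F = fun m => (F m - G m) + G m); last by apply/funext => m; rewrite subrK.
by rewrite -[l]add0r; apply: cvgD.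
Qed.

Lemma cvg_sqr_dist (u : nat -> R) (l : R) : u m @[m --> \oo] --> l ->
  (u m - l) ^+ 2 @[m --> \oo] --> 0.
Proof.
move=> ul; have h : u m - l @[m --> \oo] --> 0.
  by rewrite -(subrr l); apply: cvgB => //; exact: cvg_cst.
by rewrite -[0](mulr0 0); under eq_fun do rewrite expr2; exact: cvgM.
Qed.

Lemma cvg_dist0 (u : nat -> R) (l : R) : u m @[m --> \oo] --> l ->
  `|u m - l| @[m --> \oo] --> 0.
Proof.
move=> ul; rewrite -[0](normr0 R) -(subrr l); apply: cvg_norm.
by apply: cvgB => //; exact: cvg_cst.
Qed.

Lemma cvg_lip_modulus (L : R) (u v : nat -> R) :
  u m @[m --> \oo] --> 0 -> v m @[m --> \oo] --> 0 ->
  L * (u m + Num.sqrt (v m)) @[m --> \oo] --> 0.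
Proof.
move=> u0 v0; rewrite -(mulr0 L); apply: cvgM; first exact: cvg_cst.
rewrite -[0](addr0 0); apply: cvgD => //.
rewrite -[X in _ --> X]sqrtr0.
by apply: continuous_cvg => //; exact: sqrt_continuous.
Qed.

End Sequences.

Section CoefficientContinuity.
Context {R : realType}.
Variables (T : R) (sigma : R -> R -> probR R -> R) (L : R).
Hypothesis L0 : 0 <= L.
Hypothesis sigL : sigma_lip T sigma L.
Hypothesis sigma_caglad : caglad_coef T sigma.

Let in_near (s : R) (u : nat -> R) : 0 < s <= T -> (forall m, u m < s) -> u m @[m --> \oo] --> s ->
  \forall m \near \oo, 0 <= u m <= T.
Proof.
move=> /andP[s0 sT] us ucvg; move/cvgrPdist_lt : ucvg => /(_ s s0).
apply: filterS => m; have := us m; rewrite ltr_norml => h1 /andP[_ h2].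
by apply/andP; split; lra.
Qed.

Let avg_cvg0 n (Y : nat -> R) (Y_ : nat -> nat -> R) :
  (forall j, (j < n)%N -> Y_ m j @[m --> \oo] --> Y j) ->
  \sum_(j < n) n%:R^-1 * (Y_ m j - Y j) ^+ 2 @[m --> \oo] --> (0 : R).
Proof.
move=> hY; have z : \sum_(j < n) (0 : R) = 0 by rewrite big1.
rewrite -[X in _ --> X]z.
apply: cvg_fin_sum => j; rewrite -(mulr0 n%:R^-1); apply: cvgM; first exact: cvg_cst.
exact/cvg_sqr_dist/hY.
Qed.

Lemma sigma_empirical_cvg n t (a : R) (Y : nat -> R) (a_ : nat -> R) (Y_ : nat -> nat -> R) :
  (0 < n)%N -> 0 <= t <= T -> a_ m @[m --> \oo] --> a ->
  (forall j, (j < n)%N -> Y_ m j @[m --> \oo] --> Y j) ->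
  sigma t (a_ m) (empirical n (Y_ m)) @[m --> \oo] --> sigma t a (empirical n Y).
Proof.
move=> n0 tT ha hY; apply: (cvg_close (G := fun=> sigma t a (empirical n Y))).
- by apply: nearW => m; exact: (sigma_empirical L0 sigL (a_ m) a (Y_ m) Y n0 tT).
- apply: cvg_lip_modulus; first exact: cvg_dist0.
  exact: avg_cvg0.
- exact: cvg_cst.
Qed.

(** The Lipschitz bound, uniform in time, allows the space arguments to be frozen at their limits;
    left continuity in time is then used at one fixed measure. *)
Lemma sigma_empirical_left n (s : R) (u : nat -> R) (a : R) (Y : nat -> R)
    (a_ : nat -> R) (Y_ : nat -> nat -> R) :
  (0 < n)%N -> 0 < s <= T -> (forall m, u m < s) -> u m @[m --> \oo] --> s ->
  a_ m @[m --> \oo] --> a -> (forall j, (j < n)%N -> Y_ m j @[m --> \oo] --> Y j) ->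
  sigma (u m) (a_ m) (empirical n (Y_ m)) @[m --> \oo] --> sigma s a (empirical n Y).
Proof.
move=> n0 sT us ucvg ha hY.
apply: (cvg_close (G := fun m => sigma (u m) a (empirical n Y))).
- apply: filterS (in_near sT us ucvg) => m uT.
  exact: (sigma_empirical L0 sigL (a_ m) a (Y_ m) Y n0 uT).
- apply: cvg_lip_modulus; first exact: cvg_dist0.
  exact: avg_cvg0.
- have [h _] := sigma_caglad a (empirical_P2 Y n0).
  exact: (at_left_seq (f := fun t => sigma t a (empirical n Y)) (h s sT) us ucvg).
Qed.

(** Compared with the value at 0 and at atoms all equal to 0, a function of time alone, which is
    bounded because it has one-sided limits. *)
Lemma sigma_empirical_bounded n (M : R) : (0 < n)%N -> exists M', forall s a Y, 0 <= s <= T ->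
  `|a| <= M -> (forall j, (j < n)%N -> `|Y j| <= M) -> `|sigma s a (empirical n Y)| <= M'.
Proof.
move=> n0.
have [B hB] := caglad_bounded (sigma_caglad 0 (empirical_P2 (fun=> 0) n0)).
exists (B + L * (M + Num.sqrt (M ^+ 2))) => s a Y sT aM YM.
have := sigma_empirical L0 sigL a 0 Y (fun=> 0) n0 sT.
rewrite subr0 => h.
have := lerB_dist (sigma s a (empirical n Y)) (sigma s 0 (empirical n (fun=> 0))).
move=> h'.
have : L * (`|a| + Num.sqrt (\sum_(j < n) n%:R^-1 * (Y j - 0) ^+ 2)) <= L * (M + Num.sqrt (M ^+ 2)).
  rewrite ler_wpM2l// lerD// ler_wsqrtr//.
  apply: (@le_trans _ _ (\sum_(j < n) n%:R^-1 * M ^+ 2)).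
    apply: ler_sum => j _; rewrite ler_wpM2l// ?invr_ge0// subr0.
    by rewrite -[leLHS]real_normK ?num_real// lerXn2r ?nnegrE ?YM// (le_trans _ aM).
  rewrite sumr_const card_ord -(mulr_natr (_ * _)) mulrAC mulVf ?mul1r//.
  by rewrite pnatr_eq0 -lt0n.
by move=> h2; have := hB s sT; lra.
Qed.

Context {disp : measure_display} {Omega : measurableType disp}.
Variable P : probability Omega R.

(** The laws at two times are coupled by the process itself; the cost tends to 0 by dominated
    convergence, the squared difference being at most 4S. *)
Lemma sigma_law_left (X : R -> Omega -> R) (mu : R -> probR R) (S : Omega -> R)
    (s : R) (u : nat -> R) (a : R) (a_ : nat -> R) :
  (forall t, 0 <= t <= T -> is_law P (X t) (mu t)) -> L1 P S ->
  {ae P, forall w t, 0 <= t <= T -> X t w ^+ 2 <= S w} ->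
  (forall t, 0 <= t <= T -> L2 P (X t)) ->
  {ae P, forall w, X t w @[t --> s^'-] --> X s w} ->
  0 < s <= T -> (forall m, u m < s) -> u m @[m --> \oo] --> s ->
  a_ m @[m --> \oo] --> a ->
  sigma (u m) (a_ m) (mu (u m)) @[m --> \oo] --> sigma s a (mu s).
Proof.
move=> Xmu lS XS X2 Xleft sT us ucvg ha.
have sT' : 0 <= s <= T by case/andP: sT => s0 ->; rewrite ltW.
(* [u m] lies in [0, T] only eventually, whereas the dominated convergence needs every term. *)
pose v m := if (0 <= u m <= T) then u m else s.
have vT m : 0 <= v m <= T by rewrite /v; case: ifP.
have vu : \forall m \near \oo, v m = u m.
  by apply: filterS (in_near sT us ucvg) => m uT; rewrite /v uT.
apply: (cvg_close (G := fun m => sigma (u m) a (mu s))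
  (b := fun m => L * (`|a_ m - a| + Num.sqrt (\int[P]_w ((X (v m) w - X s w) ^+ 2))))).
- apply: filterS2 (in_near sT us ucvg) vu => m uT ->.
  exact: (sigma_law sigL (a_ m) a (Xmu _ uT) (Xmu _ sT') (X2 _ uT) (X2 _ sT') uT).
- apply: cvg_lip_modulus; first exact: cvg_dist0.
  rewrite -(E_cst P 0).
  have m0 : measurable_fun setT (fun _ : Omega => 0 : R) by exact: measurable_cst.
  have mX t : 0 <= t <= T -> measurable_fun setT (X t) by move=> /X2[].
  have [|||||_] := @E_dominated _ _ _ P (fun m w => (X (v m) w - X s w) ^+ 2) (fun=> 0) (fun w => 4 * S w) => //.
  + by move=> m; apply: measurable_funX; apply: measurable_funB; exact: mX.
  + apply: filterS Xleft => w h.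
    have hu := at_left_seq h us ucvg.
    have : (X (u m) w - X s w) ^+ 2 @[m --> \oo] --> 0 by exact: cvg_sqr_dist.
    by apply: cvg_trans; apply: near_eq_cvg; apply: filterS vu => m ->.
  + exact: L1Z.
  apply: filterS XS => w h m; have := h _ (vT m); have := h _ sT'.
  rewrite ger0_norm ?sqr_ge0//.
  by have := sqr_ge0 (X (v m) w + X s w); nra.
- have [h _] := sigma_caglad a (law_P2 (Xmu s sT') (X2 s sT')).
  exact: (at_left_seq (f := fun t => sigma t a (mu s)) (h s sT) us ucvg).
Qed.

Lemma sigma_law_bounded (X : R -> Omega -> R) (mu : R -> probR R) (S : Omega -> R) (M : R) :
  (forall t, 0 <= t <= T -> is_law P (X t) (mu t)) -> L1 P S ->
  (forall t, 0 <= t <= T -> {ae P, forall w, X t w ^+ 2 <= S w}) ->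
  (forall t, 0 <= t <= T -> L2 P (X t)) ->
  exists M', forall s a, 0 <= s <= T -> `|a| <= M -> `|sigma s a (mu s)| <= M'.
Proof.
move=> Xmu lS XS X2.
pose Z : Omega -> R := fun=> 0.
have mZ : measurable_fun setT Z by exact: measurable_cst.
pose nu : probR R := distribution P (@mfun_Sub _ _ Omega (measurableTypeR R) _ (mem_set mZ)).
have nulaw : is_law P Z nu by split.
have Z2 : L2 P Z by exact: L2_cst.
have [B hB] := caglad_bounded (sigma_caglad 0 (law_P2 nulaw Z2)).
exists (B + L * (M + Num.sqrt (\int[P]_w S w))) => s a sT aM.
have := sigma_law sigL a 0 (Xmu s sT) nulaw (X2 s sT) Z2 sT.
rewrite subr0 => h.
have h' := lerB_dist (sigma s a (mu s)) (sigma s 0 nu).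
have : L * (`|a| + Num.sqrt (\int[P]_w (X s w - Z w) ^+ 2)) <=
    L * (M + Num.sqrt (\int[P]_w S w)).
  rewrite ler_wpM2l// lerD// ler_wsqrtr//.
  under eq_Rintegral do rewrite subr0.
  by apply: E_le_ae => //; [have [] := X2 s sT|exact: XS].
by move=> h2; have := hB s sT; lra.
Qed.

End CoefficientContinuity.

Section Adapted.
Context {R : realType} {disp : measure_display} {Omega : measurableType disp}.
Variable P : probability Omega R.
Variables (D : nat -> @driver R disp Omega) (J : set nat).
Implicit Types X Y : Omega -> R.

Lemma history_ae t X Y : {ae P, forall w, X w = Y w} ->
  meas_wrt (history P D J t) X -> meas_wrt (history P D J t) Y.
Proof.
move=> XY hX B mB.
pose N := [set w | X w <> Y w].
have negN A : A `<=` N -> history P D J t A.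
  move=> AN; apply: sub_sigma_algebra; right.
  by apply: (negligibleS AN); apply: XY.
rewrite (_ : _ @^-1` _ = (X @^-1` B `\` N) `|` (Y @^-1` B `&` N)).
  pose HT : measurableType _ := g_sigma_algebraType
    (preimages (\bigcup_(j in J) observed (D j) t) `|` P.-negligible).
  apply: (@measurableU _ HT); first apply: (@measurableD _ HT).
  - exact: hX.
  - exact: negN.
  - by apply: negN => w [].
apply/seteqP; split => w /=.
  move=> YB; have [e|ne] := pselect (X w = Y w); last by right.
  by left; split; [rewrite e|move=> /(_ e)].
by move=> [[XB /contrapT e]|[]//]; rewrite -e.
Qed.

(** The upper limit is measurable without any convergence; it agrees with [X] almost surely, and the
    histories contain the negligible sets. *)
Lemma history_lim t (X_ : nat -> Omega -> R) X :
  (forall m, meas_wrt (history P D J t) (X_ m)) ->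
  {ae P, forall w, X_ m w @[m --> \oo] --> X w} ->
  meas_wrt (history P D J t) X.
Proof.
move=> mX cX; pose Y w := fine (limn_esup (fun m => (X_ m w)%:E)).
apply: (@history_ae _ Y).
  apply: filterS cX => w c; rewrite /Y.
  have h : (X_ m w)%:E @[m --> \oo] --> (X w)%:E by apply: cvg_EFin => //; exact: nearW.
  by have [_ ->] := cvg_limn_einf_sup h.
apply/meas_wrtP; rewrite /Y.
apply: (@measurableT_comp _ _ _ _ _ _ fine) => //.
apply: measurable_fun_limn_esup => m; apply/measurable_EFinP.
by have /meas_wrtP := mX m.
Qed.

Variable T : R.
Hypothesis T0 : 0 < T.

Lemma lpart_adapted (X : R -> Omega -> R) t : 0 <= t <= T ->
  {ae P, forall w, cadlag T (X ^~ w)} ->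
  (forall s, 0 <= s <= T -> meas_wrt (history P D J s) (X s)) ->
  meas_wrt (history P D J t) (fun w => lpart (X ^~ w) t).
Proof.
move=> /[dup] tT /andP[t0 tT'] cX mX; have [->|t00] := eqVneq t 0.
  rewrite (_ : (fun w => _) = X 0); last by apply/funext => w; rewrite lpart0.
  by apply: mX; rewrite lexx ltW.
have tT2 : 0 < t <= T by rewrite lt_neqAle eq_sym t00 t0.
have [k [kp /(_ _)kt kc]] := dy_left_seq T0 tT2.
have kl m : dy T m (k m) < t by have /andP[] := kt m.
apply: (@history_lim _ (fun m => X (dy T m (k m)))).
  move=> m B mB.
  apply: (@history_mono _ _ _ P D J J _ _ (@subset_refl _ J) (ltW (kl m))).
  by apply: mX => //; apply: dy_in => //; exact: ltnW.
apply: filterS cX => w c.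
exact: (at_left_seq (lpart_cvg c tT2) kl kc).
Qed.

End Adapted.

Section Coefficients.
Context {R : realType} {disp : measure_display} {Omega : measurableType disp}.
Variable P : probability Omega R.
Hypothesis cP : measure_is_complete P.
Variables (T : R) (d : nat) (D0 : @driver R disp Omega).
Variable D : nat -> @driver R disp Omega.
Hypothesis T0 : 0 < T.
Hypothesis D0_driver : is_driver P T d D0.
Hypothesis D_copies : independent_copies P T D0 D.
Variable r : R -> R.
Hypothesis r_gt0 : forall a : R, 0 < r a.
Hypothesis r_cont : continuous r.

(** A sum instead of a maximum: by positivity of [r] it bounds [r] on the state space, which is all
    that is needed. *)
Definition rmax : R := \sum_(k < d) r k.+1%:R.

Lemma rmax_ge0 : 0 <= rmax.
Proof. by apply: sumr_ge0 => k _; exact: ltW. Qed.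

Let chain_cadlag i : {ae P, forall w, cadlag T (chain (D i) ^~ w)}.
Proof. by have [/(_ i)[_ _ + _] _] := D_copies; apply: filterS => w []. Qed.

Let states_closed : closed (@state_space R d).
Proof.
rewrite (_ : state_space d = \bigcup_(k in `I_d) [set x | x = k.+1%:R]).
  by apply: closed_bigcup => // k _; exact: closed_eq.
apply/seteqP; split => x /=; first by move=> [k kd <-]; exists k.
by move=> [k kd ->]; exists k.
Qed.

(** A copy of the chain shares only its law, so it may leave the state space on a null set. Its
    values are controlled at dyadic times by the law, then at all times and for left limits because
    the finite state space is closed. *)
Lemma chain_bound i : {ae P, forall w t, 0 <= t <= T -> `|r (lpart (chain (D i) ^~ w) t)| <= rmax}.
Proof.
have mS : measurable (@state_space R d) by exact: closed_measurable.
have atS t : 0 <= t <= T -> {ae P, forall w, state_space d (chain (D i) t w)}.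
  move=> tT; exists (~` (chain (D i) t @^-1` @state_space R d)); split => //.
    by apply: measurableC; apply: measurable_preim mS; exact: (chain_meas D_copies).
  apply: etrans (chain_law D_copies i tT (measurableC mS)) _.
  rewrite (_ : _ @^-1` _ = set0) ?measure0//; apply/seteqP; split => w //=.
  by have [_ _ [_ h _ _] _] := D0_driver; apply; exact: h.
have dyS : {ae P, forall w p k, (k <= 2 ^ p)%N -> state_space d (chain (D i) (dy T p k) w)}.
  apply: ae_foralln => p; apply: ae_foralln => k; have [kp|kp] := leqP k (2 ^ p).
    by apply: filterS (atS _ (dy_in T0 kp)) => w h _.
  by apply: aeW => w.
apply: filterS2 dyS (chain_cadlag i) => w hS c t tT.
have allS s : 0 <= s <= T -> state_space d (chain (D i) s w).
  move=> /andP[s0]; rewrite le_eqVlt => /orP[/eqP->|sT].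
    by rewrite -(dy_full T 0); exact: hS.
  have [k [kp kl kc]] := dy_right_seq T0 (introT andP (conj s0 sT)).
  have hc := at_right_seq (c.1 s (introT andP (conj s0 sT))) kl kc.
  by apply: (closed_cvg (@state_space R d) _ _ _ hc) => //; apply: nearW => p; exact: hS.
have /= [k kd <-] : state_space d (lpart (chain (D i) ^~ w) t).
  apply: (lpart_closed c tT states_closed) => s /andP[s0 st]; apply: allS.
  by rewrite s0 (le_trans st)//; case/andP: tT.
rewrite gtr0_norm// /rmax (bigD1 (Ordinal kd))//= lerDl.
by apply: sumr_ge0 => l _; exact: ltW.
Qed.

Lemma chain_coef_adapted J i t : J i -> 0 <= t <= T ->
  meas_wrt (history P D J t) (fun w => r (lpart (chain (D i) ^~ w) t)).
Proof.
move=> Ji tT.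
have h : meas_wrt (history P D J t) (fun w => lpart (chain (D i) ^~ w) t).
  apply: (lpart_adapted T0 tT (chain_cadlag i)) => s /andP[s0 sT] B mB.
  apply: sub_sigma_algebra; left; exists (chain (D i) s); last by exists B.
  by exists i => //; right; exists s => //=; rewrite in_itv/= s0 lexx.
move=> B mB; apply: (h (r @^-1` B)).
by apply: measurable_preim mB; exact: continuous_measurable_fun.
Qed.

Lemma chain_coef_left i : {ae P, forall w s, 0 < s <= T ->
  r (lpart (chain (D i) ^~ w) u) @[u --> s^'-] --> r (lpart (chain (D i) ^~ w) s)}.
Proof.
apply: filterS (chain_cadlag i) => w c s sT.
by apply: continuous_cvg; [exact: r_cont|exact: lpart_left_cont c sT].
Qed.

Variables (sigma : R -> R -> probR R -> R) (L : R).
Hypothesis L0 : 0 <= L.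
Hypothesis sigL : sigma_lip T sigma L.
Hypothesis sigma_caglad : caglad_coef T sigma.

Section Particles.
Variables (n : nat) (y : nat -> R -> Omega -> R).
Hypothesis n0 : (0 < n)%N.
Hypothesis y_cadlag : {ae P, forall w j, (j < n)%N -> cadlag T (y j ^~ w)}.

Lemma sigma_empirical_adapted J i t : (i < n)%N -> 0 <= t <= T ->
  (forall j s, (j < n)%N -> 0 <= s <= T -> meas_wrt (history P D J s) (y j s)) ->
  meas_wrt (history P D J t) (fun w => sigma t (lpart (y i ^~ w) t)
    (empirical n (fun j => lpart (y j ^~ w) t))).
Proof.
move=> i_n tT my.
have hl j : (j < n)%N -> meas_wrt (history P D J t) (fun w => lpart (y j ^~ w) t).
  move=> jn; apply: (lpart_adapted T0 tT); last by move=> s sT; exact: my.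
  by apply: filterS y_cadlag => w; exact.
apply/meas_wrtP.
(* Coordinate 0 is the particle [i] in the space variable, coordinate j+1 is the atom [j]. *)
pose X (j : nat) w := lpart (y (if j is j'.+1 then j' else i) ^~ w) t.
pose HT : measurableType _ := g_sigma_algebraType
  (preimages (\bigcup_(j in J) observed (D j) t) `|` P.-negligible).
apply: (@measurable_seq_continuous R _ HT n.+1 X
  (fun z => sigma t (z 0%N) (empirical n (fun j => z j.+1)))).
  move=> j jn; apply/meas_wrtP; apply: hl.
  by case: j jn.
move=> z u zu.
exact: (sigma_empirical_cvg L0 sigL n0 tT (zu 0%N isT) (fun j jn => zu j.+1 jn)).
Qed.

Lemma sigma_empirical_path_left i : (i < n)%N -> {ae P, forall w s, 0 < s <= T ->
  sigma u (lpart (y i ^~ w) u) (empirical n (fun j => lpart (y j ^~ w) u)) @[u --> s^'-] -->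
  sigma s (lpart (y i ^~ w) s) (empirical n (fun j => lpart (y j ^~ w) s))}.
Proof.
move=> i_n; apply: filterS y_cadlag => w c s sT.
apply/cvg_at_leftP => u [us uc].
apply: (sigma_empirical_left L0 sigL sigma_caglad n0 sT us uc).
  exact: (at_left_seq (lpart_left_cont (c i i_n) sT) us uc).
by move=> j jn; exact: (at_left_seq (lpart_left_cont (c j jn) sT) us uc).
Qed.

Lemma sigma_empirical_path_bounded i : (i < n)%N ->
  {ae P, forall w, exists M : R, forall s, 0 <= s <= T ->
  `|sigma s (lpart (y i ^~ w) s) (empirical n (fun j => lpart (y j ^~ w) s))| <= M}.
Proof.
move=> i_n; apply: filterS y_cadlag => w c.
have [M hM] : exists M : R, forall j, (j < n)%N -> forall s, 0 <= s <= T -> `|lpart (y j ^~ w) s| <= M.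
  elim: (n) c => [|m ih] c; first by exists 0.
  have [|M hM] := ih; first by move=> j jm; apply: c; exact: ltnW.
  have [M' hM'] := cadlag_bounded (c m (leqnn _)).
  exists (Num.max M M') => j; rewrite ltnS leq_eqVlt => /orP[/eqP->|jm] s sT.
    by rewrite le_max (lpart_bound (c m (leqnn _)) sT hM') orbT.
  by rewrite le_max hM.
have [M' hM'] := sigma_empirical_bounded L0 sigL sigma_caglad M n0.
by exists M' => s sT; apply: hM' => // [|j jn]; exact: hM.
Qed.

End Particles.

Section LimitProcess.
Variables (x : R -> Omega -> R) (mu : R -> probR R) (S : Omega -> R).
Hypothesis x_cadlag : {ae P, forall w, cadlag T (x ^~ w)}.
Hypothesis x_law : forall t, 0 <= t <= T -> is_law P (fun w => lpart (x ^~ w) t) (mu t).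
Hypothesis lS : L1 P S.
Hypothesis xS : {ae P, forall w t, 0 <= t <= T -> lpart (x ^~ w) t ^+ 2 <= S w}.

Lemma lpart_L2 t : 0 <= t <= T -> L2 P (fun w => lpart (x ^~ w) t).
Proof.
move=> tT; have [mx _] := x_law tT; split => //.
apply: (L1_le_ae _ lS); first exact: measurable_funX.
by apply: filterS xS => w h; rewrite ger0_norm ?sqr_ge0// h.
Qed.

Lemma sigma_law_adapted J t : 0 <= t <= T ->
  (forall s, 0 <= s <= T -> meas_wrt (history P D J s) (x s)) ->
  meas_wrt (history P D J t) (fun w => sigma t (lpart (x ^~ w) t) (mu t)).
Proof.
move=> tT mx; have hl := lpart_adapted T0 tT x_cadlag mx.
apply/meas_wrtP.
pose HT : measurableType _ := g_sigma_algebraType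
  (preimages (\bigcup_(j in J) observed (D j) t) `|` P.-negligible).
apply: (@measurable_seq_continuous R _ HT 1 (fun _ w => lpart (x ^~ w) t)
  (fun z => sigma t (z 0%N) (mu t))) => [j _|z u zu]; first exact/meas_wrtP.
apply: (cvg_close (G := fun=> sigma t (z 0%N) (mu t))
  (b := fun m => L * (`|u m 0%N - z 0%N| + Num.sqrt 0))).
- apply: nearW => m.
  have := sigma_law sigL (u m 0%N) (z 0%N) (x_law tT) (x_law tT) (lpart_L2 tT) (lpart_L2 tT) tT.
  by under eq_Rintegral do rewrite subrr expr0n; rewrite E_cst.
- by apply: cvg_lip_modulus; [apply: cvg_dist0; exact: zu|exact: cvg_cst].
- exact: cvg_cst.
Qed.

Lemma sigma_law_path_left : {ae P, forall w s, 0 < s <= T ->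
  sigma u (lpart (x ^~ w) u) (mu u) @[u --> s^'-] --> sigma s (lpart (x ^~ w) s) (mu s)}.
Proof.
apply: filterS x_cadlag => w c s sT.
apply/cvg_at_leftP => u [us uc].
apply: (sigma_law_left sigL sigma_caglad x_law lS xS lpart_L2) => //.
  by apply: filterS x_cadlag => w' c'; exact: lpart_left_cont c' sT.
exact: (at_left_seq (lpart_left_cont c sT) us uc).
Qed.

Lemma sigma_law_path_bounded : {ae P, forall w, exists M : R, forall s, 0 <= s <= T ->
  `|sigma s (lpart (x ^~ w) s) (mu s)| <= M}.
Proof.
apply: filterS x_cadlag => w c; have [M hM] := cadlag_bounded c.
have xS' t : 0 <= t <= T -> {ae P, forall w, lpart (x ^~ w) t ^+ 2 <= S w}.
  by move=> tT; apply: filterS xS => w'; exact.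
have [M' hM'] := sigma_law_bounded L0 sigL sigma_caglad M x_law lS xS' lpart_L2.
by exists M' => s sT; apply: hM' => //; exact: lpart_bound c sT hM.
Qed.

End LimitProcess.

End Coefficients.

(** * The Gronwall estimate *)

Lemma subn_add_split a b c : (a + b <= c)%N -> (c - a = b + (c - (a + b)))%N.
Proof. lia. Qed.

Lemma expn_split a b : (a <= b)%N -> (2 ^ b = 2 ^ a * 2 ^ (b - a))%N.
Proof. by move=> ab; rewrite -expnD subnKC. Qed.

Lemma affine_half {R : realType} (a b c : R) :
  (a + 4 * b * c) / 2 + 2 * b * c = a / 2 + 4 * b * c.
Proof. lra. Qed.

Lemma half_le {R : realType} (a b : R) : a <= b -> 0 <= a -> a / 2 <= b.
Proof. lra. Qed.

Lemma measurable_bigmax {R : realType} d (U : measurableType d) m (f : nat -> U -> R) :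
  (forall l, (l < m)%N -> measurable_fun setT (f l)) ->
  measurable_fun setT (fun w => \big[Num.max/0]_(l < m) f l w).
Proof.
elim: m f => [|m ih] f mf.
  by under [X in measurable_fun _ X]funext do rewrite big_ord0; exact: measurable_cst.
under [X in measurable_fun _ X]funext do rewrite big_ord_recl.
by apply: measurable_maxr; [exact: mf|apply: (ih (fun l => f l.+1)) => l lm; exact: mf].
Qed.

Section Gronwall.
Context {R : realType} {disp : measure_display} {Omega : measurableType disp}.
Variable P : probability Omega R.
Local Notation E f := (\int[P]_w (f w)).
Hypothesis cP : measure_is_complete P.
Variables (T : R) (d : nat) (D0 : @driver R disp Omega).
Variable D : nat -> @driver R disp Omega.
Hypothesis T0 : 0 < T.
Hypothesis D0_driver : is_driver P T d D0.
Hypothesis D0_sqint : square_integrable P T (lev D0).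
Hypothesis D_copies : independent_copies P T D0 D.

Let kmax := K0 P T D0.
Let kmax0 : 0 <= kmax. Proof. exact: K0_ge0. Qed.

(** A left Riemann sum of an increasing exponential is below its integral; each step of the
    induction is 1 + x <= exp x. *)
Lemma expR_riemann (a : R) p j : 0 < a ->
  \sum_(k < j) expR (a * (k%:R / 2 ^+ p)) / 2 ^+ p <= expR (a * (j%:R / 2 ^+ p)) / a.
Proof.
move=> a0; have e2 := @exp2_gt0 R p.
suff h : a * \sum_(k < j) expR (a * (k%:R / 2 ^+ p)) / 2 ^+ p <= expR (a * (j%:R / 2 ^+ p)) - 1.
  by rewrite ler_pdivlMr// mulrC; apply: (le_trans h); lra.
elim: j => [|j ih]; first by rewrite big_ord0 mulr0 mul0r mulr0 expR0 subrr.
rewrite big_ord_recr/= mulrDr.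
have -> : a * (j.+1%:R / 2 ^+ p) = a * (j%:R / 2 ^+ p) + a / 2 ^+ p.
  by rewrite -natr1; field; rewrite gt_eqF.
rewrite expRD; set u := expR (_ * (_ / _)) in ih *.
have u0 : 0 < u by exact: expR_gt0.
have := expR_ge1Dx (a / 2 ^+ p); set v := expR (a / _) => hv.
have -> : a * (u / 2 ^+ p) = u * (a / 2 ^+ p) by ring.
by have := ler_wpM2l (ltW u0) hv; lra.
Qed.

Variables (n : nat) (y x : nat -> R -> Omega -> R) (Hy Hx : nat -> R -> Omega -> R).
Hypothesis n0 : (0 < n)%N.
Let J : set nat := `I_n.
Let e j t w : R := y j t w - x j t w.
Hypothesis y_cadlag : forall j, (j < n)%N -> {ae P, forall w, cadlag T (y j ^~ w)}.
Hypothesis x_cadlag : forall j, (j < n)%N -> {ae P, forall w, cadlag T (x j ^~ w)}.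
Hypothesis y_F : forall j t, (j < n)%N -> 0 <= t <= T -> meas_wrt (history P D J t) (y j t).
Hypothesis x_F : forall j t, (j < n)%N -> 0 <= t <= T -> meas_wrt (history P D J t) (x j t).
Hypothesis Hy_F : forall j t, (j < n)%N -> 0 <= t <= T -> meas_wrt (history P D J t) (Hy j t).
Hypothesis Hx_F : forall j t, (j < n)%N -> 0 <= t <= T -> meas_wrt (history P D J t) (Hx j t).
Hypothesis Hy_bounded : forall j, (j < n)%N ->
  {ae P, forall w, exists M : R, forall s, 0 <= s <= T -> `|Hy j s w| <= M}.
Hypothesis Hx_bounded : forall j, (j < n)%N ->
  {ae P, forall w, exists M : R, forall s, 0 <= s <= T -> `|Hx j s w| <= M}.
Hypothesis Hy_left : forall j, (j < n)%N ->
  {ae P, forall w s, 0 < s <= T -> Hy j u w @[u --> s^'-] --> Hy j s w}.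
Hypothesis Hx_left : forall j, (j < n)%N ->
  {ae P, forall w s, 0 < s <= T -> Hx j u w @[u --> s^'-] --> Hx j s w}.
Hypothesis y_ito : forall j, (j < n)%N ->
  ito_integral P T (history P D J) (lev (D j)) (Hy j) (fun t w => y j t w - ini (D j) w).
Hypothesis x_ito : forall j, (j < n)%N ->
  ito_integral P T (history P D J) (lev (D j)) (Hx j) (fun t w => x j t w - ini (D j) w).
Variables (C eps : R).
Hypothesis C0 : 0 <= C.
Hypothesis eps0 : 0 <= eps.
Hypothesis cmp : forall i p k, (i < n)%N -> (k < 2 ^ p)%N ->
  exists Z : Omega -> R, [/\ L1 P Z, forall w, 0 <= Z w, E Z <= eps &
    {ae P, forall w, (Hy i (dy T p k) w - Hx i (dy T p k) w) ^+ 2 <=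
      C * (lpart (e i ^~ w) (dy T p k) ^+ 2 +
           \sum_(j < n) n%:R^-1 * lpart (e j ^~ w) (dy T p k) ^+ 2) + Z w}].

Let dy_dy q j m l : dy (dy T q j) m l = dy T (q + m) (j * l).
Proof.
rewrite /dy natrM exprD; field.
by rewrite !gt_eqF// exp2_gt0.
Qed.

Let dyt_in t m l : 0 <= t <= T -> (l <= 2 ^ m)%N -> 0 <= dy t m l <= t.
Proof.
move=> /andP[t0 _] lm; have e2 := @exp2_gt0 R m.
have h : 0 <= (l%:R / 2 ^+ m : R) <= 1.
  by rewrite divr_ge0 ?ler0n ?(ltW e2)//= ler_pdivrMr// mul1r -natrX ler_nat.
by case/andP: h => h1 h2; rewrite /dy mulr_ge0//= ler_piMr.
Qed.

Let inT s t : 0 <= t <= T -> 0 <= s <= t -> 0 <= s <= T.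
Proof. by move=> /andP[_ tT] /andP[-> st]; exact: le_trans tT. Qed.

Let e_cadlag : {ae P, forall w j, (j < n)%N -> cadlag T (e j ^~ w)}.
Proof.
apply: ae_foralln => j; have [jn|jn] := ltnP j n; last by apply: aeW.
apply: filterS2 (y_cadlag jn) (x_cadlag jn) => w [y1 y2] [x1 x2] _; split => t tT.
  by apply: cvgB; [exact: y1|exact: x1].
by apply: is_cvgB; [exact: y2|exact: x2].
Qed.

Let e_F j t : (j < n)%N -> 0 <= t <= T -> meas_wrt (history P D J t) (e j t).
Proof.
move=> jn tT; apply/meas_wrtP; apply: measurable_funB.
  by have /meas_wrtP := y_F jn tT.
by have /meas_wrtP := x_F jn tT.
Qed.

Let e_meas j t : (j < n)%N -> 0 <= t <= T -> measurable_fun setT (e j t).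
Proof. by move=> jn /[dup] tT /andP[_ tT']; exact: (history_meas cP D_copies tT' (e_F jn tT)). Qed.

Section Localized.
Variable N : R.
Hypothesis N0 : 0 <= N.

(* All errors stay below [N] up to time [t]; only countably many times are used, so that the event
   is in the history at [t]. *)
Definition tame t := [set w | forall j m l, (j < n)%N -> (l <= 2 ^ m)%N -> e j (dy t m l) w ^+ 2 <= N].

Local Notation A := tame.

Let A_bound t w : 0 <= t <= T -> (forall j, (j < n)%N -> cadlag T (e j ^~ w)) -> A t w ->
  forall j s, (j < n)%N -> 0 <= s <= t -> e j s w ^+ 2 <= N.
Proof.
move=> /andP[t0 tT] c At j s jn st.
move: t0; rewrite le_eqVlt => /orP[/eqP t00|t0].
  have -> : s = dy t 0 0 by rewrite dy0; move: st; rewrite -t00 -eq_le => /eqP.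
  exact: At.
have h : (supsq t (e j ^~ w) <= N%:E)%E.
  apply: (supsq_le t0) => [u /andP[u0 ut]|p k kp].
    by apply: (c j jn).1; rewrite u0 (lt_le_trans ut).
  by rewrite lee_fin real_normK ?num_real//; exact: At.
have := le_trans (supsq_ge (e j ^~ w) st) h.
by rewrite lee_fin real_normK ?num_real.
Qed.

Let A_mono s t w : 0 <= t <= T -> (forall j, (j < n)%N -> cadlag T (e j ^~ w)) ->
  0 <= s <= t -> A t w -> A s w.
Proof.
move=> tT c st At j m l jn lm; apply: (A_bound tT c At jn).
have sT := inT tT st; have /andP[-> h] := dyt_in sT lm.
by rewrite (le_trans h)//; case/andP: st.
Qed.

Let A_F t : 0 <= t <= T -> history P D J t (A t).
Proof.
move=> tT.
pose HT : measurableType _ := g_sigma_algebraType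
  (preimages (\bigcup_(j in J) observed (D j) t) `|` P.-negligible).
rewrite (_ : A t = \bigcap_j \bigcap_m \bigcap_l
    [set w | (j < n)%N -> (l <= 2 ^ m)%N -> e j (dy t m l) w ^+ 2 <= N]); last first.
  apply/seteqP; split => w /=; first by move=> h j _ m _ l _; exact: h.
  by move=> h j m l; exact: h.
apply: (@bigcapT_measurable _ HT) => j; apply: (@bigcapT_measurable _ HT) => m.
apply: (@bigcapT_measurable _ HT) => l.
have [jn|jn] := ltnP j n; last by rewrite [X in measurable X](_ : _ = setT)//; exact/seteqP.
have [lm|lm] := leqP l (2 ^ m); last by rewrite [X in measurable X](_ : _ = setT)//; exact/seteqP.
rewrite [X in measurable X](_ : _ = e j (dy t m l) @^-1` [set u | u ^+ 2 <= N]); last first.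
  by apply/seteqP; split => w /=; [exact|move=> + _ _].
have sT := dyt_in tT lm; have /andP[_ st] := sT.
apply: (@history_mono _ _ _ P D J J _ _ (@subset_refl _ J) st).
apply: e_F => //; first exact: inT sT.
by apply: meas_set_le; [exact: measurable_funX|exact: measurable_cst].
Qed.

Let A_meas t : 0 <= t <= T -> measurable (A t).
Proof. by move=> /[dup] tT /andP[_ tT']; apply: (history_measurable cP D_copies tT'); exact: A_F. Qed.

(** Makes 4 * kmax * C / lam at most 1/2 in [pbound_running]; the added 1 keeps it positive when
    [kmax * C] vanishes. *)
Let lam : R := 8 * kmax * C + 1.
Let lam0 : 0 < lam.
Proof. by rewrite /lam ltr_wpDl// !mulr_ge0. Qed.

(* The weight [expR (lam * .)] is chosen so that the Gronwall iteration [pbound_half] contracts [B]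
   by a factor 2. *)
Definition pbound (B : R) := forall i q j m l, (i < n)%N -> (j <= 2 ^ q)%N -> (l <= 2 ^ m)%N ->
  E (fun w => \1_(A (dy T q j)) w * e i (dy (dy T q j) m l) w ^+ 2) <=
  B * expR (lam * (j%:R / 2 ^+ q)).

Let Ae_meas t j s : (j < n)%N -> 0 <= t <= T -> 0 <= s <= T ->
  measurable_fun setT (fun w => \1_(A t) w * e j s w ^+ 2).
Proof.
move=> jn tT sT; apply: measurable_funM; first by apply: measurable_indic; exact: A_meas.
by apply: measurable_funX; exact: e_meas.
Qed.

Let Ae_le t j m l w : (j < n)%N -> (l <= 2 ^ m)%N -> `|\1_(A t) w * e j (dy t m l) w ^+ 2| <= N.
Proof.
move=> jn lm; rewrite indicE; have [/set_mem h|_] := boolP (w \in A t).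
  by rewrite mul1r ger0_norm ?sqr_ge0//; exact: h.
by rewrite mul0r normr0.
Qed.

(** The coefficients involve left limits, while [pbound] speaks of values at dyadic times: dyadic
    times of [0, t] increasing to t, and domination by N on the tame event. *)
Let left_bound B i p k : pbound B -> (i < n)%N -> (k < 2 ^ p)%N ->
  L1 P (fun w => \1_(A (dy T p k)) w * lpart (e i ^~ w) (dy T p k) ^+ 2) /\
  E (fun w => \1_(A (dy T p k)) w * lpart (e i ^~ w) (dy T p k) ^+ 2) <=
  B * expR (lam * (k%:R / 2 ^+ p)).
Proof.
move=> hB i_n kp; have kp' := ltnW kp; set t := dy T p k.
have tT : 0 <= t <= T by exact: dy_in.
have [k0|k0] := posnP k.
  have tE : t = 0 by rewrite /t k0 dy0.
  have h w : \1_(A t) w * lpart (e i ^~ w) t ^+ 2 = \1_(A t) w * e i (dy t 0 0) w ^+ 2.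
    by rewrite dy0 tE lpart0.
  split; last by under eq_Rintegral do rewrite h; exact: hB.
  under [X in L1 P X]funext do rewrite h.
  apply: (L1_le _ (L1_cst P N)) => [|w]; last exact: Ae_le.
  have d0 : 0 <= dy t 0 0 <= T by rewrite dy0 lexx ltW.
  exact: Ae_meas.
have t0 : 0 < t by rewrite -(dy0 T p) dy_lt.
have [c [cp ct cc]] := dy_left_seq t0 (introT andP (conj t0 (lexx t))).
have cl m : dy t m (c m) < t by have /andP[] := ct m.
have ei_cadlag : {ae P, forall w, cadlag T (e i ^~ w)} by apply: filterS e_cadlag => w; exact.
have ml : measurable_fun setT (fun w => lpart (e i ^~ w) t).
  apply: (history_meas cP D_copies (dy_leT T0 kp')).
  exact: (lpart_adapted T0 tT ei_cadlag (fun s sT => e_F i_n sT)).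
have st m : 0 <= dy t m (c m) <= T by exact: (inT tT (dyt_in tT (ltnW (cp m)))).
have mA : measurable_fun setT (\1_(A t) : Omega -> R) by apply: measurable_indic; exact: A_meas.
have h1 m : measurable_fun setT (fun w => \1_(A t) w * e i (dy t m (c m)) w ^+ 2).
  exact: Ae_meas.
have h2 : measurable_fun setT (fun w => \1_(A t) w * lpart (e i ^~ w) t ^+ 2).
  by apply: measurable_funM => //; exact: measurable_funX.
have h3 : {ae P, forall w, \1_(A t) w * e i (dy t m (c m)) w ^+ 2 @[m --> \oo] -->
    (\1_(A t) w * lpart (e i ^~ w) t ^+ 2 : R)}.
  apply: filterS ei_cadlag => w ew.
  have tT' : 0 < t <= T by rewrite t0; case/andP: tT.
  have h := at_left_seq (lpart_cvg ew tT') cl cc.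
  apply: cvgM; first exact: cvg_cst.
  by under eq_fun do rewrite expr2; rewrite expr2; exact: cvgM.
have h4 : {ae P, forall w m, `|\1_(A t) w * e i (dy t m (c m)) w ^+ 2| <= N}.
  by apply: aeW => w m; apply: Ae_le => //; exact: ltnW.
have [h5 h6] := E_dominated h1 h2 h3 (L1_cst P N) h4.
split=> //; apply: (closed_cvg (fun z : R => z <= B * expR (lam * (k%:R / 2 ^+ p))) _ _ _ h6).
  exact: closed_le.
by apply: nearW => m; apply: hB => //; exact: ltnW.
Qed.

Let incrs (H : R -> Omega -> R) i p j w := \sum_(k < j) H (dy T p k) w * incr T D i p k w.

Let G i p k w : R := Hy i (dy T p k) w - Hx i (dy T p k) w.

(** The integrand stopped at time [dy T q j] and multiplied by the tame event of its own time: this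
    keeps it adapted and square integrable, and on the final tame event all these indicators equal
    1. *)
Let h i q j p k : Omega -> R :=
  if (k < j * 2 ^ (p - q))%N then (fun w => \1_(A (dy T p k)) w * G i p k w) else (fun=> 0).

Let h_F i q j p k : (i < n)%N -> (k < 2 ^ p)%N -> meas_wrt (history P D J (dy T p k)) (h i q j p k).
Proof.
move=> i_n kp; have tT := dy_in T0 (ltnW kp).
pose HT : measurableType _ := g_sigma_algebraType
  (preimages (\bigcup_(j in J) observed (D j) (dy T p k)) `|` P.-negligible).
apply/meas_wrtP; rewrite /h; case: ifP => _; last exact: measurable_cst.
apply: measurable_funM; last apply: measurable_funB.
- by apply: (@measurable_indic _ HT R); exact: A_F.
- by have /meas_wrtP := Hy_F i_n tT.
- by have /meas_wrtP := Hx_F i_n tT.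
Qed.

(** The factor 2 counts the error of the particle itself and the average of all errors, each
    controlled by [left_bound]. *)
Let h_bound B i q j p k : pbound B -> (i < n)%N -> (k < 2 ^ p)%N ->
  L2 P (h i q j p k) /\
  E (fun w => h i q j p k w ^+ 2) <=
  2 * C * B * ((k < j * 2 ^ (p - q))%N%:R * expR (lam * (k%:R / 2 ^+ p))) + eps.
Proof.
move=> hB i_n kp; have tT := dy_in T0 (ltnW kp).
have mh : measurable_fun setT (h i q j p k).
  by have /andP[_ tT'] := tT; exact: (history_meas cP D_copies tT' (h_F q j i_n kp)).
rewrite {1}/h; case: ifP => [kJ|kJ]; last first.
  rewrite mul0r mulr0 add0r; split; first exact: L2_cst.
  by rewrite /h kJ; under eq_Rintegral do rewrite expr0n; rewrite E_cst.
have [Z [lZ Z0 EZ' GZ]] := cmp i_n kp.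
set t := dy T p k in tT GZ *.
have lb l : (l < n)%N -> L1 P (fun w => \1_(A t) w * lpart (e l ^~ w) t ^+ 2) /\
    E (fun w => \1_(A t) w * lpart (e l ^~ w) t ^+ 2) <= B * expR (lam * (k%:R / 2 ^+ p)).
  by move=> ln; exact: left_bound.
pose W w := C * (\1_(A t) w * lpart (e i ^~ w) t ^+ 2 +
   \sum_(l < n) n%:R^-1 * (\1_(A t) w * lpart (e l ^~ w) t ^+ 2)) + Z w.
have lS : L1 P (fun w => \sum_(l < n) n%:R^-1 * (\1_(A t) w * lpart (e l ^~ w) t ^+ 2)).
  by apply: L1_sum => l _; apply: L1Z; case: (lb l).
have li : L1 P (fun w => \1_(A t) w * lpart (e i ^~ w) t ^+ 2) by case: (lb i).
have lW : L1 P W by apply: L1D => //; apply: L1Z; exact: L1D.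
have hW : {ae P, forall w, h i q j p k w ^+ 2 <= W w}.
  apply: filterS GZ => w hw; rewrite /h kJ /W -/t indicE.
  have [_|_] := boolP (w \in A t).
    rewrite !mul1r; under eq_bigr do rewrite mul1r; exact: hw.
  rewrite !mul0r expr0n/=; under eq_bigr do rewrite mul0r mulr0.
  by rewrite big1// addr0 mulr0 add0r.
have lh : L1 P (fun w => h i q j p k w ^+ 2).
  apply: (L1_le_ae _ lW); first exact: measurable_funX.
  by apply: filterS hW => w hw; rewrite ger0_norm ?sqr_ge0.
split; first by rewrite /h kJ in mh lh *; split.
apply: (le_trans (E_le_ae lh lW hW)).
rewrite /W ED//; last by apply: L1Z; exact: L1D.
rewrite EZ; last exact: L1D.
rewrite ED//; apply: lerD => //.
rewrite E_sum; last by move=> l _; apply: L1Z; case: (lb l).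
set b := B * _ in lb *.
rewrite mul1r -mulrA -mulrA (mulrCA 2) -/b ler_wpM2l//.
have bi : E (fun w => \1_(A t) w * lpart (e i ^~ w) t ^+ 2) <= b by case: (lb i).
have : \sum_(l < n) E (fun w => n%:R^-1 * (\1_(A t) w * lpart (e l ^~ w) t ^+ 2)) <= b.
  apply: (@le_trans _ _ (\sum_(l < n) n%:R^-1 * b)).
    apply: ler_sum => l _; have [l1 l2] := lb l (ltn_ord l).
    by rewrite EZ// ler_wpM2l// invr_ge0.
  rewrite sumr_const card_ord -(mulr_natr (_ * _)) mulrAC mulVf ?mul1r//.
  by rewrite pnatr_eq0 -lt0n.
lra.
Qed.

Let bad (H : R -> Omega -> R) (u : R -> Omega -> R) i q j Q p c l : set Omega :=
  [set w | c <= `|incrs H i p (j * l * 2 ^ (p - (q + Q))) w -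
                   (u (dy T (q + Q) (j * l)) w - ini (D i) w)|].

Let ini_meas i : measurable_fun setT (ini (D i)).
Proof. by have [/(_ i)[]] := D_copies. Qed.

Let jl_le q j Q l : (j <= 2 ^ q)%N -> (l <= 2 ^ Q)%N -> (j * l <= 2 ^ (q + Q))%N.
Proof. by move=> jq lQ; rewrite expnD leq_mul. Qed.

Let bad_y i q j Q l (dl c : R) : (i < n)%N -> (j <= 2 ^ q)%N -> (l <= 2 ^ Q)%N -> 0 < dl -> 0 < c ->
  exists N, forall p, (N <= p)%N -> (q + Q <= p)%N ->
    (P (bad (Hy i) (y i) i q j Q p c l) <= dl%:E)%E.
Proof.
move=> i_n jq lQ dl0 c0.
have Imeas t : 0 <= t <= T -> measurable_fun setT (fun w => y i t w - ini (D i) w).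
  move=> /[dup] tT /andP[_ tT']; apply: measurable_funB => //.
  exact: (history_meas cP D_copies tT' (y_F i_n tT)).
have Iright : {ae P, forall w t, 0 <= t < T ->
    y i s w - ini (D i) w @[s --> t^'+] --> y i t w - ini (D i) w}.
  apply: filterS (y_cadlag i_n) => w [c1 _] t tT.
  by apply: cvgB; [exact: c1|exact: cvg_cst].
have HF p k : (k < 2 ^ p)%N -> meas_wrt (history P D J (dy T p k)) (Hy i (dy T p k)).
  by move=> kp; apply: Hy_F => //; apply: dy_in => //; exact: ltnW.
exact: (riemann_cvg cP T0 D0_driver D0_sqint D_copies i_n HF (Hy_bounded i_n)
  (Hy_left i_n) Imeas Iright (y_ito i_n) (jl_le jq lQ) dl0 c0).
Qed.

Let bad_x i q j Q l (dl c : R) : (i < n)%N -> (j <= 2 ^ q)%N -> (l <= 2 ^ Q)%N -> 0 < dl -> 0 < c ->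
  exists N, forall p, (N <= p)%N -> (q + Q <= p)%N ->
    (P (bad (Hx i) (x i) i q j Q p c l) <= dl%:E)%E.
Proof.
move=> i_n jq lQ dl0 c0.
have Imeas t : 0 <= t <= T -> measurable_fun setT (fun w => x i t w - ini (D i) w).
  move=> /[dup] tT /andP[_ tT']; apply: measurable_funB => //.
  exact: (history_meas cP D_copies tT' (x_F i_n tT)).
have Iright : {ae P, forall w t, 0 <= t < T ->
    x i s w - ini (D i) w @[s --> t^'+] --> x i t w - ini (D i) w}.
  apply: filterS (x_cadlag i_n) => w [c1 _] t tT.
  by apply: cvgB; [exact: c1|exact: cvg_cst].
have HF p k : (k < 2 ^ p)%N -> meas_wrt (history P D J (dy T p k)) (Hx i (dy T p k)).
  by move=> kp; apply: Hx_F => //; apply: dy_in => //; exact: ltnW.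
exact: (riemann_cvg cP T0 D0_driver D0_sqint D_copies i_n HF (Hx_bounded i_n)
  (Hx_left i_n) Imeas Iright (x_ito i_n) (jl_le jq lQ) dl0 c0).
Qed.

(** [riemann_cvg] gives a rank for each time separately; finitely many times allow a common level
    p. *)
Let bad_both i q j Q (dl c : R) : (i < n)%N -> (j <= 2 ^ q)%N -> 0 < dl -> 0 < c ->
  exists2 p, (q + Q <= p)%N & forall l, (l <= 2 ^ Q)%N ->
    (P (bad (Hy i) (y i) i q j Q p c l) <= dl%:E)%E /\
    (P (bad (Hx i) (x i) i q j Q p c l) <= dl%:E)%E.
Proof.
move=> i_n jq dl0 c0.
suff [M hM] : exists M, forall p, (M <= p)%N -> (q + Q <= p)%N -> forall l, (l <= 2 ^ Q)%N ->
    (P (bad (Hy i) (y i) i q j Q p c l) <= dl%:E)%E /\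
    (P (bad (Hx i) (x i) i q j Q p c l) <= dl%:E)%E.
  exists (M + (q + Q))%N; first exact: leq_addl.
  by apply: hM; [exact: leq_addr|exact: leq_addl].
suff H m : (m <= (2 ^ Q).+1)%N -> exists M, forall p, (M <= p)%N -> (q + Q <= p)%N ->
    forall l, (l < m)%N ->
    (P (bad (Hy i) (y i) i q j Q p c l) <= dl%:E)%E /\
    (P (bad (Hx i) (x i) i q j Q p c l) <= dl%:E)%E.
  exact: H (leqnn _).
elim: m => [_|m ih mQ]; first by exists 0%N.
have [M hM] := ih (ltnW mQ).
have [M1 h1] := bad_y i_n jq mQ dl0 c0.
have [M2 h2] := bad_x i_n jq mQ dl0 c0.
exists (maxn M (maxn M1 M2)) => p; rewrite !geq_max => /andP[p1 /andP[p2 p3]] p4 l.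
rewrite ltnS leq_eqVlt => /orP[/eqP->|lm]; last exact: hM.
by split; [exact: h1|exact: h2].
Qed.

Let incrs_meas (H : R -> Omega -> R) i p j : (j <= 2 ^ p)%N ->
  (forall k, (k < 2 ^ p)%N -> measurable_fun setT (H (dy T p k))) ->
  measurable_fun setT (incrs H i p j).
Proof.
move=> jp mH; apply: measurable_sum => k; have kp : (k < 2 ^ p)%N := leq_trans (ltn_ord k) jp.
by apply: measurable_funM; [exact: mH|exact: (incr_meas T0 D_copies)].
Qed.

Definition running t i Q w : R := \big[Num.max/0]_(l < (2 ^ Q).+1) e i (dy t Q l) w ^+ 2.

Lemma running_meas t i Q : (i < n)%N -> 0 <= t <= T -> measurable_fun setT (running t i Q).
Proof.
move=> i_n tT.
apply: (@measurable_bigmax _ _ _ _ (fun l w => e i (dy t Q l) w ^+ 2)) => l lQ.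
by apply: measurable_funX; apply: e_meas => //; exact: (inT tT (dyt_in tT lQ)).
Qed.

Lemma running_ge t i Q l w : (l <= 2 ^ Q)%N -> e i (dy t Q l) w ^+ 2 <= running t i Q w.
Proof. by move=> lQ; apply: (le_bigmax _ _ (Ordinal (lQ : (l < (2 ^ Q).+1)%N))). Qed.

Lemma running_le t i Q w (c : R) : 0 <= c ->
  (forall l, (l <= 2 ^ Q)%N -> e i (dy t Q l) w ^+ 2 <= c) -> running t i Q w <= c.
Proof. by move=> c0 h'; apply: bigmax_le => // l _; apply: h'; rewrite -ltnS. Qed.

Lemma running_ge0 t i Q w : 0 <= running t i Q w.
Proof. by apply: le_trans (running_ge t i w (leq0n _)); exact: sqr_ge0. Qed.

Lemma running_L1 t i Q : (i < n)%N -> 0 <= t <= T -> L1 P (fun w => \1_(A t) w * running t i Q w).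
Proof.
move=> i_n tT; apply: (L1_le _ (L1_cst P N)) => [|w].
  by apply: measurable_funM; [apply: measurable_indic; exact: A_meas|exact: running_meas].
rewrite indicE; have [/set_mem hA|_] := boolP (w \in A t); last by rewrite mul0r normr0.
by rewrite mul1r ger0_norm ?running_ge0//; apply: running_le => // l lQ; exact: hA.
Qed.

(** On a bad event the crude bound N is used. Elsewhere the initial values cancel and the error is
    within 2c of the difference of the two Riemann sums, which is the sum of the [h] terms; squaring
    gives 2Z + 8c^2. *)
Let pathwise_bound i q j Q p c : (i < n)%N -> (j <= 2 ^ q)%N -> (q + Q <= p)%N -> 0 < c ->
  forall Z : Omega -> R,
  (forall w m, (m <= 2 ^ p)%N -> (\sum_(k < m) h i q j p k w * incr T D i p k w) ^+ 2 <= Z w) ->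
  {ae P, forall w, \1_(A (dy T q j)) w * running (dy T q j) i Q w <=
    2 * Z w + 8 * c ^+ 2 + N * \sum_(l < (2 ^ Q).+1)
      (\1_(bad (Hy i) (y i) i q j Q p c l) w + \1_(bad (Hx i) (x i) i q j Q p c l) w)}.
Proof.
move=> i_n jq qp c0 Z hZ; set t := dy T q j.
have tT : 0 <= t <= T by exact: dy_in.
apply: filterS e_cadlag => w ew.
set S := \sum_(_ < _) _.
have S0 : 0 <= S by apply: sumr_ge0 => l _; rewrite addr_ge0.
have Z0 : 0 <= Z w by apply: le_trans (hZ w 0%N _) => //; exact: sqr_ge0.
have c8 : 0 <= 8 * c ^+ 2 by rewrite mulr_ge0 ?sqr_ge0.
have NS : 0 <= N * S by exact: mulr_ge0.
rewrite indicE; have [/set_mem At|_] := boolP (w \in A t); last by rewrite mul0r; lra.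
rewrite mul1r; apply: running_le => [|l lQ]; first by lra.
have eN : e i (dy t Q l) w ^+ 2 <= N by exact: At.
have [hb|hb] := pselect (bad (Hy i) (y i) i q j Q p c l w \/ bad (Hx i) (x i) i q j Q p c l w).
  suff S1 : 1 <= S.
    by have := ler_wpM2l N0 S1; rewrite mulr1; lra.
  rewrite /S (bigD1 (Ordinal (lQ : (l < (2 ^ Q).+1)%N)))//=.
  have h0 : 0 <= \sum_(k < (2 ^ Q).+1 | k != Ordinal (lQ : (l < (2 ^ Q).+1)%N))
      (\1_(bad (Hy i) (y i) i q j Q p c k) w + \1_(bad (Hx i) (x i) i q j Q p c k) w : R).
    by apply: sumr_ge0 => k _; rewrite addr_ge0.
  case: hb => hb; rewrite [X in X + _ + _]indicE [X in _ + X + _]indicE (mem_set hb).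
    by case: (_ \in _) => /=; lra.
  by case: (w \in bad (Hy i) _ _ _ _ _ _ _ _) => /=; lra.
have qp' : (q <= p)%N by apply: leq_trans qp; exact: leq_addr.
pose m := (j * l * 2 ^ (p - (q + Q)))%N.
have mJ : (m <= j * 2 ^ (p - q))%N.
  rewrite /m -mulnA leq_mul2l; apply/orP; right.
  by rewrite (subn_add_split qp) expnD leq_mul2r lQ orbT.
have Jp : (j * 2 ^ (p - q) <= 2 ^ p)%N.
  by rewrite (expn_split qp') leq_mul2r jq orbT.
have hE : \sum_(k < m) h i q j p k w * incr T D i p k w =
    incrs (Hy i) i p m w - incrs (Hx i) i p m w.
  rewrite /incrs -sumrB; apply: eq_bigr => k _; rewrite -mulrBl /h.
  have kJ : (k < j * 2 ^ (p - q))%N by exact: leq_trans mJ.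
  have Ak : A (dy T p k) w.
    apply: (A_mono tT ew _ At); rewrite dy_ge0//=.
    rewrite /t (@dy_refine _ T q p j)//.
    by rewrite dy_le// ltnW.
  by rewrite kJ indicE mem_set// mul1r.
have := hZ w m (leq_trans mJ Jp); rewrite hE.
have := hb; rewrite /bad /= => /not_orP[/negP + /negP].
rewrite -!ltNge -/m -dy_dy -/t.
set a := incrs _ _ _ _ _; set b := incrs _ _ _ _ _.
rewrite !ltr_norml => /andP[a1 a2] /andP[b1 b2] hab.
set s := dy t Q l in a1 a2 b1 b2 *.
pose v := a - b - e i s w.
have hv : e i s w = (a - b) - v by rewrite /v; ring.
have vc : `|v| <= 2 * c by rewrite ler_norml /v /e; apply/andP; split; lra.
have v2 : v ^+ 2 <= (2 * c) ^+ 2.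
  by rewrite -real_normK ?num_real// lerXn2r ?nnegrE// mulr_ge0// ltW.
rewrite hv; have := sqr_ge0 (a - b + v).
by move: v2 hab; move: (a - b) => u; nra.
Qed.

Lemma pbound_running B i q j Q : 0 <= B -> pbound B -> (i < n)%N -> (j <= 2 ^ q)%N ->
  E (fun w => \1_(A (dy T q j)) w * running (dy T q j) i Q w) <=
  (B / 2 + 2 * kmax * eps) * expR (lam * (j%:R / 2 ^+ q)).
Proof.
move=> B0 hB i_n jq; set t := dy T q j; set EX := expR _.
have tT : 0 <= t <= T by exact: dy_in.
have EX1 : 1 <= EX.
  by rewrite /EX -(@expR0 R) ler_expR mulr_ge0 ?(ltW lam0)// divr_ge0// ltW// exp2_gt0.
apply/ler_addgt0Pr => eta eta0.
(* Then 8c^2 = eta / 2. *)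
pose c := Num.sqrt (eta / 16).
have c2 : c ^+ 2 = eta / 16 by rewrite sqr_sqrtr// divr_ge0// ltW.
have c0 : 0 < c by rewrite sqrtr_gt0 divr_gt0.
(* Each of the 2^Q + 1 times contributes two bad events of probability at most eta / K, so N times
   their total is at most eta / 2. *)
pose K : R := 4 * (N + 1) * (2 ^ Q).+1%:R.
have K0' : 0 < K by rewrite !mulr_gt0// ltr_wpDl.
pose dl := eta / K; have dl0 : 0 < dl by exact: divr_gt0.
have [p qp hbad] := bad_both Q i_n jq dl0 c0.
have qp' : (q <= p)%N by apply: leq_trans qp; exact: leq_addr.
have hF k : (k < 2 ^ p)%N -> meas_wrt (history P D J (dy T p k)) (h i q j p k) by exact: h_F.
have hL k : (k < 2 ^ p)%N -> L2 P (h i q j p k) by move=> kp; case: (h_bound q j hB i_n kp).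
have [Z [lZ hZ EZ']] := dyadic_doob cP T0 D0_driver D0_sqint D_copies (i_n : J i) hF hL.
have mlt l : (l < (2 ^ Q).+1)%N -> (j * l * 2 ^ (p - (q + Q)) <= 2 ^ p)%N.
  rewrite ltnS => lQ.
  by rewrite (expn_split qp) leq_mul2r jl_le// orbT.
have mbad (H u : R -> Omega -> R) l : (l < (2 ^ Q).+1)%N ->
    (forall s, 0 <= s <= T -> measurable_fun setT (H s)) ->
    (forall s, 0 <= s <= T -> measurable_fun setT (u s)) ->
    measurable (bad H u i q j Q p c l).
  move=> lQ mH mu; apply: meas_set_le; first exact: measurable_cst.
  apply: measurableT_comp => //; apply: measurable_funB.
    by apply: incrs_meas => [|k kp]; [exact: mlt|apply: mH; apply: dy_in => //; exact: ltnW].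
  by apply: measurable_funB => //; apply: mu; apply: dy_in => //; exact: jl_le.
have mby l : (l < (2 ^ Q).+1)%N -> measurable (bad (Hy i) (y i) i q j Q p c l).
  move=> lQ; apply: mbad => // s /[dup] sT /andP[_ sT'].
    exact: (history_meas cP D_copies sT' (Hy_F i_n sT)).
  exact: (history_meas cP D_copies sT' (y_F i_n sT)).
have mbx l : (l < (2 ^ Q).+1)%N -> measurable (bad (Hx i) (x i) i q j Q p c l).
  move=> lQ; apply: mbad => // s /[dup] sT /andP[_ sT'].
    exact: (history_meas cP D_copies sT' (Hx_F i_n sT)).
  exact: (history_meas cP D_copies sT' (x_F i_n sT)).
have l1 (l : 'I_(2 ^ Q).+1) : L1 P (fun w => \1_(bad (Hy i) (y i) i q j Q p c l) w +
    \1_(bad (Hx i) (x i) i q j Q p c l) w : R).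
  by apply: L1D; apply: L1_indic; [exact: mby|exact: mbx].
have lS : L1 P (fun w => \sum_(l < (2 ^ Q).+1)
      (\1_(bad (Hy i) (y i) i q j Q p c l) w + \1_(bad (Hx i) (x i) i q j Q p c l) w)).
  by apply: L1_sum => l _.
have ES : E (fun w => \sum_(l < (2 ^ Q).+1)
      (\1_(bad (Hy i) (y i) i q j Q p c l) w + \1_(bad (Hx i) (x i) i q j Q p c l) w)) <=
    (2 ^ Q).+1%:R * (2 * dl).
  rewrite E_sum//; apply: (@le_trans _ _ (\sum_(l < (2 ^ Q).+1) (2 * dl))); last first.
    by rewrite sumr_const card_ord -(mulr_natl (2 * dl)).
  apply: ler_sum => l _; have [h1 h2] := hbad l (ltn_ord l).
  rewrite ED; [|by apply: L1_indic; exact: mby|by apply: L1_indic; exact: mbx].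
  rewrite !E_indic//; [|exact: mbx|exact: mby].
  have fle (X : set Omega) : measurable X -> (P X <= dl%:E)%E -> fine (P X) <= dl.
    by move=> mX hX; rewrite -lee_fin fineK// fin_num_measure.
  by have := fle _ (mby _ (ltn_ord l)) h1; have := fle _ (mbx _ (ltn_ord l)) h2; lra.
have lR : L1 P (fun w => 2 * Z w + 8 * c ^+ 2 + N * \sum_(l < (2 ^ Q).+1)
      (\1_(bad (Hy i) (y i) i q j Q p c l) w + \1_(bad (Hx i) (x i) i q j Q p c l) w)).
  by apply: L1D; [apply: L1D; [exact: L1Z|exact: L1_cst]|exact: L1Z].
apply: (le_trans (E_le_ae (running_L1 Q i_n tT) lR (pathwise_bound i_n jq qp c0 hZ))).
rewrite ED; [|by apply: L1D; [exact: L1Z|exact: L1_cst]|exact: L1Z].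
rewrite ED; [|exact: L1Z|exact: L1_cst].
rewrite EZ// E_cst EZ// c2.
have hN : N * ((2 ^ Q).+1%:R * (2 * dl)) <= eta / 2.
  have -> : eta / 2 = (N + 1) * ((2 ^ Q).+1%:R * (2 * dl)).
    have N1 : N + 1 != 0 by rewrite gt_eqF// ltr_wpDl.
    have M1 : (2 ^ Q).+1%:R != 0 :> R by rewrite pnatr_eq0.
    rewrite /dl /K; move: (N + 1) ((2 ^ Q).+1%:R : R) N1 M1 => a b a0 b0.
    by field; rewrite a0 b0.
  rewrite ler_wpM2r ?lerDl//; apply: mulr_ge0 => //; apply: mulr_ge0 => //; exact: ltW.
have hN' := ler_wpM2l N0 ES.
suff EZb : E Z <= kmax * (2 * C * B * (EX / lam) + eps).
  (* The contraction: the time integral of the exponential weight gains a factor 1 / lam. *)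
  have key : 4 * kmax * C / lam <= 1 / 2.
    by rewrite ler_pdivrMr// /lam; lra.
  have kB : 4 * kmax * C / lam * (B * EX) <= 1 / 2 * (B * EX).
    by rewrite ler_wpM2r// mulr_ge0// (le_trans _ EX1).
  have kE : 2 * kmax * eps * 1 <= 2 * kmax * eps * EX.
    by rewrite ler_wpM2l// !mulr_ge0.
  have e1 : 2 * (kmax * (2 * C * B * (EX / lam) + eps)) =
      4 * kmax * C / lam * (B * EX) + 2 * kmax * eps * 1 by ring.
  by lra.
apply: (le_trans EZ'); rewrite -/kmax -mulrA ler_wpM2l//.
rewrite ler_pdivrMl ?exp2_gt0//.
apply: (@le_trans _ _ (\sum_(k < 2 ^ p) (2 * C * B *
    ((k < j * 2 ^ (p - q))%N%:R * expR (lam * (k%:R / 2 ^+ p))) + eps))).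
  by apply: ler_sum => k _; have [] := h_bound q j hB i_n (ltn_ord k).
rewrite big_split/= sumr_const card_ord -(mulr_natl eps) natrX mulrDr lerD2r -mulr_sumr.
rewrite mulrCA ler_wpM2l ?mulr_ge0//.
have Jp : (j * 2 ^ (p - q) <= 2 ^ p)%N.
  by rewrite (expn_split qp') leq_mul2r jq orbT.
have -> : \sum_(k < 2 ^ p) ((k < j * 2 ^ (p - q))%N%:R * expR (lam * (k%:R / 2 ^+ p))) =
    \sum_(k < j * 2 ^ (p - q)) expR (lam * (k%:R / 2 ^+ p)).
  rewrite (big_ord_widen (2 ^ p) (fun k : nat => expR (lam * (k%:R / 2 ^+ p))) Jp).
  rewrite [RHS]big_mkcond/=; apply: eq_bigr => k _.
  by case: ifP => _; rewrite ?mul1r ?mul0r.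
have := expR_riemann p (j * 2 ^ (p - q)) lam0.
rewrite -mulr_suml ler_pdivrMr ?exp2_gt0// mulrC; move=> /le_trans; apply.
rewrite ler_wpM2l ?(ltW (exp2_gt0 _))// /EX.
have -> : (j * 2 ^ (p - q))%:R / 2 ^+ p = j%:R / 2 ^+ q :> R.
  rewrite -[in 2 ^+ p](subnK qp') exprD natrM natrX; field.
  by rewrite !gt_eqF// exp2_gt0.
by [].
Qed.

Let pbound_init : pbound N.
Proof.
move=> i q j m l i_n jq lm; have tT := dy_in T0 jq.
apply: (@le_trans _ _ N).
  rewrite -[leRHS](E_cst P); apply: E_le.
  - apply: (L1_le _ (L1_cst P N)) => [|w]; last exact: Ae_le.
    by apply: Ae_meas => //; exact: (inT tT (dyt_in tT lm)).
  - exact: L1_cst.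
  by move=> w; apply: le_trans (ler_norm _) _; exact: Ae_le.
rewrite ler_peMr// -(@expR0 R) ler_expR mulr_ge0 ?(ltW lam0)// divr_ge0// ltW// exp2_gt0.
Qed.

Let pbound_half B : 0 <= B -> pbound B -> pbound (B / 2 + 2 * kmax * eps).
Proof.
move=> B0 hB i q j m l i_n jq lm; have tT := dy_in T0 jq.
apply: le_trans (pbound_running m B0 hB i_n jq); apply: E_le.
- apply: (L1_le _ (L1_cst P N)) => [|w]; last exact: Ae_le.
  by apply: Ae_meas => //; exact: (inT tT (dyt_in tT lm)).
- exact: running_L1.
by move=> w; rewrite ler_wpM2l//; exact: running_ge.
Qed.

(** 4 * kmax * eps is the fixed point of the affine map in [pbound_half]; the distance to it is
    halved at each step. *)
Let pbound_iter k : pbound (N / 2 ^+ k + 4 * kmax * eps).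
Proof.
have ke : 0 <= 4 * kmax * eps by rewrite !mulr_ge0.
elim: k => [|k ih].
  move=> i q j m l i_n jq lm; apply: (le_trans (pbound_init i_n jq lm)).
  by rewrite expr0 divr1 ler_wpM2r ?expR_ge0// lerDl.
have B0 : 0 <= N / 2 ^+ k + 4 * kmax * eps by rewrite addr_ge0// divr_ge0// ltW// exp2_gt0.
have := pbound_half B0 ih; congr pbound.
by rewrite exprS; field; rewrite gt_eqF// exp2_gt0.
Qed.

Lemma localized_bound i Q : (i < n)%N ->
  E (fun w => \1_(tame T) w * running T i Q w) <= 4 * kmax * eps * expR lam.
Proof.
move=> i_n; apply/ler_addgt0Pr => eta eta0.
have ke : 0 <= 4 * kmax * eps by rewrite !mulr_ge0.
(* Once 2^k exceeds this ratio, the part of the bound that still depends on N is below [eta]. *)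
pose v := N * expR lam / eta.
have v0 : 0 <= v by rewrite divr_ge0 ?mulr_ge0 ?expR_ge0// ltW.
pose k := (Num.truncn v).+1.
have vk : v <= 2 ^+ k.
  have /andP[_ h'] := truncn_itv v0; apply: (le_trans (ltW h')).
  by rewrite -natrX ler_nat ltnW// ltn_expl.
have B0 : 0 <= N / 2 ^+ k + 4 * kmax * eps by rewrite addr_ge0// divr_ge0// ltW// exp2_gt0.
have := pbound_running Q B0 (pbound_iter k) i_n (leqnn (2 ^ 0)).
rewrite (dy_full T 0) natrX divff ?mulr1 ?expr0 ?oner_eq0// => /le_trans; apply.
rewrite affine_half mulrDl addrC lerD2l.
have le_eta : N / 2 ^+ k * expR lam <= eta.
  by rewrite mulrAC ler_pdivrMr ?exp2_gt0// [leRHS]mulrC -ler_pdivrMr.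
have : 0 <= N / 2 ^+ k * expR lam.
  by rewrite mulr_ge0 ?expR_ge0// divr_ge0// ltW// exp2_gt0.
by rewrite (mulrAC _ 2^-1); exact: half_le le_eta.
Qed.

End Localized.

(** The bound of [localized_bound] depends neither on N nor on the grid. A path is bounded on
    [0, T], hence eventually tame, and Fatou's lemma removes the localization. *)
Theorem gronwall_bound i : (i < n)%N ->
  (\int[P]_w supsq T (fun t => y i t w - x i t w)%R <=
   (4 * kmax * eps * expR (8 * kmax * C + 1))%:E)%E.
Proof.
move=> i_n; have TT : 0 <= T <= T by rewrite lexx ltW.
(* One index for both limits: the localization level and the grid level. *)
pose f (m : nat) w := (\1_(tame m%:R T) w * running T i m w)%:E : \bar R.
have f0 m w : (0 <= f m w)%E by rewrite lee_fin mulr_ge0// running_ge0.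
have lf m : L1 P (fun w => \1_(tame m%:R T) w * running T i m w) by exact: running_L1.
have mf m : measurable_fun setT (f m) by apply/measurable_EFinP; exact: L1_meas (lf m).
have fb m : (\int[P]_w f m w <= (4 * kmax * eps * expR (8 * kmax * C + 1))%:E)%E.
  by rewrite -EFin_E// lee_fin; exact: localized_bound.
have ei_cadlag : {ae P, forall w, cadlag T (e i ^~ w)} by apply: filterS e_cadlag => w; exact.
have msup : measurable_fun setT (fun w => supsq T (e i ^~ w)).
  apply: (supsq_measurable cP T0) => [t tT|]; first exact: e_meas.
  by apply: filterS ei_cadlag => w [c1 _] t; exact: c1.
have sup0 w : (0 <= supsq T (e i ^~ w))%E.
  by apply: le_trans (supsq_ge _ TT); rewrite lee_fin.
apply: (@le_trans _ _ (\int[P]_w limn_einf (f ^~ w))%E).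
  apply: ae_ge0_le_integral => //.
  - by move=> w _; exact: sup0.
  - move=> w _; rewrite limn_einf_lim; apply: lime_ge; first exact: is_cvg_einfs.
    by apply: nearW => m; apply: le_ereal_inf_tmp => _ [m' _ <-]; exact: f0.
  - apply: measurableT_comp => //; apply: measurable_fun_limn_esup => m.
    exact: measurableT_comp.
  apply: filterS e_cadlag => w ew _.
  have [M hM] : exists M : R, forall j, (j < n)%N -> forall s, 0 <= s <= T -> `|e j s w| <= M.
    elim: (n) ew => [|m ih] ew; first by exists 0.
    have [|M hM] := ih; first by move=> j jm; apply: ew; exact: ltnW.
    have [M' hM'] := cadlag_bounded (ew m (leqnn _)).
    exists (Num.max M M') => j; rewrite ltnS leq_eqVlt => /orP[/eqP->|jm] s sT.
      by rewrite le_max hM' ?orbT.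
    by rewrite le_max hM.
  apply: (supsq_le T0) => [t tT|p k kp]; first exact: (ew i i_n).1.
  rewrite limn_einf_lim; apply: lime_ge; first exact: is_cvg_einfs.
  (* From the level p on, [dy T p k] is a grid point; beyond M^2 the path is tame. *)
  exists (maxn p (Num.truncn (M ^+ 2)).+1) => // m /=; rewrite geq_max => /andP[pm Mm].
  apply: le_ereal_inf_tmp => _ [m' /= mm' <-].
  have pm' := leq_trans pm mm'; have Mm' := leq_trans Mm mm'.
  rewrite /f lee_fin real_normK ?num_real// indicE mem_set.
    rewrite mul1r (@dy_refine _ T p m' k)//; apply: running_ge.
    by rewrite (expn_split pm') leq_mul2r kp orbT.
  move=> j q l jn lq.
  have sT : 0 <= dy T q l <= T by exact: dy_in.
  rewrite -real_normK ?num_real//; apply: (@le_trans _ _ (M ^+ 2)).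
    by rewrite lerXn2r ?nnegrE ?hM//; apply: le_trans (hM j jn _ sT).
  have /andP[_ h'] := truncn_itv (sqr_ge0 M).
  by apply: (le_trans (ltW h')); rewrite ler_nat.
apply: (le_trans (fatou _ _ _ _)) => //.
rewrite limn_einf_lim; apply: lime_le; first exact: is_cvg_einfs.
apply: nearW => m; apply: le_trans (fb m); apply: ereal_inf_lbound.
by exists m => //=.
Qed.

End Gronwall.

(** * Stability of the particle system *)

Section SupSquare.
Context {R : realType} {disp : measure_display} {Omega : measurableType disp}.
Variable P : probability Omega R.
Hypothesis cP : measure_is_complete P.
Variable T : R.
Hypothesis T0 : 0 < T.

Lemma lpartB (f g : R -> R) t : cadlag T f -> cadlag T g -> 0 <= t <= T ->
  lpart (fun s => f s - g s) t = lpart f t - lpart g t.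
Proof.
move=> cf cg /andP[t0 tT]; have [->|t00] := eqVneq t 0; first by rewrite !lpart0.
have t1 : 0 < t <= T by rewrite lt_neqAle eq_sym t00 t0.
have cfg : cadlag T (fun s => f s - g s).
  by split => s sT; [apply: cvgB; [exact: cf.1|exact: cg.1]|
    apply: is_cvgB; [exact: cf.2|exact: cg.2]].
have h := lpart_cvg cfg t1.
have h' : f s - g s @[s --> t^'-] --> lpart f t - lpart g t.
  by apply: cvgB; exact: lpart_cvg t1.
by rewrite -(cvg_lim (@Rhausdorff R) h) -(cvg_lim (@Rhausdorff R) h').
Qed.

Variable x : R -> Omega -> R.
Hypothesis x_cadlag : {ae P, forall w, cadlag T (x ^~ w)}.
Hypothesis x_meas : forall t, 0 <= t <= T -> measurable_fun setT (x t).
Hypothesis x_fin : (\int[P]_w supsq T (x ^~ w) < +oo)%E.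

Lemma supsq_ge0 (f : R -> R) : (0 <= supsq T f)%E.
Proof. by apply: le_trans (supsq_ge f (_ : 0 <= T <= T)); rewrite ?lee_fin// lexx ltW. Qed.

Lemma supsq_L1 : L1 P (fun w => fine (supsq T (x ^~ w))).
Proof.
have ms : measurable_fun setT (fun w => supsq T (x ^~ w)).
  by apply: (supsq_measurable cP T0) => //; apply: filterS x_cadlag => w [].
have mf : measurable_fun setT (fun w => fine (supsq T (x ^~ w))) by exact: measurableT_comp.
apply: L1_lty => // [w|]; first by rewrite fine_ge0// supsq_ge0.
apply: le_lt_trans x_fin; apply: ge0_le_integral => //.
- by move=> w _; rewrite lee_fin fine_ge0// supsq_ge0.
- exact/measurable_EFinP.
move=> w _; have := supsq_ge0 (x ^~ w).
by case: (supsq T (x ^~ w)) => [a|//|//] _; rewrite ?lee_fin// leey.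
Qed.

Lemma lpart_sqr_le_supsq :
  {ae P, forall w t, 0 <= t <= T -> lpart (x ^~ w) t ^+ 2 <= fine (supsq T (x ^~ w))}.
Proof.
apply: filterS x_cadlag => w c t tT; have [M hM] := cadlag_bounded c.
have s0 := supsq_ge0 (x ^~ w).
have sM : (supsq T (x ^~ w) <= (M ^+ 2)%:E)%E.
  apply: (supsq_le T0) => [s sT|p k kp]; first exact: c.1.
  have h := hM _ (dy_in T0 kp).
  by rewrite lee_fin lerXn2r ?nnegrE// (le_trans _ h).
have sfin : supsq T (x ^~ w) \is a fin_num.
  by rewrite ge0_fin_numE//; apply: le_lt_trans sM _; exact: ltry.
have f0 : 0 <= fine (supsq T (x ^~ w)) by exact: fine_ge0.
have h : `|lpart (x ^~ w) t| <= Num.sqrt (fine (supsq T (x ^~ w))).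
  apply: (lpart_bound c tT) => s sT.
  rewrite -(ger0_norm (normr_ge0 _)) -sqrtr_sqr ler_wsqrtr//.
  by rewrite -lee_fin fineK//; exact: supsq_ge.
rewrite -real_normK ?num_real// -[leRHS]sqr_sqrtr//.
by rewrite lerXn2r ?nnegrE ?sqrtr_ge0.
Qed.

End SupSquare.

(** Here a is the coefficient along the particles, b the one along the limit copies with their
    empirical measure, c the one with the true law, and k the value of [r]. The difference a - b
    feeds the Gronwall inequality, b - c is the source. *)
Lemma coef_difference_bound {R : realType} (L M a b c u v z k : R) :
  0 <= L -> 0 <= M -> 0 <= v -> `|a - b| <= L * (`|u| + Num.sqrt v) ->
  (b - c) ^+ 2 <= z -> `|k| <= M ->
  (a - c) ^+ 2 * k ^+ 2 <= 4 * M ^+ 2 * L ^+ 2 * (u ^+ 2 + v) + 2 * M ^+ 2 * z.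
Proof.
move=> L0 M0 v0 hab hbc hk.
have k2 : k ^+ 2 <= M ^+ 2 by rewrite -real_normK ?num_real// lerXn2r ?nnegrE.
have ab2 : (a - b) ^+ 2 <= 2 * L ^+ 2 * (u ^+ 2 + v).
  rewrite -real_normK ?num_real//; apply: (@le_trans _ _ ((L * (`|u| + Num.sqrt v)) ^+ 2)).
    by rewrite lerXn2r ?nnegrE// mulr_ge0// addr_ge0// sqrtr_ge0.
  rewrite exprMn -[u ^+ 2]real_normK ?num_real//.
  have hv := sqr_sqrtr v0; set s := Num.sqrt v in hv *; rewrite -hv.
  by have := mulr_ge0 (sqr_ge0 L) (sqr_ge0 (`|u| - s)); lra.
have ac2 : (a - c) ^+ 2 <= 2 * (a - b) ^+ 2 + 2 * (b - c) ^+ 2.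
  by have := sqr_ge0 ((a - b) - (b - c)); lra.
apply: (@le_trans _ _ ((a - c) ^+ 2 * M ^+ 2)); first by rewrite ler_wpM2l ?sqr_ge0.
have -> : 4 * M ^+ 2 * L ^+ 2 * (u ^+ 2 + v) + 2 * M ^+ 2 * z =
  (2 * (2 * L ^+ 2 * (u ^+ 2 + v)) + 2 * z) * M ^+ 2 by ring.
by rewrite ler_wpM2r ?sqr_ge0//; lra.
Qed.

Section Stability.
Context {R : realType} {disp : measure_display} {Omega : measurableType disp}.
Variable P : probability Omega R.
Local Notation E f := (\int[P]_w (f w)).
Hypothesis cP : measure_is_complete P.
Variables (T : R) (d : nat) (D0 : @driver R disp Omega).
Variable D : nat -> @driver R disp Omega.
Hypothesis T0 : 0 < T.
Hypothesis D0_driver : is_driver P T d D0.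
Hypothesis D0_sqint : square_integrable P T (lev D0).
Hypothesis D_copies : independent_copies P T D0 D.
Variable r : R -> R.
Hypothesis r_gt0 : forall a : R, 0 < r a.
Hypothesis r_cont : continuous r.
Variables (sigma : R -> R -> probR R -> R) (L : R).
Hypothesis L0 : 0 <= L.
Hypothesis sigL : sigma_lip T sigma L.
Hypothesis sigma_caglad : caglad_coef T sigma.
Variables (x : nat -> R -> Omega -> R) (law : R -> probR R).
Hypothesis x_law : forall i (t : R), 0 <= t <= T ->
  is_law P (fun w => lpart (x i ^~ w) t) (law t).
Hypothesis x_fin : forall i, (\int[P]_w supsq T (x i ^~ w) < +oo)%E.
Hypothesis x_sde : forall i, sde_solution P T (history P D [set i]) (ini (D i)) (lev (D i))
  (fun t w => sigma t (lpart (x i ^~ w) t) (law t) * r (lpart (chain (D i) ^~ w) t)) (x i).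

Let S i w := fine (supsq T (x i ^~ w)).

Let x_cadlag i : {ae P, forall w, cadlag T (x i ^~ w)}. Proof. by case: (x_sde i). Qed.

Let x_meas i t : 0 <= t <= T -> measurable_fun setT (x i t).
Proof.
move=> /[dup] tT /andP[_ tT']; have [_ h _ _] := x_sde i.
exact: (history_meas cP D_copies tT' (h t tT)).
Qed.

Lemma limit_sup_L1 i : L1 P (S i).
Proof. by apply: supsq_L1 => //; exact: x_meas. Qed.

Lemma limit_sup_ge0 i w : 0 <= S i w.
Proof. by rewrite /S fine_ge0// supsq_ge0. Qed.

Lemma limit_lpart_le i : {ae P, forall w t, 0 <= t <= T -> lpart (x i ^~ w) t ^+ 2 <= S i w}.
Proof. exact: lpart_sqr_le_supsq. Qed.

Lemma limit_L2 i t : 0 <= t <= T -> L2 P (fun w => lpart (x i ^~ w) t).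
Proof. exact: (lpart_L2 (x_law i) (limit_sup_L1 i) (limit_lpart_le i)). Qed.

(** Each limit process is adapted to the history of its own driver, and histories of disjoint sets
    of drivers are independent. *)
Lemma limit_pair_indep t i j k (U : set (R * R)) (B : set R) : 0 <= t <= T ->
  k != i -> k != j -> measurable U -> measurable B ->
  P ((fun w => (lpart (x i ^~ w) t, lpart (x j ^~ w) t)) @^-1` U `&`
     (fun w => lpart (x k ^~ w) t) @^-1` B) =
  (P ((fun w => (lpart (x i ^~ w) t, lpart (x j ^~ w) t)) @^-1` U) *
   P ((fun w => lpart (x k ^~ w) t) @^-1` B))%E.
Proof.
move=> tT ki kj mU mB; have /andP[_ tT'] := tT.
have hl l : meas_wrt (history P D [set l] t) (fun w => lpart (x l ^~ w) t).
  by apply: (lpart_adapted T0 tT (x_cadlag l)); have [] := x_sde l.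
pose J : set nat := [set i; j].
have nJ : ~ J k by case => /= kE; [rewrite kE eqxx in ki|rewrite kE eqxx in kj].
have hJ l : J l -> meas_wrt (history P D J T) (fun w => lpart (x l ^~ w) t).
  move=> Jl C mC; apply: (@history_mono _ _ _ P D [set l] J _ _ _ tT'); last exact: hl.
  by move=> _ ->.
apply: (history_indep cP D_copies nJ (J' := [set k]) (fun l lk => lk)); last first.
  by apply: (@history_mono _ _ _ P D [set k] [set k] _ _ (@subset_refl _ _) tT'); exact: hl.
pose HT : measurableType _ := g_sigma_algebraType
  (preimages (\bigcup_(l in J) observed (D l) T) `|` P.-negligible).
have m1 : measurable_fun (setT : set HT) (fun w => lpart (x i ^~ w) t).
  by apply/meas_wrtP; apply: hJ; left.
have m2 : measurable_fun (setT : set HT) (fun w => lpart (x j ^~ w) t).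
  by apply/meas_wrtP; apply: hJ; right.
have m12 : measurable_fun (setT : set HT) (fun w => (lpart (x i ^~ w) t, lpart (x j ^~ w) t)).
  by apply/measurable_fun_pairP; split.
by have := m12 measurableT U mU; rewrite setTI.
Qed.

Let Hx i t w := sigma t (lpart (x i ^~ w) t) (law t) * r (lpart (chain (D i) ^~ w) t).

Let mul_left (f g : R -> Omega -> R) :
  {ae P, forall w s, 0 < s <= T -> f u w @[u --> s^'-] --> f s w} ->
  {ae P, forall w s, 0 < s <= T -> g u w @[u --> s^'-] --> g s w} ->
  {ae P, forall w s, 0 < s <= T -> f u w * g u w @[u --> s^'-] --> f s w * g s w}.
Proof. by move=> + hg; apply: filterS2 hg => w hg hf s sT; apply: cvgM; [exact: hf|exact: hg]. Qed.

Let mul_bounded (f g : R -> Omega -> R) (M : R) :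
  {ae P, forall w, exists M : R, forall s, 0 <= s <= T -> `|f s w| <= M} ->
  {ae P, forall w s, 0 <= s <= T -> `|g s w| <= M} ->
  {ae P, forall w, exists M : R, forall s, 0 <= s <= T -> `|f s w * g s w| <= M}.
Proof.
move=> + hg; apply: filterS2 hg => w hg [M' hM']; exists (M' * M) => s sT.
by rewrite normrM ler_pM// ?hM' ?hg.
Qed.

Let mul_adapted J t (f g : Omega -> R) : meas_wrt (history P D J t) f ->
  meas_wrt (history P D J t) g -> meas_wrt (history P D J t) (fun w => f w * g w).
Proof.
move=> hf hg; apply/meas_wrtP; apply: measurable_funM.
  by have /meas_wrtP := hf.
by have /meas_wrtP := hg.
Qed.

(** The limit [x i] is integrated in the history of driver [i], the particle in that of all n
    drivers. Simple processes stay predictable in a larger history, so both can be compared in the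
    second one. *)
Let ito_mono J J' z H I : J `<=` J' -> ito_integral P T (history P D J) z H I ->
  ito_integral P T (history P D J') z H I.
Proof.
move=> JJ [A [A1 A2 A3]]; exists A; split => // m; have [g h] := A1 m; split => // k kp.
have [hF hM] := h k kp; split => // B mB.
exact: (@history_mono _ _ _ P D J J' _ _ JJ (lexx _)) (hF _ mB).
Qed.

Let Rm := rmax d r.

(** The constant of [gronwall_bound] for C = 4 Rm^2 L^2 and a source multiplied by 2 Rm^2, as given
    by [coef_difference_bound]. It does not depend on n. *)
Definition stability_constant : R :=
  4 * K0 P T D0 * (2 * Rm ^+ 2) * expR (8 * K0 P T D0 * (4 * Rm ^+ 2 * L ^+ 2) + 1).

Lemma stability_constant_ge0 : 0 <= stability_constant.
Proof.
have k0 := K0_ge0 P T D0; apply: mulr_ge0 (expR_ge0 _).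
by apply: mulr_ge0; [exact: mulr_ge0|rewrite mulr_ge0 ?sqr_ge0].
Qed.

(** The source enters linearly, so a bound on it, small or of order 1/n, becomes a bound of the same
    order on the particles. *)
Theorem stability n (y : nat -> R -> Omega -> R) (eps : R) : (0 < n)%N -> 0 <= eps ->
  particle_system P T sigma r D n y ->
  (forall i t, (i < n)%N -> 0 <= t <= T -> exists Z : Omega -> R, [/\ L1 P Z, E Z <= eps &
    forall w, (sigma t (lpart (x i ^~ w) t) (empirical n (fun j => lpart (x j ^~ w) t)) -
               sigma t (lpart (x i ^~ w) t) (law t)) ^+ 2 <= Z w]) ->
  forall i, (i < n)%N ->
    (\int[P]_w supsq T (fun t => y i t w - x i t w)%R <= (stability_constant * eps)%:E)%E.
Proof.
move=> n0 eps0 ysol lln i i_n.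
have y_cadlag j : (j < n)%N -> {ae P, forall w, cadlag T (y j ^~ w)} by move=> /ysol[].
have y_cadlags : {ae P, forall w j, (j < n)%N -> cadlag T (y j ^~ w)}.
  apply: ae_foralln => j; have [jn|jn] := ltnP j n; last exact: aeW.
  by apply: filterS (y_cadlag j jn) => w.
have x_cadlags : {ae P, forall w j, cadlag T (x j ^~ w)} by exact: ae_foralln.
have y_F j t : (j < n)%N -> 0 <= t <= T -> meas_wrt (history P D `I_n t) (y j t).
  by move=> /ysol[_ + _ _]; exact.
have jI j : (j < n)%N -> [set j] `<=` `I_n by move=> jn _ ->.
have x_F j t : (j < n)%N -> 0 <= t <= T -> meas_wrt (history P D `I_n t) (x j t).
  move=> jn tT B mB; have [_ h _ _] := x_sde j.
  exact: (@history_mono _ _ _ P D [set j] `I_n _ _ (jI _ jn) (lexx _)) (h t tT B mB).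
pose Hy j t w := sigma t (lpart (y j ^~ w) t) (empirical n (fun l => lpart (y l ^~ w) t)) *
  r (lpart (chain (D j) ^~ w) t).
have Rm0 : 0 <= Rm := rmax_ge0 d r_gt0.
have cb j := chain_bound T0 D0_driver D_copies r_gt0 j.
have cl j := chain_coef_left D_copies r_cont j.
have Hy_F j t : (j < n)%N -> 0 <= t <= T -> meas_wrt (history P D `I_n t) (Hy j t).
  move=> jn tT; apply: mul_adapted.
    exact: (sigma_empirical_adapted T0 L0 sigL n0 y_cadlags jn tT).
  exact: (chain_coef_adapted T0 D_copies r_cont jn tT).
have Hx_F j t : (j < n)%N -> 0 <= t <= T -> meas_wrt (history P D `I_n t) (Hx j t).
  move=> jn tT; apply: mul_adapted.
    exact: (sigma_law_adapted T0 sigL (x_cadlag j) (x_law j) (limit_sup_L1 j) (limit_lpart_le j)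
      tT (fun s sT => x_F j s jn sT)).
  exact: (chain_coef_adapted T0 D_copies r_cont jn tT).
have Hy_bounded j : (j < n)%N -> {ae P, forall w, exists M : R, forall s, 0 <= s <= T -> `|Hy j s w| <= M}.
  move=> jn; apply: mul_bounded (cb j).
  exact: (sigma_empirical_path_bounded L0 sigL sigma_caglad n0 y_cadlags jn).
have Hx_bounded j : (j < n)%N -> {ae P, forall w, exists M : R, forall s, 0 <= s <= T -> `|Hx j s w| <= M}.
  move=> jn; apply: mul_bounded (cb j).
  exact: (sigma_law_path_bounded L0 sigL sigma_caglad (x_cadlag j) (x_law j) (limit_sup_L1 j) (limit_lpart_le j)).
have Hy_left j : (j < n)%N -> {ae P, forall w s, 0 < s <= T -> Hy j u w @[u --> s^'-] --> Hy j s w}.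
  move=> jn; apply: mul_left (cl j).
  exact: (sigma_empirical_path_left L0 sigL sigma_caglad n0 y_cadlags jn).
have Hx_left j : (j < n)%N -> {ae P, forall w s, 0 < s <= T -> Hx j u w @[u --> s^'-] --> Hx j s w}.
  move=> jn; apply: mul_left (cl j).
  exact: (sigma_law_path_left sigL sigma_caglad (x_cadlag j) (x_law j) (limit_sup_L1 j) (limit_lpart_le j)).
have y_ito j : (j < n)%N ->
    ito_integral P T (history P D `I_n) (lev (D j)) (Hy j) (fun t w => y j t w - ini (D j) w).
  by move=> /ysol[].
have x_ito j : (j < n)%N ->
    ito_integral P T (history P D `I_n) (lev (D j)) (Hx j) (fun t w => x j t w - ini (D j) w).
  by move=> jn; apply: (ito_mono (jI _ jn)); case: (x_sde j).
pose C := 4 * Rm ^+ 2 * L ^+ 2.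
have C0 : 0 <= C by rewrite !mulr_ge0 ?sqr_ge0.
pose eps' := 2 * Rm ^+ 2 * eps.
have eps'0 : 0 <= eps' by rewrite !mulr_ge0 ?sqr_ge0.
have cmp j p k : (j < n)%N -> (k < 2 ^ p)%N ->
  exists Z : Omega -> R, [/\ L1 P Z, forall w, 0 <= Z w, E Z <= eps' &
    {ae P, forall w, (Hy j (dy T p k) w - Hx j (dy T p k) w) ^+ 2 <=
      C * (lpart (fun t => y j t w - x j t w) (dy T p k) ^+ 2 +
           \sum_(l < n) n%:R^-1 * lpart (fun t => y l t w - x l t w) (dy T p k) ^+ 2) + Z w}].
  move=> jn kp; have tT := dy_in T0 (ltnW kp); set t := dy T p k in tT *.
  have [Z [lZ EZ' hZ]] := lln j t jn tT.
  have r2 : 0 <= 2 * Rm ^+ 2 by rewrite mulr_ge0 ?sqr_ge0.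
  exists (fun w => 2 * Rm ^+ 2 * Z w); split.
  - exact: L1Z.
  - by move=> w; rewrite mulr_ge0// (le_trans _ (hZ w)) ?sqr_ge0.
  - by rewrite EZ// ler_wpM2l.
  apply: filterS3 (cb j) y_cadlags x_cadlags => w hc yc xc.
  rewrite (lpartB (yc j jn) (xc j) tT).
  under eq_bigr => l _ do rewrite (lpartB (yc l (ltn_ord l)) (xc l) tT).
  set av := \sum_(_ < _) _.
  have av0 : 0 <= av by apply: sumr_ge0 => l _; rewrite mulr_ge0 ?sqr_ge0.
  have h1 := sigma_empirical L0 sigL (lpart (y j ^~ w) t) (lpart (x j ^~ w) t)
    (fun l => lpart (y l ^~ w) t) (fun l => lpart (x l ^~ w) t) n0 tT.
  have h2 := hZ w; have h3 := hc t tT.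
  rewrite -/av in h1; rewrite /Hy /Hx -mulrBl exprMn /C.
  set a := sigma t _ (empirical n (fun l => lpart (y l ^~ w) t)) in h1 *.
  set b := sigma t _ (empirical n (fun l => lpart (x l ^~ w) t)) in h1 h2 *.
  set c := sigma t _ (law t) in h2 *.
  set u := lpart (y j ^~ w) t - lpart (x j ^~ w) t in h1 *.
  exact: (coef_difference_bound L0 Rm0 av0 h1 h2 h3).
apply: (le_trans (gronwall_bound cP T0 D0_driver D0_sqint D_copies n0 y_cadlag
  (fun j _ => x_cadlag j) y_F x_F Hy_F Hx_F Hy_bounded Hx_bounded Hy_left Hx_left
  y_ito x_ito C0 eps'0 cmp i_n)).
rewrite lee_fin le_eqVlt; apply/orP; left; apply/eqP.
by rewrite /stability_constant /eps' /C; ring.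
Qed.

End Stability.

(** The rank 0 is left out: for no particles [mean_sup_dist] is the supremum of the empty set, which
    is not nonnegative. *)
Lemma cvg_e0_of_bound {R : realType} (u : nat -> \bar R) :
  (forall n, (0 < n)%N -> (0 <= u n)%E) ->
  (forall e : R, 0 < e -> exists N, forall n, (N < n)%N -> (u n <= e%:E)%E) ->
  u n @[n --> \oo] --> 0%E.
Proof.
move=> u0 ue; apply/fine_cvgP.
have fin e : 0 < e -> \forall n \near \oo, (0 <= u n)%E /\ (u n <= e%:E)%E.
  move=> e0; have [N hN] := ue e e0; exists N.+1 => // n /= Nn.
  by split; [apply: u0; apply: leq_ltn_trans Nn|exact: hN].
split.
  apply: filterS (fin 1 ltr01) => n [h1 h2].
  by rewrite ge0_fin_numE// (le_lt_trans h2)// ltry.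
apply/cvgrPdist_le => e e0; apply: filterS (fin e e0) => n [h1 h2] /=.
have hf : u n \is a fin_num by rewrite ge0_fin_numE// (le_lt_trans h2)// ltry.
rewrite sub0r normrN ger0_norm ?fine_ge0//.
by rewrite -lee_fin fineK.
Qed.

Theorem proposition2p2 (R : realType) (disp : measure_display)
    (Omega : measurableType disp) (P : probability Omega R)
    (T : R) (d : nat)
    (sigma : R -> R -> probability (measurableTypeR R) R -> R) (r : R -> R)
    (D0 : @driver R disp Omega) (D : nat -> @driver R disp Omega)
    (xn : nat -> nat -> R -> Omega -> R) (x : nat -> R -> Omega -> R)
    (complete_P : measure_is_complete P)
    (T_gt0 : 0 < T)
    (r_gt0 : forall a : R, 0 < r a)
    (r_cont : continuous r)
    (D0_driver : is_driver P T d D0)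
    (D0_sqint : square_integrable P T (lev D0))
    (D_copies : independent_copies P T D0 D)
    (sigma_lip : lipschitz_coef T sigma)
    (sigma_caglad : caglad_coef T sigma)
    (sigma_sqint : (\int[lebesgue_measure]_(s in `[0%R, T])
      (`|sigma s 0%R \d_(0%R : measurableTypeR R)| ^+ 2)%:E < +oo)%E)
    (xn_sol : forall n, (0 < n)%N -> particle_system P T sigma r D n (xn n))
    (x_sol : limit_processes P T sigma r D x) :
  mean_sup_dist P T n (xn n) x @[n --> \oo] --> 0%E /\
  (forall eta : R -> R -> R -> R,
     lipschitz_kernel T eta -> caglad_kernel T eta ->
     (forall (t a : R) (nu : probability (measurableTypeR R) R),
        0 <= t <= T -> P2 nu -> sigma t a nu = \int[nu]_b eta t a b) ->
     exists C : R, forall n, (0 < n)%N ->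
       (mean_sup_dist P T n (xn n) x <= (C / n%:R)%:E)%E).
Proof.
have [L [L0 sigL]] := lipschitz_sigma_lip sigma_lip.
have [law [x_law x_sol2]] := x_sol.
have x_fin i : (\int[P]_w supsq T (x i ^~ w) < +oo)%E by case: (x_sol2 i).
have x_sde i := (x_sol2 i).2.
pose S w := fine (supsq T (x 0%N ^~ w)).
have lS : L1 P S := limit_sup_L1 complete_P T_gt0 D_copies x_fin x_sde 0.
have S0 w : 0 <= S w := limit_sup_ge0 T_gt0 x 0 w.
have xS := limit_lpart_le T_gt0 x_sde.
have X2 i t : 0 <= t <= T -> L2 P (fun w => lpart (x i ^~ w) t).
  by move=> tT; exact: (limit_L2 complete_P T_gt0 D_copies x_law x_fin x_sde i tT).
have Xind t i j k (U : set (R * R)) (B : set R) : 0 <= t <= T -> k != i -> k != j ->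
    measurable U -> measurable B ->
  P ((fun w => (lpart (x i ^~ w) t, lpart (x j ^~ w) t)) @^-1` U `&`
     (fun w => lpart (x k ^~ w) t) @^-1` B) =
  (P ((fun w => (lpart (x i ^~ w) t, lpart (x j ^~ w) t)) @^-1` U) *
   P ((fun w => lpart (x k ^~ w) t) @^-1` B))%E.
  exact: (limit_pair_indep complete_P T_gt0 D_copies x_sde).
pose K := stability_constant P T d D0 r L.
have K0 : 0 <= K := stability_constant_ge0 P T d D0 r L.
have reduction n (eps : R) : (0 < n)%N -> 0 <= eps ->
  (forall i t, (i < n)%N -> 0 <= t <= T -> exists Z : Omega -> R, [/\ L1 P Z, \int[P]_w Z w <= eps &
    forall w, (sigma t (lpart (x i ^~ w) t) (empirical n (fun j => lpart (x j ^~ w) t)) -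
               sigma t (lpart (x i ^~ w) t) (law t)) ^+ 2 <= Z w]) ->
  (mean_sup_dist P T n (xn n) x <= (K * eps)%:E)%E.
  move=> n0 eps0 lln; apply: ge_ereal_sup => _ [i i_n <-].
  exact: (stability complete_P T_gt0 D0_driver D0_sqint D_copies r_gt0 r_cont L0 sigL
    sigma_caglad x_law x_fin x_sde n0 eps0 (xn_sol n n0) lln i_n).
split.
  apply: cvg_e0_of_bound => [n n0|e e0].
    apply: (@le_trans _ _ (\int[P]_w supsq T (fun t => xn n 0%N t w - x 0%N t w)%R)%E).
      by apply: integral_ge0 => w _; exact: supsq_ge0.
    by apply: ereal_sup_ubound; exists 0%N.
  have K1 : 0 < K + 1 by rewrite ltr_wpDl.
  have [||||||N hN] := @uniform_lln _ _ _ P T sigma L L0 sigL `[0, T]%classic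
    (fun t j w => lpart (x j ^~ w) t) law S _ _ _ _ lS S0 _ (e / (K + 1)).
  - by [].
  - by move=> t j; rewrite /= in_itv/=; exact: x_law.
  - by move=> t j; rewrite /= in_itv/=; exact: X2.
  - by move=> t i j k U B; rewrite /= in_itv/=; exact: Xind.
  - move=> t; rewrite /= in_itv/= => tT; apply: filterS (xS 0%N) => w; exact.
  - exact: divr_gt0.
  exists N => n Nn; have n0 : (0 < n)%N by apply: leq_ltn_trans Nn.
  have ek : 0 <= e / (K + 1) by rewrite divr_ge0// ltW.
  apply: (le_trans (reduction n (e / (K + 1)) n0 ek _)).
    move=> i t i_n tT; have tI : `[0, T]%classic t by rewrite /= in_itv.
    have [Z [lZ EZ hZ]] := hN n t Nn tI.
    by exists Z; split => // w; exact: hZ.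
  by rewrite lee_fin mulrA ler_pdivrMr// mulrC ler_wpM2l ?(ltW e0)// lerDl ler01.
move=> eta [Le hLe] _ sigma_eta.
pose s2 := \int[P]_w S w.
have s20 : 0 <= s2 by exact: E_ge0.
(* The constant of [kernel_lln] with the second moment at time t replaced by the expectation of [S],
   which dominates it for all t. The absolute value is there because [Le] is not assumed
   nonnegative. *)
exists (K * (4 * `|Le| ^+ 2 * s2)) => n n0.
have n0' : 0 < n%:R :> R by rewrite ltr0n.
rewrite -mulrA; apply: reduction => //.
  apply: divr_ge0; last exact: ltW.
  by apply: mulr_ge0 => //; rewrite mulr_ge0 ?sqr_ge0.
move=> i t i_n tT.
have kL a b a' b' : `|eta t a b - eta t a' b'| <= `|Le| * (`|a - a'| + `|b - b'|).
  by apply: (le_trans (hLe t tT _ _ _ _)); rewrite ler_wpM2r// ?addr_ge0// ler_norm.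
have [lZ EZ] := kernel_lln (normr_ge0 Le) kL n0 (fun j => x_law j t tT) (fun j => X2 j t tT)
  (fun i j k U B h1 h2 => @Xind t i j k U B tT h1 h2) i.
exists (fun w => (\int[empirical n (fun j => lpart (x j ^~ w) t)]_b eta t (lpart (x i ^~ w) t) b -
  \int[law t]_b eta t (lpart (x i ^~ w) t) b) ^+ 2); split => //.
  apply: (le_trans EZ); rewrite ler_wpM2r ?invr_ge0 ?(ltW n0')//.
  apply: ler_wpM2l; first by rewrite mulr_ge0 ?sqr_ge0.
  apply: E_le_ae => //; first by have [] := X2 0%N t tT.
  by apply: filterS (xS 0%N) => w; exact.
move=> w; rewrite sigma_eta//; last exact: empirical_P2.
by rewrite sigma_eta//; exact: law_P2 (x_law i t tT) (X2 i t tT).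
Qed.
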